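(* Let $\alpha>0$ be fixed. Suppose that $g\in PW$, and for $k\in\mathbb{N}$ let $$I_k[g](x)=\sum_{j\in\mathbb{Z}}g(j)L_k(x-j),\qquad x\in\mathbb{R}.$$ Then: (i) $\displaystyle\lim_{k\to\infty}\|g-I_k[g]\|_{L_2(\mathbb{R})}=0$, and (ii) $\displaystyle\lim_{k\to\infty}|g(x)-I_k[g](x)|=0$, uniformly on $\mathbb{R}$.
   Context: Here $\mathbb{N}=\{1,2,3,\dots\}$. The Fourier transform of $g\in L_1(\mathbb{R})$ is $\hat g(\xi)=(2\pi)^{-1/2}\int_{\mathbb{R}}g(x)e^{-ix\xi}\,dx$, extended as usual to $L_2(\mathbb{R})$ and to distributions. The Paley-Wiener space is $PW=\{g\in L_2(\mathbb{R}):\hat g(\xi)=0 \text{ for a.e. } \xi\notin[-\pi,\pi]\}$. Each $g\in PW$ is identified with its continuous (in fact entire) representative, so that the values $g(x)$, $g(j)$ make sense. For $\alpha>0$ and $k\in\mathbb{N}$, put $G_k(\xi)=(-1)^k(\xi^2+\alpha^2)^{-k}$. The fundamental function of cardinal interpolation $L_k$ (which depends on $\alpha$) is the function on $\mathbb{R}$ defined by its Fourier transform $$\widehat{L_k}(\xi)=(2\pi)^{-1/2}\frac{G_k(\xi)}{\sum_{j\in\mathbb{Z}}G_k(\xi-2\pi j)}.$$ *)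

(* Defs.v *)
From mathcomp Require Import all_boot all_order all_algebra.
From mathcomp Require Import all_classical all_reals all_analysis.
From mathcomp Require Import complex.
From mathcomp.analysis.showcase Require summability.

Set Implicit Arguments.
Unset Strict Implicit.
Unset Printing Implicit Defensive.
Import Order.TTheory GRing.Theory Num.Theory.
Import numFieldNormedType.Exports.
Local Open Scope classical_set_scope.
Local Open Scope ring_scope.
Local Open Scope complex_scope.

Section Defs.
Context {R : realType}.
Local Notation C := R[i].
Local Notation mu := (@lebesgue_measure R).
Local Notation Re := (@complex.Re R).
Local Notation Im := (@complex.Im R).
Implicit Types (f g h : R -> C) (k : nat) (alpha x xi : R).

Definition ccontinuous f := continuous (Re \o f) /\ continuous (Im \o f).

Definition cmeasurable f :=
  measurable_fun setT (Re \o f) /\ measurable_fun setT (Im \o f).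

Definition cintegrable f :=
  mu.-integrable setT (EFin \o (Re \o f)) /\
  mu.-integrable setT (EFin \o (Im \o f)).

Definition cintegral f : C :=
  Rintegral mu setT (Re \o f) +i* Rintegral mu setT (Im \o f).

(* summability.sum is the unordered sum, i.e., the limit of the finite partial
   sums along the finite subsets of the index type ordered by inclusion. *)
Definition sumZ (u : int -> R) : R := summability.sum (u : int -> R^o).

Definition csumZ (u : int -> C) : C := sumZ (Re \o u) +i* sumZ (Im \o u).

(* Normc.normc is the R-valued modulus; `|_| on R[i] is R[i]-valued. *)
Definition L2norm f : \bar R :=
  'N[mu]_2%:E[(fun x => (Normc.normc (f x))%:E)]%E.

Definition inL2 f := cmeasurable f /\ (L2norm f < +oo)%E.

Definition expNi (t : R) : C := cos t -i* sin t.

(* Meaningful for f integrable. *)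
Definition fourier f xi : C :=
  ((Num.sqrt (2 * pi))^-1)%:C * cintegral (fun x => f x * expNi (x * xi)).

(* h represents the Fourier transform of g in L_2: the graph of the extension
   by continuity is the closure in L_2 x L_2 of the graph of the integral
   transform on the integrable functions of L_2. *)
Definition fourierL2 g h :=
  [/\ inL2 g, inL2 h &
    exists u : nat -> R -> C,
      [/\ forall n, cintegrable (u n) /\ inL2 (u n),
          L2norm (fun x => u n x - g x) @[n --> \oo] --> 0%E &
          L2norm (fun xi => fourier (u n) xi - h xi) @[n --> \oo] --> 0%E]].

(* The elements are the continuous representatives. *)
Definition PW g :=
  ccontinuous g /\
  exists2 h, fourierL2 g h &
    {ae mu, forall xi, ~ (- pi <= xi <= pi) -> h xi = 0}.

Definition Gk alpha k xi : R := (-1) ^+ k * (xi ^+ 2 + alpha ^+ 2) ^- k.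

Definition hatL alpha k xi : R :=
  (Num.sqrt (2 * pi))^-1 *
  (Gk alpha k xi / sumZ (fun j => Gk alpha k (xi - 2 * pi * j%:~R))).

(* L is the fundamental function of cardinal interpolation of order k. Its
   Fourier transform only determines it almost everywhere, hence the choice of
   the continuous representative. *)
Definition fundamental alpha k (L : R -> C) :=
  ccontinuous L /\ fourierL2 L (fun xi => (hatL alpha k xi)%:C).

Definition interp (L g : R -> C) x : C :=
  csumZ (fun j => g j%:~R * L (x - j%:~R)).

End Defs.

(* Main.v *)
Require Import Defs.
From mathcomp Require Import all_boot all_order all_algebra.
From mathcomp Require Import all_classical all_reals all_analysis.
From mathcomp Require Import complex measurable_realfun.
From mathcomp Require finmap.
From mathcomp Require Import ring lra zify.
Import Order.TTheory GRing.Theory Num.Theory.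
Import numFieldNormedType.Exports.
Local Open Scope classical_set_scope.
Local Open Scope ring_scope.
Local Open Scope complex_scope.

(** Write h for the Fourier transform of g, which vanishes almost everywhere outside
    [-pi, pi]. The Fourier transform of L_k is (2 pi)^(-1/2) m_k, where m_k = phi^k / S_k is
    a multiplier with values in [0, 1], phi(x) = 1 / (x^2 + alpha^2), and S_k is the
    2 pi-periodization of phi^k. Hence the translates m_k(t + 2 pi j), for j integral,
    sum to 1.

    Fourier inversion ([fourier_inversion], obtained from Abel means and the Poisson
    kernel) writes both g(j) and L_k(x - j) as Fourier coefficients on the period: the
    former of h, the latter of
<<
      P_x(t) = sum over j of m_k(t + 2 pi j) e^(ix(t + 2 pi j)),
>>
    by cutting the line into periods ([fundamental_translate]). The function P_x is Lipschitz
    and periodic, so Chernoff's telescoping argument shows that its Fourier series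
    converges boundedly. This gives Parseval's identity ([parseval_pairing]) for integrable
    h, and therefore the closed form of the interpolant ([interpE])
<<
      I_k[g](x) = (2 pi)^(-1/2) integral over the period of h(t) P_x(t).
>>
    As g(x) is the same integral with e^(ixt) in place of P_x(t), the error is the integral
    of h(t) (e^(ixt) - P_x(t)). Since P_x is an average of unimodular numbers in which
    e^(ixt) has weight m_k(t), this difference is at most 2 (1 - m_k(t)), whatever x
    ([Psum_near]).

    For |t| < pi the translate of t nearest to the origin is t itself, so the other terms of
    S_k(t) are smaller than phi(t)^k by a factor that decreases geometrically in k, and
    m_k(t) tends to 1 ([mult_cvg1]). Dominated convergence then makes the uniform bound
    [error_sup] tend to 0.

    For the L2 norm, replacing x by x + j multiplies the integrand of the error by the
    character e^(ijt). The errors on a lattice x + Z are thus the Fourier coefficients of a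
    single function, and Bessel's inequality bounds the sum of their squares by the integral
    of |h|^2 (2 (1 - m_k))^2. Integrating over x in a unit interval bounds the squared L2
    norm of the error by the same quantity ([error_L2]), which tends to 0 as well. *)

(** * Complex modulus and the unit circle *)

Section ComplexModulus.
Context {R : realType}.
Local Notation C := R[i].
Local Notation Re := (@complex.Re R).
Local Notation Im := (@complex.Im R).
Local Notation nc := (@Normc.normc R).
Implicit Types (z w : C) (a b s t : R).

Lemma sqr_nc z : nc z ^+ 2 = Re z ^+ 2 + Im z ^+ 2.
Proof. by case: z => a b; rewrite /= sqr_sqrtr// addr_ge0 ?sqr_ge0. Qed.

Lemma nc_ge0 z : 0 <= nc z.
Proof. by case: z => a b; rewrite sqrtr_ge0. Qed.
Hint Resolve nc_ge0 : core.

Lemma ncM z w : nc (z * w) = nc z * nc w.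
Proof. exact: Normc.normcM. Qed.

Lemma ncN z : nc (- z) = nc z.
Proof. exact: normcN. Qed.

Lemma nc0 : nc 0 = 0. Proof. exact: Normc.normc0. Qed.

Lemma ncD z w : nc (z + w) <= nc z + nc w.
Proof. exact: le_normcD. Qed.

Lemma ncB z w : nc (z - w) <= nc z + nc w.
Proof. by rewrite -(ncN w); exact: ncD. Qed.

Lemma nc_eq0 z : nc z = 0 -> z = 0.
Proof. exact: Normc.eq0_normc. Qed.

Lemma ncr a : nc a%:C = `|a|.
Proof. by rewrite /= expr0n addr0 sqrtr_sqr. Qed.

Lemma Re_le_nc z : `|Re z| <= nc z.
Proof.
by rewrite -(@ler_pXn2r _ 2) ?nnegrE// real_normK ?num_real// sqr_nc lerDl sqr_ge0.
Qed.

Lemma Im_le_nc z : `|Im z| <= nc z.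
Proof.
by rewrite -(@ler_pXn2r _ 2) ?nnegrE// real_normK ?num_real// sqr_nc lerDr sqr_ge0.
Qed.

Lemma nc_le_ReIm z : nc z <= `|Re z| + `|Im z|.
Proof.
rewrite -(@ler_pXn2r _ 2) ?nnegrE ?addr_ge0// sqr_nc.
rewrite -(real_normK (num_real (Re z))) -(real_normK (num_real (Im z))).
have := mulr_ge0 (normr_ge0 (Re z)) (normr_ge0 (Im z)); nra.
Qed.

Lemma nc_conj z : nc z^* = nc z.
Proof. by case: z => a b /=; rewrite sqrrN. Qed.

Lemma nc_sum (I : Type) (s : seq I) (P : pred I) (F : I -> C) :
  nc (\sum_(i <- s | P i) F i) <= \sum_(i <- s | P i) nc (F i).
Proof.
elim/big_rec2: _ => [|i y z _ le_yz]; first by rewrite nc0.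
by apply: (le_trans (ncD _ _)); rewrite lerD2l.
Qed.

Lemma cReD z w : Re (z + w) = Re z + Re w. Proof. by case: z; case: w. Qed.
Lemma cImD z w : Im (z + w) = Im z + Im w. Proof. by case: z; case: w. Qed.
Lemma cReN z : Re (- z) = - Re z. Proof. by case: z. Qed.
Lemma cImN z : Im (- z) = - Im z. Proof. by case: z. Qed.
Lemma cReM z w : Re (z * w) = Re z * Re w - Im z * Im w.
Proof. by case: z; case: w. Qed.
Lemma cImM z w : Im (z * w) = Re z * Im w + Im z * Re w.
Proof. by case: z => a b; case: w => c d /=; rewrite mulrC addrC [b * c]mulrC addrC. Qed.
Lemma cRe_conj z : Re z^* = Re z. Proof. by case: z. Qed.
Lemma cIm_conj z : Im z^* = - Im z. Proof. by case: z. Qed.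
Lemma cRe_sum (I : Type) (s : seq I) (F : I -> C) :
  Re (\sum_(i <- s) F i) = \sum_(i <- s) Re (F i).
Proof. by elim/big_rec2: _ => [//|i y z _ <-]; rewrite cReD. Qed.
Lemma cIm_sum (I : Type) (s : seq I) (F : I -> C) :
  Im (\sum_(i <- s) F i) = \sum_(i <- s) Im (F i).
Proof. by elim/big_rec2: _ => [//|i y z _ <-]; rewrite cImD. Qed.
Lemma eq_ReIm z w : Re z = Re w -> Im z = Im w -> z = w.
Proof. by case: z => a b; case: w => c d /= -> ->. Qed.

Definition ccvg (u : nat -> C) (l : C) := nc (u n - l) @[n --> \oo] --> (0 : R).

Lemma squeeze0 (u v : nat -> R) : (forall n, 0 <= u n <= v n) ->
  v n @[n --> \oo] --> (0 : R) -> u n @[n --> \oo] --> (0 : R).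
Proof.
move=> uv v0; apply: (squeeze_cvgr _ (cvg_cst 0) v0).
by apply: nearW => n; exact: uv.
Qed.

Lemma ccvgP u l : ccvg u l <->
  (Re (u n) @[n --> \oo] --> Re l) /\ (Im (u n) @[n --> \oo] --> Im l).
Proof.
split=> [ul|[ul1 ul2]].
  split; apply/cvgrPdistC_lt => e e0; move/cvgrPdistC_lt : (ul) => /(_ _ e0);
  apply: filterS => n; rewrite subr0 ger0_norm//; apply: le_lt_trans.
  - by rewrite -cReN -cReD Re_le_nc.
  - by rewrite -cImN -cImD Im_le_nc.
apply: (@squeeze0 _ (fun n => `|Re (u n) - Re l| + `|Im (u n) - Im l|)).
  by move=> n; rewrite nc_ge0/= -cReN -cReD -cImN -cImD nc_le_ReIm.
rewrite -[0]addr0; apply: cvgD; apply/norm_cvg0P.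
- by rewrite -(subrr (Re l)); apply: cvgB => //; exact: cvg_cst.
- by rewrite -(subrr (Im l)); apply: cvgB => //; exact: cvg_cst.
Qed.

Lemma ccvg_unique u l l' : ccvg u l -> ccvg u l' -> l = l'.
Proof.
move=> /ccvgP[a b] /ccvgP[a' b']; apply: eq_ReIm.
- exact: (cvg_unique _ a a').
- exact: (cvg_unique _ b b').
Qed.

Lemma ccvg_cst l : ccvg (fun=> l) l.
Proof. by rewrite /ccvg subrr nc0; exact: cvg_cst. Qed.

Lemma ccvgD u v l m : ccvg u l -> ccvg v m -> ccvg (fun n => u n + v n) (l + m).
Proof.
move=> /ccvgP[a b] /ccvgP[a' b']; apply/ccvgP; rewrite cReD cImD.
split; under eq_fun do rewrite ?cReD ?cImD; exact: cvgD.
Qed.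

Lemma ccvgN u l : ccvg u l -> ccvg (fun n => - u n) (- l).
Proof.
move=> /ccvgP[a b]; apply/ccvgP; rewrite cReN cImN.
split; under eq_fun do rewrite ?cReN ?cImN; exact: cvgN.
Qed.

Lemma ccvgM u v l m : ccvg u l -> ccvg v m -> ccvg (fun n => u n * v n) (l * m).
Proof.
move=> /ccvgP[a b] /ccvgP[a' b']; apply/ccvgP; rewrite cReM cImM.
split; under eq_fun do rewrite ?cReM ?cImM.
- by apply: cvgB; apply: cvgM.
- by apply: cvgD; apply: cvgM.
Qed.

Lemma ccvgZ c u l : ccvg u l -> ccvg (fun n => c * u n) (c * l).
Proof. by apply: ccvgM; exact: ccvg_cst. Qed.

Lemma ccvg_nc_le u l (M : R) : ccvg u l -> (forall n, nc (u n) <= M) -> nc l <= M.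
Proof.
move=> ul uM; apply/ler_addgt0Pr => e e0.
have /cvgrPdistC_lt/(_ _ e0)[n _ /(_ n)] := ul.
rewrite /= subr0 ger0_norm// => /(_ (leqnn _))/ltW.
move=> une; have -> : nc l = nc (u n - (u n - l)) by congr (nc _); rewrite opprB addrC subrK.
by apply: (le_trans (ncB _ _)); rewrite lerD.
Qed.

Definition cis (t : R) : C := cos t +i* sin t.

Lemma cisD s t : cis (s + t) = cis s * cis t.
Proof.
rewrite /cis; apply: eq_ReIm; rewrite ?cReM ?cImM /= ?cosD ?sinD//.
by rewrite addrC.
Qed.

Lemma cis0 : cis 0 = 1.
Proof. by rewrite /cis cos0 sin0. Qed.

Lemma nc_cis t : nc (cis t) = 1.
Proof. by rewrite /= cos2Dsin2 sqrtr1. Qed.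

Lemma cisN t : cis (- t) = (cis t)^*.
Proof. by rewrite /cis cosN sinN. Qed.

Lemma expNiE t : expNi t = cis (- t).
Proof. by rewrite /cis cosN sinN. Qed.

Lemma cis_2pi : cis (2 * pi) = 1.
Proof. by rewrite /cis mulr_natl cos2pi sin2pi. Qed.

Lemma cis_2pin (n : nat) : cis (2 * pi * n%:R) = 1.
Proof.
elim: n => [|n IH]; first by rewrite mulr0 cis0.
by rewrite -[n.+1%:R]natr1 mulrDr mulr1 cisD IH cis_2pi mulr1.
Qed.

Lemma cis_2piz (n : int) : cis (2 * pi * n%:~R) = 1.
Proof.
case: n => n; first exact: cis_2pin.
rewrite NegzE mulrNz mulrN cisN -pmulrn cis_2pin.
by rewrite conjc1.
Qed.

Lemma nc_cisB1 t : nc (cis t - 1) = 2 * `|sin (t / 2)|.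
Proof.
apply/eqP; rewrite -(@eqrXn2 _ 2) ?mulr_ge0//; apply/eqP.
rewrite sqr_nc exprMn real_normK ?num_real// cReD cImD cReN cImN /=.
have -> : t = (t / 2) *+ 2 by rewrite mulr2n; field.
rewrite cos_mulr2n sin_mulr2n.
have -> : t / 2 *+ 2 / 2 = t / 2 by rewrite mulr2n; field.
have := cos2Dsin2 (t / 2); set c := cos _; set s := sin _.
rewrite !mulr2n oppr0 addr0 => h.
have -> : c ^+ 2 = 1 - s ^+ 2 by rewrite -h addrK.
have -> : (c * s + c * s) ^+ 2 = 4 * (c ^+ 2 * s ^+ 2) by ring.
have -> : c ^+ 2 = 1 - s ^+ 2 by rewrite -h addrK.
by ring.
Qed.

Lemma sin_MVT t : 0 < t -> exists2 c : R, c \in `]0, t[ & sin t = cos c * t.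
Proof.
move=> t0.
have [c ct] := @MVT R sin cos 0 t t0 (fun x _ => is_derive_sin x)
  (continuous_subspaceT (fun x => @continuous_sin R x)).
by rewrite sin0 !subr0; exists c.
Qed.

Lemma sin_le t : `|sin t| <= `|t|.
Proof.
wlog t0 : t / 0 <= t.
  move=> H; have [/H//|/ltW t0] := leP 0 t.
  by rewrite -normrN -sinN -[leRHS]normrN H// oppr_ge0.
move: t0; rewrite le_eqVlt => /predU1P[<-|t0]; first by rewrite sin0.
have [c _ ->] := sin_MVT t t0.
by rewrite normrM ler_piMl// cos_max.
Qed.

Lemma nc_cisB s t : nc (cis s - cis t) = nc (cis (s - t) - 1).
Proof.
have -> : cis s - cis t = cis t * (cis (s - t) - 1).
  by rewrite mulrBr -cisD mulr1 [t + _]addrC subrK.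
by rewrite ncM nc_cis mul1r.
Qed.

Lemma cis_lipschitz s t : nc (cis s - cis t) <= `|s - t|.
Proof.
rewrite nc_cisB nc_cisB1.
apply: (@le_trans _ _ (2 * `|(s - t) / 2|)); first by rewrite ler_wpM2l// sin_le.
by rewrite normrM (ger0_norm (_ : 0 <= 2^-1)) ?invr_ge0// mulrCA divff// mulr1.
Qed.

(** On [0, pi] the chord is 2 sin (t/2). For t <= pi/2 the mean value theorem bounds
    the sine below by t/4, the cosine being at least 1/2 on [0, pi/4]; for larger t it is
    at least sin (pi/4) >= 1/2, which suffices as pi < 4. *)
Lemma chord_lower t : `|t| <= pi -> `|t| <= 4 * nc (cis t - 1).
Proof.
wlog t0 : t / 0 <= t.
  move=> H; have [/H//|/ltW t0 tp] := leP 0 t.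
  have -> : cis t - 1 = (cis (- t) - 1)^*.
    by apply: eq_ReIm; rewrite ?(cRe_conj, cIm_conj, cReD, cImD, cReN, cImN) /= ?cosN ?sinN; ring.
  by rewrite nc_conj -normrN H ?oppr_ge0// normrN.
move: t0; rewrite le_eqVlt => /predU1P[<- _|t0]; first by rewrite normr0 mulr_ge0.
rewrite (ger0_norm (ltW t0)) => tpi; rewrite nc_cisB1.
have s0 : 0 <= sin (t / 2) by apply: sin_ge0_pi; have := pi_gt0 R; lra.
rewrite ger0_norm//.
have cq : cos (pi / 4) = sin (pi / 4) :> R.
  by rewrite -[in RHS](_ : pi / 2 - pi / 4 = pi / 4 :> R) 1?sinB ?sin_pihalf ?cos_pihalf ?mul1r ?mul0r ?subr0//; field.
have cq0 : 0 < cos (pi / 4) :> R.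
  by apply: cos_gt0_pihalf; have := pi_gt0 R; lra.
have c2 : cos (pi / 4) ^+ 2 = 2^-1 :> R.
  by have := cos2Dsin2 (pi / 4 : R); rewrite -cq; lra.
have ch : 2^-1 <= cos (pi / 4) :> R by nra.
have [tle|tlt] := leP t (pi / 2).
  have [c cin ->] := sin_MVT (t / 2) (divr_gt0 t0 (ltr0n _ 2)).
  suff : 2^-1 <= cos c by nra.
  apply: le_trans ch _; move: cin; rewrite in_itv/= => /andP[c0 ct].
  by rewrite leNgt ltr_cos ?in_itv/= -?leNgt; have := pi_gt0 R; lra.
suff : cos (pi / 4) <= sin (t / 2).
  have := pihalf_lt2 R; lra.
rewrite cq; apply: ltW; rewrite ltr_sin ?in_itv/=; have := pi_gt0 R; lra.
Qed.

End ComplexModulus.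
#[global] Hint Resolve nc_ge0 : core.

(** * Measurable complex functions *)

Section ComplexMeasurable.
Context {R : realType} {d : measure_display} {T : measurableType d}.
Local Notation C := R[i].
Local Notation Re := (@complex.Re R).
Local Notation Im := (@complex.Im R).
Local Notation nc := (@Normc.normc R).
Implicit Types (D : set T) (f g : T -> C) (u v : T -> R).

Definition cmeas D f := measurable_fun D (Re \o f) /\ measurable_fun D (Im \o f).

Lemma eq_cmeas D f g : f =1 g -> cmeas D f -> cmeas D g.
Proof. by move=> /funext ->. Qed.

Lemma cmeasD D f g : cmeas D f -> cmeas D g -> cmeas D (fun x => f x + g x).
Proof.
move=> [a b] [a' b']; split.
- rewrite (_ : _ \o _ = (Re \o f) \+ (Re \o g)); first exact: measurable_funD.
  by apply/funext => x /=; rewrite cReD.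
- rewrite (_ : _ \o _ = (Im \o f) \+ (Im \o g)); first exact: measurable_funD.
  by apply/funext => x /=; rewrite cImD.
Qed.

Lemma cmeasM D f g : cmeas D f -> cmeas D g -> cmeas D (fun x => f x * g x).
Proof.
move=> [a b] [a' b']; split.
- rewrite (_ : _ \o _ = ((Re \o f) \* (Re \o g)) \- ((Im \o f) \* (Im \o g))).
    by apply: measurable_funB; exact: measurable_funM.
  by apply/funext => x /=; rewrite cReM.
- rewrite (_ : _ \o _ = ((Re \o f) \* (Im \o g)) \+ ((Im \o f) \* (Re \o g))).
    by apply: measurable_funD; exact: measurable_funM.
  by apply/funext => x /=; rewrite cImM.
Qed.

Lemma cmeas_cst D (c : C) : cmeas D (fun=> c).
Proof. by split; exact: measurable_cst. Qed.

Lemma cmeasZ D c f : cmeas D f -> cmeas D (fun x => c * f x).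
Proof. by apply: cmeasM; exact: cmeas_cst. Qed.

Lemma cmeasN D f : cmeas D f -> cmeas D (fun x => - f x).
Proof. by move=> /(cmeasZ D (-1)); apply: eq_cmeas => x; rewrite mulN1r. Qed.

Lemma cmeasB D f g : cmeas D f -> cmeas D g -> cmeas D (fun x => f x - g x).
Proof. by move=> mf /cmeasN; exact: cmeasD. Qed.

Lemma cmeas_real D u : measurable_fun D u -> cmeas D (fun x => (u x)%:C).
Proof. by move=> mu; split => //; exact: measurable_cst. Qed.

Lemma cmeas_sum D (I : Type) (s : seq I) (F : I -> T -> C) :
  (forall i, cmeas D (F i)) -> cmeas D (fun x => \sum_(i <- s) F i x).
Proof.
move=> mF; elim: s => [|i s IH].
  by apply: (@eq_cmeas _ (fun=> 0)); [move=> x; rewrite big_nil|exact: cmeas_cst].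
apply: (@eq_cmeas _ (fun x => F i x + \sum_(j <- s) F j x)).
  by move=> x; rewrite big_cons.
exact: cmeasD.
Qed.

Lemma cmeas_cis D u : measurable_fun D u -> cmeas D (fun x => cis (u x)).
Proof.
move=> mu; split; apply: measurableT_comp => //; apply: continuous_measurable_fun.
- exact: continuous_cos.
- exact: continuous_sin.
Qed.

Lemma measurable_nc D f : cmeas D f -> measurable_fun D (nc \o f).
Proof.
move=> [a b].
rewrite (_ : _ \o _ = @Num.sqrt R \o (fun x => Re (f x) ^+ 2 + Im (f x) ^+ 2)).
  apply: measurableT_comp.
    by apply: continuous_measurable_fun; exact: sqrt_continuous.
  by apply: measurable_funD; exact: measurable_funX.
by apply/funext => x /=; rewrite -sqr_nc sqrtr_sqr ger0_norm.
Qed.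

Lemma measurable_nc2 D f : cmeas D f -> measurable_fun D (fun x => nc (f x) ^+ 2).
Proof. by move=> /measurable_nc ?; exact: measurable_funX. Qed.

Lemma measurable_invr D u : measurable_fun D u -> measurable_fun D (fun x => (u x)^-1).
Proof.
move=> mu; suff m : measurable_fun setT (@GRing.inv R) by exact: (measurableT_comp m mu).
rewrite (_ : @GRing.inv R = (fun x : R => if x == 0 then 0 else x^-1)); last first.
  by apply/funext => x; case: eqVneq => // ->; rewrite invr0.
apply: measurable_fun_if => //.
- by apply: measurable_fun_eqr => //; exact: measurable_cst.
- rewrite setTI (_ : _ @^-1` _ = ~` [set 0]).
    apply: open_continuous_measurable_fun.
      by apply: closed_openC; exact: closed_eq.
    by move=> x; rewrite inE /= => /eqP x0; exact: inv_continuous.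
  by apply/seteqP; split => x /=; [move/negbT/eqP|move/eqP/negbTE].
Qed.

Lemma cmeasV D f : cmeas D f -> cmeas D (fun x => (f x)^-1).
Proof.
move=> mf; have [a b] := mf.
have m := measurable_invr D _ (measurable_nc2 D f mf).
split.
- rewrite (_ : _ \o _ = (Re \o f) \* (fun x => (nc (f x) ^+ 2)^-1)); first exact: measurable_funM.
  by apply/funext => x /=; rewrite sqr_nc; case: (f x).
- rewrite (_ : _ \o _ = (\- (Im \o f)) \* (fun x => (nc (f x) ^+ 2)^-1)).
    by apply: measurable_funM => //; exact: measurable_funN.
  by apply/funext => x /=; rewrite sqr_nc; case: (f x) => ? ? /=; rewrite mulNr.
Qed.

Lemma cmeas_lim D (h : nat -> T -> C) f : measurable D ->
  (forall n, cmeas D (h n)) -> (forall x, D x -> ccvg (fun n => h n x) (f x)) ->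
  cmeas D f.
Proof.
move=> mD mh hf; split.
- apply: (@measurable_fun_cvg _ _ _ D (fun n => Re \o h n)) => // [n|x Dx].
    by have [] := mh n.
  by have /ccvgP[] := hf x Dx.
- apply: (@measurable_fun_cvg _ _ _ D (fun n => Im \o h n)) => // [n|x Dx].
    by have [] := mh n.
  by have /ccvgP[] := hf x Dx.
Qed.

Lemma cmeasS D E f : measurable E -> D `<=` E -> cmeas E f -> cmeas D f.
Proof. by move=> mE DE [a b]; split; apply: measurable_funS DE _. Qed.

End ComplexMeasurable.

(** * Integration of complex functions *)

Section ComplexIntegral.
Context {R : realType}.
Local Notation C := R[i].
Local Notation Re := (@complex.Re R).
Local Notation Im := (@complex.Im R).
Local Notation nc := (@Normc.normc R).
Local Notation mu := (@lebesgue_measure R).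
Variables (D : set R) (mD : measurable D).
Implicit Types (f g : R -> C) (u v : R -> R).

Definition rint u := mu.-integrable D (EFin \o u).

Lemma rint_meas u : rint u -> measurable_fun D u.
Proof. by move=> /measurable_int/measurable_EFinP. Qed.

Lemma rint_le u v : measurable_fun D u -> rint v ->
  (forall x, D x -> `|u x| <= v x) -> rint u.
Proof.
move=> mesu iv uv; apply: (@le_integrable _ _ _ mu D mD _ (EFin \o v)) => //.
  exact/measurable_EFinP.
by move=> x Dx /=; rewrite lee_fin (le_trans (uv x Dx))// ler_norm.
Qed.

Lemma rintD u v : rint u -> rint v -> rint (fun x => u x + v x).
Proof. by move=> iu iv; exact: (@integrableD _ _ _ mu D mD (EFin \o u) (EFin \o v)). Qed.

Lemma rintZ k u : rint u -> rint (fun x => k * u x).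
Proof. by move=> iu; exact: (@integrableZl _ _ _ mu D mD k (EFin \o u)). Qed.

Lemma rint_fsum (I : Type) (s : seq I) (F : I -> R -> R) :
  (forall i, rint (F i)) -> rint (fun x => \sum_(i <- s) F i x).
Proof.
move=> jF; elim: s => [|i s IH].
  by apply: (eq_integrable _ (cst 0%E)) => // [x _|]; [rewrite /= big_nil|exact: integrable0].
have := rintD _ _ (jF i) IH.
by apply: eq_integrable => // x _; rewrite /= big_cons.
Qed.

Lemma Rintegral_fsum (I : Type) (s : seq I) (F : I -> R -> R) :
  (forall i, rint (F i)) ->
  Rintegral mu D (fun x => \sum_(i <- s) F i x) = \sum_(i <- s) Rintegral mu D (F i).
Proof.
move=> jF; elim: s => [|i s IH].
  rewrite big_nil /Rintegral (eq_integral (cst 0%E)) ?integral0// => x _.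
  by rewrite big_nil.
rewrite big_cons -IH -RintegralD//; [|exact: jF|exact: rint_fsum].
by apply: eq_Rintegral => x _; rewrite big_cons.
Qed.

Lemma rdct (h : nat -> R -> R) u v : (forall n, measurable_fun D (h n)) ->
  measurable_fun D u -> rint v ->
  (forall n x, D x -> `|h n x| <= v x) ->
  (forall x, D x -> h n x @[n --> \oo] --> u x) ->
  Rintegral mu D (h n) @[n --> \oo] --> Rintegral mu D u.
Proof.
move=> mh mesu iv hv hu.
have iu : rint u.
  apply: (rint_le _ v) => // x Dx; have /cvg_norm := hu x Dx.
  move=> /cvgr_to_le; apply; apply: nearW => n; exact: hv.
have ih n : rint (h n) by apply: rint_le iv (hv n).
have [|||//||_ _] := @dominated_convergence _ _ _ mu D mD (fun n => EFin \o h n)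
  (EFin \o u) (EFin \o v).
- by move=> n; apply/measurable_EFinP; exact: mh.
- exact/measurable_EFinP.
- by apply: aeW => x Dx /=; apply: cvg_EFin; [exact: nearW|exact: hu].
- by apply: aeW => x n Dx /=; rewrite lee_fin hv.
rewrite -[X in _ --> X](@fineK _ (\int[mu]_(x in D) _)%E); last first.
  exact: integrable_fin_num.
by move=> /fine_cvg.
Qed.

(** Integrability of a complex function is expressed by its modulus: in this form it
    passes to products with bounded factors and to dominated functions. *)
Definition nint f := cmeas D f /\ rint (nc \o f).

Lemma nint_le f v : cmeas D f -> rint v -> (forall x, D x -> nc (f x) <= v x) -> nint f.
Proof.
move=> mf iv fv; split => //; apply: rint_le iv _; first exact: measurable_nc.
by move=> x Dx; rewrite ger0_norm; [exact: fv|exact: nc_ge0].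
Qed.

Lemma nint_Re f : nint f -> rint (Re \o f).
Proof. by move=> [[m _]] i; apply: rint_le m i _ => x _; exact: Re_le_nc. Qed.

Lemma nint_Im f : nint f -> rint (Im \o f).
Proof. by move=> [[_ m]] i; apply: rint_le m i _ => x _; exact: Im_le_nc. Qed.

Lemma nint_ReIm f : rint (Re \o f) -> rint (Im \o f) -> nint f.
Proof.
move=> a b; apply: (nint_le _ (fun x => `|Re (f x)| + `|Im (f x)|)).
- by split; exact: rint_meas.
- by apply: rintD; exact: integrable_norm.
- by move=> x _; exact: nc_le_ReIm.
Qed.

Lemma eq_nint f g : f =1 g -> nint f -> nint g.
Proof. by move=> /funext ->. Qed.

Lemma nint_real u : rint u -> nint (fun x => (u x)%:C).
Proof.
move=> iu; apply: (nint_le _ (fun x => `|u x|)).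
- by apply: cmeas_real; exact: rint_meas.
- exact: integrable_norm.
- by move=> x _; rewrite ncr.
Qed.

Lemma nintD f g : nint f -> nint g -> nint (fun x => f x + g x).
Proof.
move=> [mf jf] [mg jg]; apply: (nint_le _ (fun x => nc (f x) + nc (g x))).
- exact: cmeasD.
- exact: rintD.
- by move=> x _; exact: ncD.
Qed.

Lemma nintM_bounded f g (M : R) : nint f -> cmeas D g ->
  (forall x, D x -> nc (g x) <= M) -> nint (fun x => f x * g x).
Proof.
move=> [mf jf] mg gM; apply: (nint_le _ (fun x => M * nc (f x))).
- exact: cmeasM.
- exact: rintZ.
- by move=> x Dx; rewrite ncM mulrC ler_wpM2r// gM.
Qed.

Lemma nintZ c f : nint f -> nint (fun x => c * f x).
Proof.
move=> jf; apply: (@eq_nint (fun x => f x * c)); first by move=> x; rewrite mulrC.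
by apply: (@nintM_bounded _ _ (nc c)) => //; exact: cmeas_cst.
Qed.

Lemma nintM_cis f u : nint f -> measurable_fun D u -> nint (fun x => f x * cis (u x)).
Proof.
move=> jf mu; apply: (@nintM_bounded _ _ 1) => //; first exact: cmeas_cis.
by move=> x _; rewrite nc_cis.
Qed.

Lemma nintN f : nint f -> nint (fun x => - f x).
Proof. by move=> /(nintZ (-1)); apply: eq_nint => x; rewrite mulN1r. Qed.

Lemma nintB f g : nint f -> nint g -> nint (fun x => f x - g x).
Proof. by move=> jf /nintN; exact: nintD. Qed.

Lemma nint0 : nint (fun=> 0).
Proof.
apply: (nint_le _ (fun=> 0)); first exact: cmeas_cst.
  exact: integrable0.
by move=> x _; rewrite nc0.
Qed.

Lemma nint_sum (I : Type) (s : seq I) (F : I -> R -> C) :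
  (forall i, nint (F i)) -> nint (fun x => \sum_(i <- s) F i x).
Proof.
move=> mF; elim: s => [|i s IH].
  by apply: (@eq_nint (fun=> 0)); [move=> x; rewrite big_nil|exact: nint0].
apply: (@eq_nint (fun x => F i x + \sum_(j <- s) F j x)).
  by move=> x; rewrite big_cons.
exact: nintD.
Qed.

Definition cint f : C := Rintegral mu D (Re \o f) +i* Rintegral mu D (Im \o f).

Lemma eq_cint f g : (forall x, D x -> f x = g x) -> cint f = cint g.
Proof.
by move=> fg; congr (_ +i* _); apply: eq_Rintegral => x; rewrite inE => /fg /= ->.
Qed.

Lemma cintD f g : nint f -> nint g -> cint (fun x => f x + g x) = cint f + cint g.
Proof.
move=> jf jg; apply: eq_ReIm; rewrite ?(cReD, cImD) /=.
- rewrite -RintegralD//; [|exact: nint_Re..].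
  by apply: eq_Rintegral => x _; rewrite /= cReD.
- rewrite -RintegralD//; [|exact: nint_Im..].
  by apply: eq_Rintegral => x _; rewrite /= cImD.
Qed.

Lemma cintZ c f : nint f -> cint (fun x => c * f x) = c * cint f.
Proof.
move=> jf; have iR := nint_Re _ jf; have iI := nint_Im _ jf.
apply: eq_ReIm; rewrite ?(cReM, cImM) /=.
- rewrite -!RintegralZl// -RintegralB//; [|exact: rintZ..].
  by apply: eq_Rintegral => x _; rewrite /= cReM.
- rewrite -!RintegralZl// -RintegralD//; [|exact: rintZ..].
  by apply: eq_Rintegral => x _; rewrite /= cImM.
Qed.

Lemma cintZr c f : nint f -> cint (fun x => f x * c) = cint f * c.
Proof.
by move=> jf; rewrite mulrC -cintZ//; apply: eq_cint => x _; rewrite mulrC.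
Qed.

Lemma cintB f g : nint f -> nint g -> cint (fun x => f x - g x) = cint f - cint g.
Proof.
move=> jf jg; rewrite -[- cint g]mulN1r -cintZ// -cintD//; last exact: nintZ.
by apply: eq_cint => x _; rewrite mulN1r.
Qed.

Lemma cint0 : cint (fun=> 0) = 0.
Proof. by rewrite /cint (_ : _ \o _ = cst 0)// (_ : Im \o _ = cst 0)// Rintegral_cst// mul0r. Qed.

Lemma cint_sum (I : Type) (s : seq I) (F : I -> R -> C) :
  (forall i, nint (F i)) ->
  cint (fun x => \sum_(i <- s) F i x) = \sum_(i <- s) cint (F i).
Proof.
move=> mF; elim: s => [|i s IH].
  by rewrite [RHS]big_nil -[RHS]cint0; apply: eq_cint => x _; rewrite big_nil.
rewrite big_cons -IH -cintD//; last exact: nint_sum.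
by apply: eq_cint => x _; rewrite big_cons.
Qed.

(** Rotate the integral onto the positive real axis and integrate real parts. *)
Lemma nc_cint_le f : nint f -> nc (cint f) <= Rintegral mu D (nc \o f).
Proof.
move=> jf; have [z0|z0] := eqVneq (nc (cint f)) 0.
  by rewrite z0; apply: Rintegral_ge0 => x _; exact: nc_ge0.
have zp : 0 < nc (cint f) by rewrite lt_neqAle eq_sym z0 nc_ge0.
rewrite -(ler_pM2l zp) -RintegralZl//; last by case: jf.
have -> : nc (cint f) * nc (cint f) = Re (cint (fun x => (cint f)^* * f x)).
  by rewrite cintZ// cReM cRe_conj cIm_conj -expr2 sqr_nc; ring.
apply: le_Rintegral => //.
- by apply: nint_Re; exact: nintZ.
- by apply: rintZ; case: jf.
- move=> x Dx /=; apply: (le_trans (ler_norm _)).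
  by apply: (le_trans (Re_le_nc _)); rewrite ncM nc_conj.
Qed.

Lemma cdct (h : nat -> R -> C) f v : (forall n, cmeas D (h n)) -> rint v ->
  (forall n x, D x -> nc (h n x) <= v x) ->
  (forall x, D x -> ccvg (fun n => h n x) (f x)) ->
  ccvg (fun n => cint (h n)) (cint f).
Proof.
move=> mh iv hv hf; have [mR mI] := cmeas_lim D h f mD mh hf.
apply/ccvgP; split.
- apply: (rdct (fun n => Re \o h n) _ v) => // [n|n x Dx|x Dx].
  + by have [] := mh n.
  + exact: le_trans (Re_le_nc _) (hv n x Dx).
  + by have /ccvgP[] := hf x Dx.
- apply: (rdct (fun n => Im \o h n) _ v) => // [n|n x Dx|x Dx].
  + by have [] := mh n.
  + exact: le_trans (Im_le_nc _) (hv n x Dx).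
  + by have /ccvgP[] := hf x Dx.
Qed.

Lemma Re_cint f : Re (cint f) = Rintegral mu D (Re \o f).
Proof. by []. Qed.

Lemma Im_cint f : Im (cint f) = Rintegral mu D (Im \o f).
Proof. by []. Qed.

End ComplexIntegral.

Lemma fourierE {R : realType} (f : R -> R[i]) (xi : R) :
  fourier f xi = ((Num.sqrt (2 * pi))^-1)%:C * cint setT (fun x => f x * cis (- (x * xi))).
Proof. by rewrite /fourier; congr (_ * _); apply: eq_cint => x _; rewrite expNiE. Qed.

#[global] Opaque cint.

(** * Translations and reflections preserve Lebesgue measure *)

Section Transport.
Context {R : realType}.
Local Notation mu := (@lebesgue_measure R).

Section Pushforward.
Variables (phi : R -> R) (mphi : measurable_fun setT phi).
Hypothesis phiE : forall a b, a < b -> mu (phi @^-1` `]a, b]%classic) = (b - a)%:E.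

(** By uniqueness of Lebesgue measure it is enough to compare the two measures on
    half-open intervals. *)
Lemma lebesgue_pushforward (A : set R) : measurable A ->
  mu A = pushforward mu (phi : _ -> measurableTypeR R) A.
Proof.
move=> mA; apply: lebesgue_measure_unique => //= X [[a b] _ <-].
rewrite /pushforward lebesgue_measure_itv/= lte_fin.
have [ab|ba] := ltP a b; first by rewrite phiE.
by rewrite set_itv_ge ?preimage_set0 ?measure0// -leNgt bnd_simp.
Qed.

Lemma ge0_integral_preserved (D : set R) (f : R -> \bar R) : measurable D ->
  measurable_fun D f -> (forall x, D x -> (0 <= f x)%E) ->
  (\int[mu]_(x in D) f x = \int[mu]_(x in phi @^-1` D) f (phi x))%E.
Proof.
move=> mD mf f0.
rewrite (eq_measure_integral (pushforward mu (phi : _ -> measurableTypeR R))).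
  rewrite ge0_integral_pushforward// => x; rewrite inE; exact: f0.
by move=> A mA _; exact: lebesgue_pushforward.
Qed.

Lemma integral_preserved (D : set R) (f : R -> R) : measurable D ->
  measurable_fun setT f -> rint (phi @^-1` D) (f \o phi) ->
  Rintegral mu D f = Rintegral mu (phi @^-1` D) (f \o phi).
Proof.
move=> mD mf rf; congr fine.
rewrite (eq_measure_integral (pushforward mu (phi : _ -> measurableTypeR R))).
  have mf' : measurable_fun setT (EFin \o f) by exact/measurable_EFinP.
  exact: (@integral_pushforward _ _ (measurableTypeR R) (measurableTypeR R) R phi mphi mu D (EFin \o f) mf' rf mD).
by move=> A mA _; exact: lebesgue_pushforward.
Qed.

End Pushforward.

Lemma shift_preserves (c a b : R) : a < b ->
  mu ((fun x => x + c) @^-1` `]a, b]%classic) = (b - a)%:E.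
Proof.
move=> ab; rewrite (_ : _ @^-1` _ = `]a - c, b - c]%classic).
  by rewrite lebesgue_measure_itv/= lte_fin ltrD2r ab -EFinB; congr (_%:E); ring.
by apply/seteqP; split => x /=; rewrite !in_itv/= ltrBlDr lerBrDr.
Qed.

Lemma measurable_shift (c : R) : measurable_fun setT (fun x : R => x + c).
Proof. by apply: measurable_funD => //; exact: measurable_cst. Qed.

Lemma opp_preserves (a b : R) : a < b ->
  mu (-%R @^-1` `]a, b]%classic) = (b - a)%:E.
Proof.
move=> ab; rewrite (_ : _ @^-1` _ = `[- b, - a[%classic).
  by rewrite lebesgue_measure_itv/= lte_fin ltrN2 ab -EFinD opprK addrC.
by apply/seteqP; split => x /=; rewrite !in_itv/= andbC lerNl ltrNr.
Qed.

End Transport.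

(** * The Poisson kernel *)

Section PoissonKernel.
Context {R : realType}.
Local Notation C := R[i].
Local Notation Im := (@complex.Im R).
Local Notation mu := (@lebesgue_measure R).

Definition expabs (e t : R) := expR (- e * `|t|).
(** This is the Poisson kernel of the half-plane at height e with total mass 2 pi, the
    normalisation for which it is the integral of exp(-e |x|) against exp(i t x). *)
Definition poisson (e t : R) := 2 * e / (e ^+ 2 + t ^+ 2).

Lemma ge0_rint (f : R -> R) (D : set R) (r : R) : measurable D -> measurable_fun D f ->
  (forall x, D x -> 0 <= f x) -> (\int[mu]_(x in D) (f x)%:E)%E = r%:E -> rint D f.
Proof.
move=> mD mf f0 fr; apply/integrableP; split; first exact/measurable_EFinP.
under eq_integral => x /[!inE] Dx do rewrite /= ger0_norm ?f0//.
by rewrite fr ltry.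
Qed.

Lemma continuous_linear_expR (e : R) : continuous (fun x : R => expR (- e * x)).
Proof.
move=> x; apply: (@continuous_comp _ _ _ (fun x => - e * x) expR).
  by apply: cvgM; [exact: cvg_cst|exact: cvg_id].
exact: continuous_expR.
Qed.

Lemma continuous_linear_cos (y : R) : continuous (fun x : R => cos (y * x)).
Proof.
move=> x; apply: (@continuous_comp _ _ _ (fun x => y * x) cos).
  by apply: cvgM; [exact: cvg_cst|exact: cvg_id].
exact: continuous_cos.
Qed.

(** Adding 1 to the cosine makes the integrand nonnegative, so that the improper
    integral is the variation of an explicit antiderivative. *)
Lemma integral0y_exp_cos (e y : R) : 0 < e ->
  (\int[mu]_(x in `[0%R, +oo[) (expR (- e * x) * (1 + cos (y * x)))%:E =
  (e^-1 + e / (e ^+ 2 + y ^+ 2))%:E)%E.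
Proof.
move=> e0; have ey0 : e ^+ 2 + y ^+ 2 != 0.
  by rewrite gt_eqF// ltr_wpDr ?sqr_ge0// exprn_gt0.
have en0 : e != 0 by rewrite gt_eqF.
have dlin (a x : R) : is_derive x 1 ( *%R a) a.
  by apply: (@is_derive_eq _ _ _ _ _ _ _ _ (is_deriveZ a (is_derive_id x 1))); rewrite /GRing.scale /= mulr1.
pose E : R -> R := expR \o *%R (- e).
pose G : R -> R := cst (- e^-1) + (e ^+ 2 + y ^+ 2)^-1 \*: (y \*: (sin \o *%R y) - e \*: (cos \o *%R y)).
pose F : R -> R := E * G.
have dF (x : R) : is_derive x 1 F (expR (- e * x) * (1 + cos (y * x))).
  have dE := is_derive1_comp (is_derive_expR (- e * x)) (dlin (- e) x).
  have dS := is_derive1_comp (is_derive_sin (y * x)) (dlin y x).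
  have dC := is_derive1_comp (is_derive_cos (y * x)) (dlin y x).
  have dG := is_deriveD (is_derive_cst (- e^-1) x 1) (is_deriveZ (e ^+ 2 + y ^+ 2)^-1
     (is_deriveB (is_deriveZ y dS) (is_deriveZ e dC))).
  apply: (@is_derive_eq _ _ _ _ _ _ _ _ (is_deriveM dE dG)).
  by rewrite /GRing.scale /= /G /E !fctE /= -![_ *: _]/(_ * _); field; rewrite ey0 en0.
have Finf : F x @[x --> +oo%R] --> (0 : R).
  pose K := e^-1 + (e ^+ 2 + y ^+ 2)^-1 * (`|y| + e).
  have ex : expR (- e * x) @[x --> +oo%R] --> (0 : R).
    under eq_fun do rewrite mulNr.
    apply: (cvg_comp (fun x => e * x) (fun x => expR (- x))); last exact: cvgr_expR.
    apply/cvgryPge => A; apply: filterS (nbhs_pinfty_ge (num_real (A / e))) => t.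
    by rewrite ler_pdivrMr// mulrC.
  apply/norm_cvg0P; apply: (@squeeze_cvgr _ _ _ _ (cst 0) (fun x => expR (- e * x) * K)); last first.
  - by rewrite -[0](mul0r K); apply: cvgM => //; exact: cvg_cst.
  - exact: cvg_cst.
  - apply: nearW => x; rewrite /F /E normr_ge0/= !fctE normrM (ger0_norm (expR_ge0 _)).
    rewrite ler_wpM2l ?expR_ge0// /G !fctE.
    apply: (le_trans (ler_normD _ _)); rewrite normrN ger0_norm ?invr_ge0 ?(ltW e0)// lerD2l.
    rewrite normrM ger0_norm ?invr_ge0 ?addr_ge0 ?sqr_ge0// ler_wpM2l ?invr_ge0 ?addr_ge0 ?sqr_ge0//.
    apply: (le_trans (ler_normB _ _)); apply: lerD.
      by rewrite normrM ler_piMr// sin_max.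
    by rewrite normrM (gtr0_norm e0) ler_piMr ?(ltW e0)// cos_max.
rewrite (@ge0_continuous_FTC2y _ _ F 0 0).
- rewrite /F /E /G !fctE /= -![_ *: _]/(_ * _) !mulr0 expR0 sin0 cos0 -EFinB; congr (_%:E); field; by rewrite ey0 en0.
- move=> x _; rewrite mulr_ge0 ?expR_ge0//; have := cos_geN1 (y * x); lra.
- apply: continuous_subspaceT => x; apply: cvgM; first exact: continuous_linear_expR.
  by apply: cvgD; [exact: cvg_cst|exact: continuous_linear_cos].
- exact: Finf.
- by move=> x _; exact: ex_derive.
- apply: cvg_at_right_filter; apply/differentiable_continuous/derivable1_diffP.
  exact: ex_derive.
- by move=> x _; rewrite derive1E; exact: derive_val.
Qed.

Lemma continuous_expabs (e : R) : continuous (expabs e).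
Proof.
move=> x; apply: (@continuous_comp _ _ _ (fun x : R => `|x|) (fun x => expR (- e * x))).
  exact: norm_continuous.
exact: continuous_linear_expR.
Qed.

Lemma integral_expabs_cos (e y : R) : 0 < e ->
  (\int[mu]_x (expabs e x * (1 + cos (y * x)))%:E =
  (2 * (e^-1 + e / (e ^+ 2 + y ^+ 2)))%:E)%E.
Proof.
move=> e0; rewrite ge0_symfun_integralT//.
- rewrite -set_itvcy EFinM -integral0y_exp_cos//; congr (_ * _)%E.
  apply: eq_integral => x; rewrite inE/= in_itv/= andbT => x0.
  by rewrite /expabs ger0_norm.
- move=> x; rewrite mulr_ge0 ?expR_ge0//; have := cos_geN1 (y * x); lra.
- move=> x; apply: cvgM; first exact: continuous_expabs.
  by apply: cvgD; [exact: cvg_cst|exact: continuous_linear_cos].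
- by move=> x; rewrite /expabs /= normrN mulrN cosN.
Qed.

Lemma rint_expabs_cos (e y : R) : 0 < e ->
  rint setT (fun x => expabs e x * (1 + cos (y * x))).
Proof.
move=> e0; apply: (ge0_rint _ _ _ _ _ _ (integral_expabs_cos e y e0)) => //.
- apply: continuous_measurable_fun => x; apply: cvgM; first exact: continuous_expabs.
  by apply: cvgD; [exact: cvg_cst|exact: continuous_linear_cos].
- move=> x _; rewrite mulr_ge0 ?expR_ge0//; have := cos_geN1 (y * x); lra.
Qed.

Lemma rint_expabs (e : R) : 0 < e -> rint setT (expabs e).
Proof.
move=> e0; have := rintZ setT measurableT 2^-1 _ (rint_expabs_cos e 0 e0).
by congr (rint _ _); apply/funext => x; rewrite mul0r cos0; field.
Qed.

Lemma Rintegral_expabs (e : R) : 0 < e -> Rintegral mu setT (expabs e) = 2 / e.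
Proof.
move=> e0; have en0 : e != 0 by rewrite gt_eqF.
rewrite (_ : expabs e = (fun x => 2^-1 * (expabs e x * (1 + cos (0 * x))))).
  rewrite RintegralZl//; last exact: rint_expabs_cos.
  by rewrite /Rintegral integral_expabs_cos//=; field; rewrite en0.
by apply/funext => x; rewrite mul0r cos0; field.
Qed.

Lemma expabs_ge0 (e t : R) : 0 <= expabs e t. Proof. exact: expR_ge0. Qed.

Lemma expabs_gt0 (e t : R) : 0 < expabs e t. Proof. exact: expR_gt0. Qed.

Lemma expabs_le1 (e t : R) : 0 < e -> expabs e t <= 1.
Proof. by move=> e0; rewrite expR_le1 mulNr oppr_le0 mulr_ge0 ?(ltW e0). Qed.

Lemma nint_expabs (e : R) : 0 < e -> nint setT (fun x => (expabs e x)%:C).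
Proof. by move=> e0; apply: nint_real => //; exact: rint_expabs. Qed.

(** The real part is the integral above minus the one without the cosine; the imaginary
    part vanishes because its integrand is odd. *)
Lemma fourier_expabs (e y : R) : 0 < e ->
  cint setT (fun t => (expabs e t)%:C * cis (y * t)) = (poisson e y)%:C.
Proof.
move=> e0; have en0 : e != 0 by rewrite gt_eqF.
have ey0 : e ^+ 2 + y ^+ 2 != 0.
  by rewrite gt_eqF// ltr_wpDr ?sqr_ge0// exprn_gt0.
have mlin : measurable_fun setT (fun t : R => y * t).
  by apply: measurable_funM => //; exact: measurable_cst.
have nI := nintM_cis setT measurableT _ _ (nint_expabs e e0) mlin.
apply: eq_ReIm; rewrite ?Re_cint ?Im_cint /=.
- rewrite (_ : _ \o _ = fun t => expabs e t * (1 + cos (y * t)) - expabs e t).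
    rewrite RintegralB//; [|exact: rint_expabs_cos|exact: rint_expabs].
    rewrite Rintegral_expabs// /Rintegral integral_expabs_cos//= /poisson.
    by field; rewrite en0 ey0.
  by apply/funext => t /=; ring.
- have oddI : (Im \o (fun t => (expabs e t)%:C * cis (y * t))) \o -%R =
     fun t => - 1 * (Im \o (fun t => (expabs e t)%:C * cis (y * t))) t.
    by apply/funext => t /=; rewrite /expabs normrN mulrN sinN; ring.
  have rI := nint_Im setT measurableT _ nI.
  suff : Rintegral mu setT (Im \o (fun t => (expabs e t)%:C * cis (y * t))) =
     - 1 * Rintegral mu setT (Im \o (fun t => (expabs e t)%:C * cis (y * t))) by lra.
  rewrite -RintegralZl// -oddI.
  apply: (integral_preserved -%R) => //.
  + exact: opp_preserves.
  + by case: nI => -[].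
  + by rewrite preimage_setT oddI; exact: rintZ.
Qed.

Lemma poisson_ge0 (e t : R) : 0 < e -> 0 <= poisson e t.
Proof.
by move=> e0; rewrite divr_ge0 ?mulr_ge0 ?addr_ge0 ?sqr_ge0// ltW.
Qed.

Lemma continuous_poisson (e : R) : 0 < e -> continuous (poisson e).
Proof.
move=> e0 x; apply: cvgM; first exact: cvg_cst.
apply: cvgV; first by rewrite gt_eqF// ltr_wpDr ?sqr_ge0// exprn_gt0.
by apply: cvgD; [exact: cvg_cst|exact: exprn_continuous].
Qed.

Lemma integral_poisson0 (e : R) : 0 < e ->
  (\int[mu]_t (poisson e t)%:E = (2 * pi)%:E)%E.
Proof.
move=> e0; have en0 : e != 0 by rewrite gt_eqF.
rewrite ge0_symfun_integralT//; last 3 first.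
- by move=> x; exact: poisson_ge0.
- exact: continuous_poisson.
- by move=> x; rewrite /poisson /= sqrrN.
pose F : R -> R := 2 \*: (@atan R \o *%R e^-1).
have dlin (a x : R) : is_derive x 1 ( *%R a) a.
  by apply: (@is_derive_eq _ _ _ _ _ _ _ _ (is_deriveZ a (is_derive_id x 1))); rewrite /GRing.scale /= mulr1.
have dF (x : R) : is_derive x 1 F (poisson e x).
  have dA := is_derive1_comp (is_derive1_atan (e^-1 * x)) (dlin e^-1 x).
  apply: (@is_derive_eq _ _ _ _ _ _ _ _ (is_deriveZ 2 dA)).
  have e2 : e ^+ 2 + x ^+ 2 != 0.
    by rewrite gt_eqF// ltr_wpDr ?sqr_ge0// exprn_gt0.
  by rewrite -![_ *: _]/(_ * _) /poisson; field; rewrite en0 e2 /=.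
rewrite -set_itvcy (@ge0_continuous_FTC2y _ _ F 0 pi).
- by rewrite /F /= mulr0 atan0 -[_ *: _]/(_ * _) mulr0 sube0 EFinM.
- by move=> x _; exact: poisson_ge0.
- by apply: continuous_subspaceT; exact: continuous_poisson.
- rewrite [X in _ --> X](_ : pi = 2 * (pi / 2)); last by field.
  apply: cvgM; first exact: cvg_cst.
  apply: (cvg_comp (fun x => e^-1 * x) (@atan R)); last exact: cvgy_atan.
  apply/cvgryPge => A; apply: filterS (nbhs_pinfty_ge (num_real (e * A))) => t.
  by rewrite [e^-1 * _]mulrC ler_pdivlMr// mulrC.
- by move=> x _; exact: ex_derive.
- apply: cvg_at_right_filter; apply/differentiable_continuous/derivable1_diffP.
  exact: ex_derive.
- by move=> x _; rewrite derive1E; exact: derive_val.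
Qed.

Lemma integral_poisson (e x : R) : 0 < e ->
  (\int[mu]_t (poisson e (t - x))%:E = (2 * pi)%:E)%E.
Proof.
move=> e0; rewrite -(integral_poisson0 e e0).
rewrite (ge0_integral_preserved _ (measurable_shift (- x)) (shift_preserves (- x))
  setT (EFin \o poisson e))//.
- apply/measurable_EFinP; apply: continuous_measurable_fun; exact: continuous_poisson.
- by move=> t _; rewrite lee_fin poisson_ge0.
Qed.

Lemma continuous_poissonB (e x : R) : 0 < e -> continuous (fun t => poisson e (t - x)).
Proof.
move=> e0 t; apply: (@continuous_comp _ _ _ (fun t => t - x) (poisson e)).
  by apply: cvgB; [exact: cvg_id|exact: cvg_cst].
exact: continuous_poisson.
Qed.

Lemma rint_poisson (e x : R) : 0 < e -> rint setT (fun t => poisson e (t - x)).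
Proof.
move=> e0; apply: (ge0_rint _ _ _ _ _ _ (integral_poisson e x e0)) => //.
- apply: continuous_measurable_fun; exact: continuous_poissonB.
- by move=> t _; exact: poisson_ge0.
Qed.

Lemma Rintegral_poisson (e x : R) : 0 < e ->
  Rintegral mu setT (fun t => poisson e (t - x)) = 2 * pi.
Proof. by move=> e0; rewrite /Rintegral integral_poisson. Qed.

End PoissonKernel.

(** * Fubini's theorem under a product majorant *)

Section FubiniComplex.
Context {R : realType}.
Local Notation C := R[i].
Local Notation Re := (@complex.Re R).
Local Notation Im := (@complex.Im R).
Local Notation nc := (@Normc.normc R).
Local Notation mu := (@lebesgue_measure R).
Local Notation mR := (measurableTypeR R).

Lemma rFubini (f : mR * mR -> R) (a b : R -> R) : measurable_fun setT f ->
  rint setT a -> rint setT b -> (forall x y, `|f (x, y)| <= a x * b y) ->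
  rint setT (fun x => Rintegral mu setT (fun y => f (x, y))) /\
      Rintegral mu setT (fun x => Rintegral mu setT (fun y => f (x, y))) =
      Rintegral mu setT (fun y => Rintegral mu setT (fun x => f (x, y))).
Proof.
move=> mf ia ib fab.
have s1 x : rint setT (fun y => f (x, y)).
  apply: (rint_le setT measurableT _ (fun y => a x * b y)) => //.
  - exact: (measurableT_comp mf (pair1_measurable x)).
  - exact: rintZ.
have s2 y : rint setT (fun x => f (x, y)).
  apply: (rint_le setT measurableT _ (fun x => b y * a x)) => //.
  - exact: (measurableT_comp mf (pair2_measurable y)).
  - exact: rintZ.
  - by move=> x _; rewrite mulrC.
have mf' : measurable_fun setT (EFin \o f) by exact/measurable_EFinP.
have E1 x : (\int[mu]_y (EFin \o f) (x, y))%E = (Rintegral mu setT (fun y => f (x, y)))%:E.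
  by rewrite /Rintegral fineK//; exact: (integrable_fin_num _ (s1 x)).
have E2 y : (\int[mu]_x (EFin \o f) (x, y))%E = (Rintegral mu setT (fun x => f (x, y)))%:E.
  by rewrite /Rintegral fineK//; exact: (integrable_fin_num _ (s2 y)).
have imf : (mu \x mu)%E.-integrable setT (EFin \o f).
  have [_] := @integrable12ltyP _ _ mR mR R mu mu (EFin \o f) mf'; apply.
  apply: (@le_lt_trans _ _ (\int[mu]_x (Rintegral mu setT b * a x)%:E)%E); last first.
    have := rintZ setT measurableT (Rintegral mu setT b) _ ia.
    by move=> /integrable_lty; exact.
  apply: ge0_le_integral => //.
  - by move=> x _; apply: integral_ge0 => y _; exact: abse_ge0.
  - apply: (measurable_fun_fubini_tonelli_F (abse \o (EFin \o f))).
      exact: measurableT_comp.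
    by move=> x; exact: abse_ge0.
  - exact: (measurable_int _ (rintZ setT measurableT _ _ ia)).
  - move=> x _; rewrite mulrC -RintegralZl//.
    rewrite /Rintegral fineK; last first.
      by apply: integrable_fin_num => //; exact: rintZ.
    apply: ge0_le_integral => //.
    + by apply: measurableT_comp => //; exact: (measurableT_comp mf' (pair1_measurable x)).
    + exact: (measurable_int _ (rintZ setT measurableT _ _ ib)).
    + by move=> y _ /=; rewrite lee_fin.
split.
- have := @integrable_fubini_F _ _ mR mR R mu mu (EFin \o f) imf; apply: eq_integrable => // x _; exact: E1.
- have := @Fubini _ _ mR mR R mu mu (EFin \o f) imf; under eq_integral do rewrite E1.
  under [in X in _ = X -> _]eq_integral do rewrite E2.
  by rewrite /Rintegral => ->.
Qed.

Lemma cFubini (F : mR * mR -> C) (a b : R -> R) : cmeas setT F ->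
  rint setT a -> rint setT b -> (forall x y, nc (F (x, y)) <= a x * b y) ->
  nint setT (fun x => cint setT (fun y => F (x, y))) /\
  cint setT (fun x => cint setT (fun y => F (x, y))) =
  cint setT (fun y => cint setT (fun x => F (x, y))).
Proof.
move=> [mR mI] ia ib Fab.
have [r1 e1] := rFubini _ a b mR ia ib
  (fun x y => le_trans (Re_le_nc _) (Fab x y)).
have [r2 e2] := rFubini _ a b mI ia ib
  (fun x y => le_trans (Im_le_nc _) (Fab x y)).
have EI : (fun x => cint setT (fun y => F (x, y))) = (fun x =>
    Rintegral mu setT (fun y => Re (F (x, y))) +i* Rintegral mu setT (fun y => Im (F (x, y)))).
  by apply/funext => x; apply: eq_ReIm; rewrite ?Re_cint ?Im_cint.
split; first by rewrite EI; exact: nint_ReIm.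
have EJ : (fun y => cint setT (fun x => F (x, y))) = (fun y =>
    Rintegral mu setT (fun x => Re (F (x, y))) +i* Rintegral mu setT (fun x => Im (F (x, y)))).
  by apply/funext => y; apply: eq_ReIm; rewrite ?Re_cint ?Im_cint.
by rewrite EI EJ; apply: eq_ReIm; rewrite ?Re_cint ?Im_cint.
Qed.

End FubiniComplex.

(** * Square-integrable functions *)

Section L2.
Context {R : realType}.
Local Notation C := R[i].
Local Notation nc := (@Normc.normc R).
Local Notation mu := (@lebesgue_measure R).
Implicit Types f g : R -> C.

Lemma L2norm_sqr f : (L2norm f `^ 2 = \int[mu]_x ((nc (f x)) ^+ 2)%:E)%E.
Proof.
rewrite /L2norm poweR_Lnorm//; apply: eq_integral => x _ /=.
by rewrite ger0_norm ?nc_ge0// powR_mulrn ?nc_ge0.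
Qed.

Lemma L2norm_ge0 f : (0 <= L2norm f)%E.
Proof. exact: Lnorm_ge0. Qed.

Lemma inL2_rint f : inL2 f -> rint setT (fun x => nc (f x) ^+ 2).
Proof.
move=> [mf f2]; apply/integrableP; split.
  by apply/measurable_EFinP; exact: measurable_nc2.
under eq_integral do rewrite /= ger0_norm ?sqr_ge0//.
by rewrite -L2norm_sqr poweR_lty.
Qed.

(** Young's inequality makes the product of square-integrable functions integrable. *)
Lemma nintM_L2 (D : set R) f g : measurable D -> cmeas D f -> cmeas D g ->
  rint D (fun x => nc (f x) ^+ 2) -> rint D (fun x => nc (g x) ^+ 2) ->
  nint D (fun x => f x * g x).
Proof.
move=> mD mf mg if2 ig2.
apply: (nint_le D mD _ (fun x => nc (f x) ^+ 2 + nc (g x) ^+ 2)).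
- exact: cmeasM.
- exact: rintD.
- move=> x _; rewrite ncM.
  have := sqr_ge0 (nc (f x) - nc (g x)); have := mulr_ge0 (nc_ge0 (f x)) (nc_ge0 (g x)); nra.
Qed.

Lemma cauchy_schwarz f g : cmeas setT f -> cmeas setT g ->
  nint setT (fun x => f x * g x) ->
  ((nc (cint setT (fun x => f x * g x)))%:E <= L2norm f * L2norm g)%E.
Proof.
move=> mf mg ifg.
have := @hoelder _ _ R mu (nc \o f) (nc \o g) 2 2 (measurable_nc setT f mf)
  (measurable_nc setT g mg) (ltr0n _ 2) (ltr0n _ 2).
have -> : 2^-1 + 2^-1 = 1 :> R by lra.
move=> /(_ erefl); apply: le_trans; rewrite Lnorm1.
apply: (@le_trans _ _ (Rintegral mu setT (nc \o (fun x => f x * g x)))%:E).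
  by rewrite lee_fin nc_cint_le.
rewrite /Rintegral fineK; last by apply: integrable_fin_num => //; case: ifg.
rewrite le_eqVlt; apply/orP; left; apply/eqP; apply: eq_integral => x _ /=.
by rewrite ncM ger0_norm// mulr_ge0// nc_ge0.
Qed.

(** Pairing with a fixed square-integrable function is continuous for the L2 norm, by
    the Cauchy-Schwarz inequality. *)
Lemma L2_pairing_cvg (u : nat -> R -> C) f w : (forall n, cmeas setT (u n)) -> cmeas setT f ->
  inL2 w -> (forall n, nint setT (fun x => u n x * w x)) -> nint setT (fun x => f x * w x) ->
  L2norm (fun x => u n x - f x) @[n --> \oo] --> 0%E ->
  ccvg (fun n => cint setT (fun x => u n x * w x)) (cint setT (fun x => f x * w x)).
Proof.
move=> mu_ mf w2 iu jf uf.
have [mw wfin] := w2; have wN : (L2norm w \is a fin_num)%E.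
  by rewrite ge0_fin_numE// L2norm_ge0.
suff H : (nc (cint setT (fun x => u n x * w x) - cint setT (fun x => f x * w x)))%:E @[n --> \oo] --> 0%E.
  exact: (fine_cvg H).
have lim : (L2norm (fun x => (u n x - f x)%R) * L2norm w)%E @[n --> \oo] --> 0%E.
  rewrite -(mul0e (L2norm w)) -(fineK wN); apply: cvgeM => //; last exact: cvg_cst.
apply: (squeeze_cvge _ (cvg_cst 0%E) lim); apply: nearW => n.
rewrite lee_fin nc_ge0 andTb -cintB//.
have E : (fun x => u n x * w x - f x * w x) = (fun x => (u n x - f x) * w x).
  by apply/funext => x; rewrite mulrBl.
rewrite E; apply: cauchy_schwarz => //; first exact: cmeasB.
by rewrite -E; exact: nintB.
Qed.

End L2.

(** * Fourier inversion by Abel means *)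

Section Inversion.
Context {R : realType}.
Local Notation C := R[i].
Local Notation Re := (@complex.Re R).
Local Notation Im := (@complex.Im R).
Local Notation nc := (@Normc.normc R).
Local Notation mu := (@lebesgue_measure R).
Implicit Types f g h u : R -> C.

Definition c0 : R := (Num.sqrt (2 * pi))^-1.

Lemma c0_sqr : c0 * c0 * (2 * pi) = 1.
Proof.
have p0 : 0 < 2 * pi :> R by have := pi_gt0 R; lra.
rewrite /c0 -invfM -expr2 sqr_sqrtr ?ltW// mulVf// gt_eqF//.
Qed.

Lemma c0_ge0 : 0 <= c0.
Proof. by rewrite invr_ge0 sqrtr_ge0. Qed.

Lemma rint_inL2 f : cmeasurable f -> rint setT (fun x => nc (f x) ^+ 2) -> inL2 f.
Proof.
move=> mf /integrable_lty f2; split => //.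
have : (L2norm f `^ 2 < +oo)%E by rewrite L2norm_sqr f2.
have := L2norm_ge0 f; case: (L2norm f) => [r| |]//= _.
- by move=> _; exact: ltry.
- by rewrite gt_eqF.
Qed.

Lemma cvg0_of_split (a : nat -> R) : (forall n, 0 <= a n) ->
  (forall e, 0 < e -> exists B, forall n, a n <= e + B * n.+1%:R^-1) ->
  a n @[n --> \oo] --> (0 : R).
Proof.
move=> a0 H; apply/cvgrPdistC_lt => e e0.
have [B aB] := H (e / 2) (divr_gt0 e0 (ltr0n _ 2)).
have : B * n.+1%:R^-1 @[n --> \oo] --> (0 : R).
  by rewrite -[0](mulr0 B); apply: cvgM; [exact: cvg_cst|exact: cvg_harmonic].
move=> /cvgrPdistC_lt/(_ (e / 2) (divr_gt0 e0 (ltr0n _ 2))).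
apply: filterS => n; rewrite !subr0 (ger0_norm (a0 n)).
have := aB n; set b := B * _; have := ler_norm b; lra.
Qed.

Lemma ccontinuous_nc g x : ccontinuous g -> forall e : R, 0 < e ->
  exists2 d, 0 < d & forall t, `|t - x| < d -> nc (g t - g x) <= e.
Proof.
move=> [cR cI] e e0; have e2 : 0 < e / 2 by rewrite divr_gt0.
have /cvgrPdistC_lt/(_ _ e2)/nbhs_ballP[d1 /= d10 H1] := cR x.
have /cvgrPdistC_lt/(_ _ e2)/nbhs_ballP[d2 /= d20 H2] := cI x.
exists (Num.min d1 d2); first by rewrite lt_min d10.
move=> t; rewrite lt_min => /andP[t1 t2].
have {}H1 : `|Re (g t) - Re (g x)| < e / 2 by apply: H1; rewrite /ball/= distrC.
have {}H2 : `|Im (g t) - Im (g x)| < e / 2 by apply: H2; rewrite /ball/= distrC.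
apply: (le_trans (nc_le_ReIm _)); rewrite cReD cReN cImD cImN; lra.
Qed.

Lemma ccontinuous_cmeas g : ccontinuous g -> cmeas setT g.
Proof. by move=> [a b]; split; exact: continuous_measurable_fun. Qed.

Section AbelMeans.
Variable x : R.

Let v (e t : R) : C := (expabs e t)%:C * cis (x * t).

Let mv e : cmeas setT (v e).
Proof.
apply: cmeasM.
- by apply: cmeas_real; apply: continuous_measurable_fun; exact: continuous_expabs.
- by apply: cmeas_cis; apply: measurable_funM => //; exact: measurable_cst.
Qed.

Let nc_v e t : nc (v e t) = expabs e t.
Proof. by rewrite ncM nc_cis mulr1 ncr ger0_norm// expabs_ge0. Qed.

(** Fubini's theorem moves the transform from u to the damped character v, whose own
    transform is the Poisson kernel centred at x. *)
Lemma multiplication_formula u e : 0 < e -> nint setT u ->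
  nint setT (fun xi => fourier u xi * v e xi) /\
  cint setT (fun xi => fourier u xi * v e xi) =
  c0%:C * cint setT (fun t : R => u t * (poisson e (t - x))%:C).
Proof.
move=> e0 iu.
pose F (p : measurableTypeR R * measurableTypeR R) : C :=
  (u p.2 * cis (- (p.2 * p.1))) * v e p.1.
have mlin (c : R) : measurable_fun setT (fun t : R => c * t).
  by apply: measurable_funM => //; exact: measurable_cst.
have mF : cmeas setT F.
  have [[uR uI] _] := iu; have [vR vI] := mv e.
  apply: cmeasM; last first.
    by split; [exact: (measurableT_comp vR measurable_fst)|exact: (measurableT_comp vI measurable_fst)].
  apply: cmeasM.
    by split; [exact: (measurableT_comp uR measurable_snd)|exact: (measurableT_comp uI measurable_snd)].
  apply: cmeas_cis; apply: measurable_funN.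
  by apply: measurable_funM; [exact: measurable_snd|exact: measurable_fst].
have Fb xi t : nc (F (xi, t)) <= expabs e xi * (nc \o u) t.
  by rewrite /F ncM nc_v ncM nc_cis mulr1 mulrC.
have [i12 e12] := cFubini F (expabs e) (nc \o u) mF (rint_expabs e e0) iu.2 Fb.
have F1 xi : c0%:C * cint setT (fun t => F (xi, t)) = fourier u xi * v e xi.
  rewrite fourierE -mulrA; congr (_ * _).
  have -> : cint setT (fun t => F (xi, t)) = cint setT (fun t : R => u t * cis (- (t * xi))) * v e xi.
    apply: etrans; last first.
      apply: (cintZr setT measurableT (v e xi) (fun t => u t * cis (- (t * xi)))).
      apply: (nintM_cis setT measurableT u (fun t => - (t * xi)) iu).
      rewrite (_ : (fun t => _) = (fun t => (- xi) * t)); first exact: mlin.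
      by apply/funext => t; rewrite mulNr mulrC.
    by apply: eq_cint => t _; rewrite /F.
  by [].
have F2 t : cint setT (fun xi => F (xi, t)) = u t * (poisson e (t - x))%:C.
  have -> : poisson e (t - x) = poisson e (x - t).
    by rewrite /poisson -(sqrrN (t - x)) opprB.
  rewrite -(fourier_expabs e (x - t) e0).
  rewrite -(cintZ setT measurableT (u t) (fun xi => (expabs e xi)%:C * cis ((x - t) * xi))); last first.
    exact: (nintM_cis setT measurableT _ _ (nint_expabs e e0) (mlin (x - t))).
  apply: eq_cint => xi _; rewrite /F /v -[(xi, t).2]/t -[(xi, t).1]/xi -mulrA.
  congr (_ * _); rewrite mulrCA; congr (_ * _); rewrite -cisD; congr (cis _).
  by rewrite mulrBl addrC.
split.
  apply: (eq_nint setT _ _ F1); exact: nintZ.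
rewrite -(eq_cint setT _ _ (fun xi _ => F1 xi)).
rewrite (cintZ setT measurableT c0%:C _ i12) e12; congr (_ * _).
by apply: eq_cint => t _; exact: F2.
Qed.

Let v_L2 e : 0 < e -> inL2 (v e).
Proof.
move=> e0; apply: rint_inL2; first exact: mv.
apply: (rint_le setT measurableT _ (expabs e)).
- exact: measurable_nc2.
- exact: rint_expabs.
- move=> t _; rewrite nc_v ger0_norm ?sqr_ge0// expr2 ler_piMl ?expabs_ge0//.
  exact: expabs_le1.
Qed.

Let K_L2 e : 0 < e -> inL2 (fun t : R => (poisson e (t - x))%:C).
Proof.
move=> e0.
have mK : measurable_fun setT (fun t : R => poisson e (t - x)).
  by apply: continuous_measurable_fun; exact: continuous_poissonB.
apply: rint_inL2; first exact: cmeas_real.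
apply: (rint_le setT measurableT _ (fun t => (2 / e) * poisson e (t - x))).
- by apply: measurable_nc2; exact: cmeas_real.
- by apply: rintZ => //; exact: rint_poisson.
- move=> t _; rewrite ncr ger0_norm ?sqr_ge0// real_normK ?num_real// expr2.
  rewrite ler_wpM2r ?poisson_ge0//.
  have e2 : 0 < e ^+ 2 by rewrite exprn_gt0.
  rewrite /poisson ler_pdivrMr ?ltr_wpDr ?sqr_ge0//.
  rewrite mulrDr (_ : 2 / e * e ^+ 2 = 2 * e); last by field; rewrite gt_eqF.
  by rewrite lerDl mulr_ge0 ?sqr_ge0// divr_ge0 ?ltW.
Qed.

(** The previous formula holds for the integrable functions that approximate g; both
    sides pass to the limit since v and the Poisson kernel are square-integrable. *)
Lemma abel_means g h e : 0 < e -> fourierL2 g h ->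
  cint setT (fun xi => h xi * v e xi) =
  c0%:C * cint setT (fun t : R => g t * (poisson e (t - x))%:C).
Proof.
move=> e0 [g2 h2 [u [uP ug uh]]].
have iM f w : inL2 f -> inL2 w -> nint setT (fun t => f t * w t).
  by move=> f2 w2; apply: nintM_L2 => //; [case: f2|case: w2|exact: inL2_rint|exact: inL2_rint].
have iu n : nint setT (u n).
  by have [[a b] _] := uP n; apply: nint_ReIm.
have [F1 F2] := all_and2 (fun n => multiplication_formula (u n) e e0 (iu n)).
have mfu n : cmeas setT (fourier (u n)).
  have := cmeasM setT _ _ (F1 n).1 (cmeasV setT _ (mv e)).
  apply: eq_cmeas => t; rewrite -mulrA divff ?mulr1//.
  apply/eqP => v0; have := nc_v e t; rewrite v0 nc0 => /eqP.
  by rewrite lt_eqF// expabs_gt0.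
have L := L2_pairing_cvg (fun n => fourier (u n)) h (v e) mfu h2.1 (v_L2 e e0) F1
  (iM _ _ h2 (v_L2 e e0)) uh.
have K := L2_pairing_cvg u g _ (fun n => (uP n).2.1) g2.1 (K_L2 e e0)
  (fun n => iM _ _ (uP n).2 (K_L2 e e0)) (iM _ _ g2 (K_L2 e e0)) ug.
apply: (ccvg_unique _ _ _ L).
rewrite (_ : (fun n => _) = fun n => c0%:C * cint setT (fun t : R => u n t * (poisson e (t - x))%:C)).
  exact: ccvgZ.
by apply/funext.
Qed.

Let en (n : nat) : R := n.+1%:R^-1.
Let en_gt0 n : 0 < en n. Proof. by rewrite invr_gt0. Qed.

Lemma abel_means_cvg h : nint setT h ->
  ccvg (fun n => cint setT (fun xi => h xi * v (en n) xi))
       (cint setT (fun xi => h xi * cis (x * xi))).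
Proof.
move=> ih; apply: (cdct setT measurableT _ _ (nc \o h)).
- by move=> n; apply: cmeasM => //; case: ih.
- by case: ih.
- by move=> n t _; rewrite ncM nc_v /= ler_piMr ?nc_ge0// expabs_le1.
- move=> t _; apply: ccvgZ; rewrite -[cis _]mul1r /v.
  apply: ccvgM; last exact: ccvg_cst.
  apply/ccvgP; split => /=; last exact: cvg_cst.
  rewrite -expR0; apply: continuous_cvg; first exact: continuous_expR.
  rewrite -(mul0r `|t|); apply: cvgM; last exact: cvg_cst.
  by rewrite -oppr0; apply: cvgN; exact: cvg_harmonic.
Qed.

(** The Poisson kernels are an approximate identity; away from x they are
    dominated by a small multiple of the kernel of width one. *)
Lemma poisson_approx g : ccontinuous g -> inL2 g ->
  ccvg (fun n => cint setT (fun t : R => g t * (poisson (en n) (t - x))%:C))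
       ((2 * pi)%:C * g x).
Proof.
move=> gc g2; have mg := ccontinuous_cmeas g gc.
have iK n : nint setT (fun t : R => (poisson (en n) (t - x))%:C).
  by apply: nint_real => //; exact: rint_poisson.
have iM w : inL2 w -> nint setT (fun t => g t * w t).
  by move=> w2; apply: nintM_L2 => //; [case: w2|exact: inL2_rint|exact: inL2_rint].
have igK n := iM _ (K_L2 (en n) (en_gt0 n)).
have i1 : rint setT (fun t : R => (nc (g t) + nc (g x)) * poisson 1 (t - x)).
  have a := (iM _ (K_L2 1 ltr01)).2.
  have b := rintZ setT measurableT (nc (g x)) _ (rint_poisson 1 x ltr01).
  have := rintD setT measurableT _ _ a b; congr (rint _ _); apply/funext => t /=.
  by rewrite -[_ (g t * _)]/(nc (g t * _)) ncM ncr ger0_norm ?poisson_ge0// mulrDl.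
have diff n : cint setT (fun t : R => g t * (poisson (en n) (t - x))%:C) - (2 * pi)%:C * g x =
    cint setT (fun t : R => (g t - g x) * (poisson (en n) (t - x))%:C).
  have -> : (2 * pi)%:C * g x = cint setT (fun t : R => g x * (poisson (en n) (t - x))%:C).
    rewrite cintZ// mulrC; congr (_ * _).
    apply: eq_ReIm; rewrite ?Re_cint ?Im_cint; first by rewrite -(Rintegral_poisson (en n) x (en_gt0 n)).
    by rewrite (_ : _ \o _ = cst 0)// Rintegral_cst// mul0r.
  rewrite -cintB//; last exact: nintZ.
  by apply: eq_cint => t _; rewrite mulrBl.
have id n : nint setT (fun t : R => (g t - g x) * (poisson (en n) (t - x))%:C).
  have := nintB setT measurableT _ _ (igK n) (nintZ setT measurableT (g x) _ (iK n)).
  by apply: eq_nint => t; rewrite mulrBl.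
apply: cvg0_of_split => [n|e e0]; first exact: nc_ge0.
have p0 : 0 < 2 * pi :> R by have := pi_gt0 R; lra.
have [d d0 gd] := ccontinuous_nc g x gc (e / (2 * pi)) (divr_gt0 e0 p0).
exists ((1 + d ^- 2) * Rintegral mu setT (fun t : R => (nc (g t) + nc (g x)) * poisson 1 (t - x))).
move=> n; rewrite diff; apply: (le_trans (nc_cint_le setT measurableT _ (id n))).
have -> : e = e / (2 * pi) * Rintegral mu setT (fun t : R => poisson (en n) (t - x)).
  by rewrite Rintegral_poisson// mulfVK// gt_eqF.
rewrite [(1 + _) * _ * _]mulrAC -RintegralZl//; last exact: rint_poisson.
rewrite -RintegralZl// -RintegralD//; last 2 first.
- by apply: rintZ => //; exact: rint_poisson.
- exact: rintZ.
apply: le_Rintegral => //.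
- by case: (id n).
- by apply: rintD => //; apply: rintZ => //; exact: rint_poisson.
move=> t _; rewrite -[X in X <= _]/(nc ((g t - g x) * (poisson (en n) (t - x))%:C)) ncM ncr.
rewrite ger0_norm ?poisson_ge0//.
have Kn := poisson_ge0 (en n) (t - x) (en_gt0 n).
have K1 := poisson_ge0 1 (t - x) ltr01.
have G0 : 0 <= nc (g t) + nc (g x) by rewrite addr_ge0 ?nc_ge0.
have d2 : 0 < d ^- 2 by rewrite invr_gt0 exprn_gt0.
have [tx|xt] := ltP `|t - x| d.
  apply: (@le_trans _ _ (e / (2 * pi) * poisson (en n) (t - x))).
    by rewrite ler_wpM2r// gd.
  rewrite lerDl; apply: mulr_ge0; last exact: mulr_ge0.
  by apply: mulr_ge0; [rewrite addr_ge0// ltW|exact: (ltW (en_gt0 n))].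
have far : poisson (en n) (t - x) <= (1 + d ^- 2) * en n * poisson 1 (t - x).
  have s2 : d ^+ 2 <= (t - x) ^+ 2.
    by rewrite -(real_normK (num_real (t - x))) ler_sqr// nnegrE// ltW.
  have dd : 0 < d ^+ 2 by rewrite exprn_gt0.
  have s0 : 0 < (t - x) ^+ 2 by exact: lt_le_trans s2.
  have e2 : 0 < en n ^+ 2 by rewrite exprn_gt0.
  rewrite /poisson expr1n.
  have -> : (1 + d ^- 2) * en n * (2 * 1 / (1 + (t - x) ^+ 2)) =
     2 * en n * ((1 + d ^- 2) / (1 + (t - x) ^+ 2)) by ring.
  apply: ler_wpM2l; first by rewrite mulr_ge0// ltW.
  apply: (@le_trans _ _ ((t - x) ^- 2)).
    by rewrite lef_pV2 ?posrE ?addr_gt0// lerDr ltW.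
  rewrite ler_pdivlMr ?addr_gt0// mulrDr mulr1 mulVf ?gt_eqF// addrC lerD2l.
  by rewrite lef_pV2 ?posrE.
apply: (@le_trans _ _ ((nc (g t) + nc (g x)) * ((1 + d ^- 2) * en n * poisson 1 (t - x)))).
  by apply: ler_pM => //; first [exact: nc_ge0|exact: ncB].
rewrite [leLHS](_ : _ = (1 + d ^- 2) * en n * ((nc (g t) + nc (g x)) * poisson 1 (t - x))).
  by rewrite lerDr mulr_ge0// divr_ge0// ltW.
by ring.
Qed.

(** The Abel means of the transform converge to the integral on the right by domination,
    and to the value of g on the left by the approximate identity. *)
Lemma fourier_inversion g h : ccontinuous g -> fourierL2 g h -> nint setT h ->
  g x = c0%:C * cint setT (fun xi => h xi * cis (x * xi)).
Proof.
move=> gc gh ih; have g2 : inL2 g by case: gh.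
have A := abel_means_cvg h ih; have B := poisson_approx g gc g2.
have -> : cint setT (fun xi => h xi * cis (x * xi)) = c0%:C * ((2 * pi)%:C * g x).
  apply: (ccvg_unique _ _ _ A); have := ccvgZ c0%:C _ _ B.
  by congr (ccvg _ _); apply/funext => n; rewrite -(abel_means g h).
by rewrite !mulrA -!rmorphM /= c0_sqr mul1r.
Qed.

End AbelMeans.
End Inversion.

(** * Fourier series on a period *)

Section FourierSeries.
Context {R : realType}.
Local Notation C := R[i].
Local Notation Re := (@complex.Re R).
Local Notation Im := (@complex.Im R).
Local Notation nc := (@Normc.normc R).
Local Notation mu := (@lebesgue_measure R).
Implicit Types f g h P q : R -> C.

Definition period : set R := `](- pi), pi[%classic.
Local Notation D := period.

Lemma measurable_period : measurable D.
Proof. exact: measurable_itv. Qed.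
Local Notation mD := measurable_period.

Lemma period_measure : mu D = (2 * pi)%:E.
Proof.
rewrite /D lebesgue_measure_itv/= lte_fin; have := pi_gt0 R => p0.
by rewrite ifT; [rewrite -EFinB; congr (_%:E); ring|lra].
Qed.

Lemma rint_cst (r : R) : rint D (fun=> r).
Proof.
apply/integrableP; split; first exact: measurable_cst.
rewrite (_ : (\int[mu]_(x in D) _)%E = (`|r|%:E * mu D)%E).
  by rewrite period_measure -EFinM ltry.
by rewrite -(@integral_cst _ _ _ mu D measurable_period).
Qed.

Lemma Rintegral_cst_period (r : R) : Rintegral mu D (fun=> r) = r * (2 * pi).
Proof.
have E : r * fine (mu D) = r * (2 * pi) by rewrite period_measure.
exact: etrans (@Rintegral_cst _ _ _ mu D measurable_period r) E.
Qed.

Lemma nint_bounded f (M : R) : cmeas D f -> (forall t, D t -> nc (f t) <= M) -> nint D f.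
Proof. by move=> mf fM; apply: (nint_le D mD _ _ mf (rint_cst M) fM). Qed.

Lemma Rintegral_period (f F : R -> R) : continuous f ->
  (forall x : R, is_derive x 1 F (f x)) -> Rintegral mu D f = F pi - F (- pi).
Proof.
move=> cf dF; have p0 := pi_gt0 R.
have ic : mu.-integrable `[(- pi), pi]%classic (EFin \o f).
  by apply: continuous_compact_integrable; [exact: segment_compact|exact: continuous_subspaceT].
rewrite /D Rintegral_itv_bndo_bndc; last first.
  by apply: integrableS ic => // x /=; rewrite !in_itv/= => /andP[/ltW-> /ltW->].
rewrite Rintegral_itv_obnd_cbnd; last first.
  by apply: integrableS ic => // x /=; rewrite !in_itv/= => /andP[/ltW-> ->].
have cF : continuous F.
  by move=> x; apply/differentiable_continuous/derivable1_diffP; exact: ex_derive.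
rewrite /Rintegral (@continuous_FTC2 _ f F)//.
- by lra.
- exact: continuous_subspaceT.
- split.
  + by move=> x _; exact: ex_derive.
  + by apply: cvg_at_right_filter; exact: cF.
  + by apply: cvg_at_left_filter; exact: cF.
- by move=> x _; rewrite derive1E; exact: derive_val.
Qed.

Lemma measurable_lin (a : R) (E : set R) : measurable_fun E (fun t : R => a * t).
Proof. by apply: measurable_funM; [exact: measurable_cst|exact: measurable_id]. Qed.

Definition char (j : int) (t : R) : C := cis (j%:~R * t).

Lemma cmeas_char E j : cmeas E (char j).
Proof. by apply: cmeas_cis; exact: measurable_lin. Qed.

Lemma nc_char j t : nc (char j t) = 1. Proof. exact: nc_cis. Qed.

Lemma charM j k t : char j t * char k t = char (j + k) t.
Proof. by rewrite /char -cisD rmorphD /= mulrDl. Qed.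

Lemma char0 t : char 0 t = 1.
Proof. by rewrite /char mul0r cis0. Qed.

Lemma char_2pi (j : int) : char j (2 * pi) = 1.
Proof. by rewrite /char mulrC cis_2piz. Qed.

Lemma cint_char (j : int) : cint D (char j) = if j == 0 then (2 * pi)%:C else 0.
Proof.
case: eqVneq => [->|j0].
  rewrite (eq_cint D _ (fun=> 1)); last by move=> t _; rewrite char0.
  apply: eq_ReIm; rewrite ?Re_cint ?Im_cint.
    by rewrite (_ : _ \o _ = cst 1)// Rintegral_cst_period mul1r.
  by rewrite (_ : _ \o _ = cst 0)// Rintegral_cst_period mul0r.
have jR : (j%:~R : R) != 0 by rewrite intr_eq0.
have dlin (a x : R) : is_derive x 1 ( *%R a) a.
  by apply: (@is_derive_eq _ _ _ _ _ _ _ _ (is_deriveZ a (is_derive_id x 1))); rewrite /GRing.scale /= mulr1.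
have per : cis ((j%:~R : R) * pi) = cis ((j%:~R : R) * (- pi)).
  have := char_2pi j; rewrite /char => h1.
  transitivity (cis ((j%:~R : R) * (2 * pi) + (j%:~R : R) * (- pi))); last by rewrite cisD h1 mul1r.
  by congr cis; ring.
apply: eq_ReIm; rewrite ?Re_cint ?Im_cint /=.
- have dF (x : R) : is_derive x 1 ((j%:~R : R)^-1 \*: (@sin R \o *%R j%:~R)) (cos (j%:~R * x)).
    have dS := is_derive1_comp (is_derive_sin (j%:~R * x)) (dlin j%:~R x).
    apply: (@is_derive_eq _ _ _ _ _ _ _ _ (is_deriveZ (j%:~R)^-1 dS)).
    by rewrite -![_ *: _]/(_ * _) mulrC mulfK.
  have -> : Re \o char j = (fun t => cos (j%:~R * t)) by [].
  rewrite (Rintegral_period _ _ (continuous_linear_cos j%:~R) dF) /=.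
  by have [_ ->] := per; rewrite subrr.
- have dF (x : R) : is_derive x 1 ((- (j%:~R : R)^-1) \*: (@cos R \o *%R j%:~R)) (sin (j%:~R * x)).
    have dS := is_derive1_comp (is_derive_cos (j%:~R * x)) (dlin j%:~R x).
    apply: (@is_derive_eq _ _ _ _ _ _ _ _ (is_deriveZ (- (j%:~R)^-1) dS)).
    by rewrite -![_ *: _]/(_ * _) !mulNr mulrN opprK mulrCA mulVf// mulr1.
  have cs : continuous (fun t : R => sin (j%:~R * t)).
    move=> x; apply: (@continuous_comp _ _ _ (fun x : R => (j%:~R : R) * x) (@sin R)).
      by apply: cvgM; [exact: cvg_cst|exact: cvg_id].
    exact: continuous_sin.
  have -> : Im \o char j = (fun t => sin (j%:~R * t)) by [].
  rewrite (Rintegral_period _ _ cs dF) /=.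
  by have [-> _] := per; rewrite subrr.
Qed.

Definition sqint f := cmeas D f /\ rint D (fun t => nc (f t) ^+ 2).

Lemma sqint_nint f : sqint f -> nint D f.
Proof.
move=> [mf f2]; apply: (nint_le D mD _ (fun t => 1 + nc (f t) ^+ 2)) => //.
- by apply: rintD => //; [exact: mD|exact: rint_cst].
- by move=> t _; have := sqr_ge0 (nc (f t) - 1); have := nc_ge0 (f t); nra.
Qed.

Lemma sqint_bounded f (M : R) : cmeas D f -> (forall t, D t -> nc (f t) <= M) -> sqint f.
Proof.
move=> mf fM; split => //.
apply: (rint_le D mD _ (fun=> M ^+ 2)) (rint_cst _) _; first exact: measurable_nc2.
move=> t Dt; rewrite ger0_norm ?sqr_ge0// ler_sqr ?nnegrE ?nc_ge0 ?fM//.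
exact: le_trans (nc_ge0 _) (fM t Dt).
Qed.

Definition fcoef f (j : int) : C := cint D (fun t => f t * char (- j) t).

Lemma nint_fcoef f j : nint D f -> nint D (fun t => f t * char j t).
Proof. by move=> jf; exact: (nintM_cis D mD f _ jf (measurable_lin _ _)). Qed.

Lemma sqint_subchar f c j : sqint f -> sqint (fun t => f t - c * char j t).
Proof.
move=> [mf f2]; have mg : cmeas D (fun t => f t - c * char j t).
  by apply: cmeasB => //; apply: cmeasZ; exact: cmeas_char.
split => //.
apply: (rint_le D mD _ (fun t => 2 * nc (f t) ^+ 2 + 2 * nc c ^+ 2)).
- exact: measurable_nc2.
- by apply: rintD; [exact: mD|apply: rintZ => //; exact: mD|exact: rint_cst].
- move=> t _; rewrite ger0_norm ?sqr_ge0//.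
  have := ncB (f t) (c * char j t); rewrite ncM nc_char mulr1.
  have := sqr_ge0 (nc (f t) - nc c).
  have := nc_ge0 (f t); have := nc_ge0 c; have := nc_ge0 (f t - c * char j t); nra.
Qed.

Lemma nc_sub_sqr (z c e : C) : nc e = 1 ->
  nc (z - c * e) ^+ 2 = (nc z ^+ 2 + nc c ^+ 2) - 2 * Re (c^* * (z * e^*)).
Proof.
move=> e1; have := sqr_nc e; rewrite e1 expr1n => h1.
rewrite !sqr_nc !(cReD, cImD, cReN, cImN, cReM, cImM, cRe_conj, cIm_conj).
have -> : Re c ^+ 2 + Im c ^+ 2 = (Re c ^+ 2 + Im c ^+ 2) * (Re e ^+ 2 + Im e ^+ 2).
  by rewrite -h1 mulr1.
ring.
Qed.

(** Bessel's inequality, peeling off one character at a time: subtracting the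
    projection onto a character leaves the other coefficients unchanged. *)
Lemma bessel f (s : seq int) : sqint f -> uniq s ->
  \sum_(j <- s) nc (fcoef f j) ^+ 2 <= 2 * pi * Rintegral mu D (fun t => nc (f t) ^+ 2).
Proof.
have p0 : 0 < 2 * pi :> R by have := pi_gt0 R; lra.
elim: s f => [|j s IH] f sf.
  move=> _; rewrite big_nil mulr_ge0 ?(ltW p0)//.
  by apply: Rintegral_ge0 => t _; exact: sqr_ge0.
move=> /= /andP[js us]; rewrite big_cons.
set a := fcoef f j; pose c := ((2 * pi)^-1)%:C * a.
pose f' t := f t - c * char j t.
have jf := sqint_nint f sf.
have sf' : sqint f' by exact: sqint_subchar.
have E k : k != j -> fcoef f' k = fcoef f k.
  move=> kj; rewrite /fcoef /f'.
  rewrite (eq_cint D _ (fun t => f t * char (- k) t - c * char (j - k) t)); last first.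
    by move=> t _; rewrite mulrBl -mulrA charM.
  rewrite cintB//; last 3 first.
  - exact: mD.
  - exact: nint_fcoef.
  - apply: nintZ; first exact: mD.
    by apply: (nint_bounded _ 1); [exact: cmeas_char|move=> t _; rewrite nc_char].
  rewrite cintZ//; last 2 first.
  - exact: mD.
  - by apply: (nint_bounded _ 1); [exact: cmeas_char|move=> t _; rewrite nc_char].
  by rewrite cint_char subr_eq0 eq_sym (negbTE kj) mulr0 subr0.
have := IH f' sf' us.
rewrite (eq_big_seq (fun k => nc (fcoef f k) ^+ 2)); last first.
  by move=> k ks; rewrite E//; apply: contraNneq js => <-.
move=> H; apply: (@le_trans _ _ (nc a ^+ 2 + 2 * pi * Rintegral mu D (fun t => nc (f' t) ^+ 2))).
  by rewrite lerD2l.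
rewrite (_ : Rintegral mu D (fun t => nc (f' t) ^+ 2) =
  Rintegral mu D (fun t => nc (f t) ^+ 2) - (2 * pi)^-1 * nc a ^+ 2).
  by rewrite mulrBr mulrA mulfV ?gt_eqF// mul1r; lra.
have pt t : nc (f' t) ^+ 2 = (nc (f t) ^+ 2 + nc c ^+ 2) -
    2 * Re (c^* * (f t * char (- j) t)).
  have -> : char (- j) t = (char j t)^* by rewrite /char rmorphN /= mulNr cisN.
  by rewrite nc_sub_sqr// nc_char.
have jc : nint D (fun t => c^* * (f t * char (- j) t)).
  by apply: nintZ; [exact: mD|exact: nint_fcoef].
rewrite (eq_Rintegral mu (fun t _ => pt t)) RintegralB; last 3 first.
- exact: mD.
- by apply: rintD; [exact: mD|case: sf|exact: rint_cst].
- by apply: rintZ; [exact: mD|exact: (nint_Re D mD _ jc)].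
rewrite RintegralD; last 3 first.
- exact: mD.
- by case: sf.
- exact: rint_cst.
rewrite Rintegral_cst_period RintegralZl; last 2 first.
- exact: mD.
- exact: (nint_Re D mD _ jc).
have -> : Rintegral mu D (fun t => Re (c^* * (f t * char (- j) t))) = Re (c^* * a).
  rewrite /a /fcoef -cintZ//; first exact: mD.
  exact: nint_fcoef.
have -> : nc c ^+ 2 = (2 * pi)^-1 ^+ 2 * nc a ^+ 2.
  by rewrite ncM exprMn ncr real_normK ?num_real.
have -> : Re (c^* * a) = (2 * pi)^-1 * nc a ^+ 2.
  by rewrite sqr_nc /c !(cReM, cImM, cRe_conj, cIm_conj) /=; ring.
have : 2 * pi != 0 :> R by rewrite gt_eqF.
by move: (2 * pi) => w wn; field.
Qed.

(** By Bessel's inequality the squared coefficients are the terms of a convergent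
    series. *)
Lemma riemann_lebesgue f (phi : nat -> int) : sqint f -> injective phi ->
  nc (fcoef f (phi n)) @[n --> \oo] --> (0 : R).
Proof.
move=> sf iphi; pose u n := nc (fcoef f (phi n)) ^+ 2.
have u0 n : 0 <= u n by exact: sqr_ge0.
have cu : cvgn (series u).
  apply: nondecreasing_is_cvgn.
    by apply/nondecreasing_seqP => n; rewrite /series /= big_nat_recr//= lerDl.
  exists (2 * pi * Rintegral mu D (fun t => nc (f t) ^+ 2)) => _ [n _ <-].
  rewrite /series /= -(big_map phi xpredT (fun j => nc (fcoef f j) ^+ 2)).
  by apply: bessel => //; rewrite map_inj_uniq// iota_uniq.
have u_0 : u n @[n --> \oo] --> (0 : R) by exact: cvg_series_cvg_0 cu.
have : Num.sqrt (u n) @[n --> \oo] --> Num.sqrt (0 : R).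
  by apply: continuous_cvg => //; exact: sqrt_continuous.
rewrite sqrtr0; under eq_fun do rewrite /u sqrtr_sqr ger0_norm ?nc_ge0//.
by [].
Qed.

Definition sidx (N i : nat) : int := i%:Z - N%:Z.

(** Summing over a natural interval makes telescoping, shifts of the index and
    exchanges with other operators instances of the ones for natural intervals. *)
Definition symsum {V : nmodType} (u : int -> V) (N : nat) : V :=
  \sum_(0 <= i < N.*2.+1) u (sidx N i).

Definition fsum P (N : nat) (t : R) : C :=
  ((2 * pi)^-1)%:C * symsum (fun j => fcoef P j * char j t) N.

Lemma symsum_delta {V : nmodType} (p : V) (N : nat) :
  symsum (fun j => if j == 0 then p else 0) N = p.
Proof.
have NI : N \in index_iota 0 N.*2.+1 by rewrite mem_index_iota ltnS -addnn leq_addr.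
rewrite /symsum (bigD1_seq N NI (iota_uniq _ _)).
rewrite /sidx subrr eqxx /= big1 ?addr0// => i iN; rewrite ifN// subr_eq0.
by apply: contraNneq iN => -[->].
Qed.

(** Chernoff's proof of pointwise convergence: when P - P(t0) is divisible by
    e^(i(t - t0)) - 1, the symmetric sums telescope. *)
Section Chernoff.
Variables (P q : R -> C) (p : C) (t0 M : R).
Hypothesis mq : cmeas D q.
Hypothesis qM : forall t, D t -> nc (q t) <= M.
Hypothesis Pq : forall t, D t -> P t - p = q t * (cis (t - t0) - 1).

Let jq : nint D q. Proof. exact: nint_bounded qM. Qed.

(** Multiplication by a character shifts the coefficients, so that the factor
    e^(i(t - t0)) - 1 turns them into differences. *)
Lemma fcoef_quotient j : fcoef P j * char j t0 =
  (if j == 0 then (2 * pi)%:C * p else 0) +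
  (fcoef q (j - 1) * char (j - 1) t0 - fcoef q j * char j t0).
Proof.
have i1 k : nint D (char k).
  by apply: (nint_bounded _ 1); [exact: cmeas_char|move=> t _; rewrite nc_char].
have -> : fcoef P j = p * cint D (char (- j)) +
    (char (-1) t0 * fcoef q (j - 1) - fcoef q j).
  rewrite /fcoef -cintZ//; last exact: mD.
  rewrite -cintZ; [|exact: mD|exact: nint_fcoef].
  rewrite -cintB; [|exact: mD|by apply: nintZ; [exact: mD|exact: nint_fcoef]|exact: nint_fcoef].
  rewrite -cintD; last 3 first.
  - exact: mD.
  - by apply: nintZ; [exact: mD|].
  - apply: nintB; first exact: mD.
      by apply: nintZ; [exact: mD|exact: nint_fcoef].
    exact: nint_fcoef.
  apply: eq_cint => t Dt.
  have -> : P t = p + q t * (cis (t - t0) - 1) by rewrite -Pq// addrC subrK.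
  have -> : cis (t - t0) = char 1 t * char (-1) t0.
    by rewrite /char -cisD mul1r mulN1r.
  have -> : char (- (j - 1)) t = char 1 t * char (- j) t.
    by rewrite charM opprB addrC.
  ring.
rewrite cint_char oppr_eq0 mulrDl; congr (_ + _).
  by case: eqVneq => [->|_]; rewrite ?char0 ?mulr0 ?mul0r// mulr1 mulrC.
rewrite mulrBl; congr (_ - _).
by rewrite mulrAC charM mulrC addrC.
Qed.

Lemma fsum_telescope N : fsum P N t0 = p + ((2 * pi)^-1)%:C *
  (fcoef q (- N.+1%:Z) * char (- N.+1%:Z) t0 - fcoef q N * char N t0).
Proof.
have p0 : (2 * pi)%:C != 0 :> C.
  by apply/eqP => -[]/eqP; rewrite gt_eqF// mulr_gt0// pi_gt0.
have pV : ((2 * pi)^-1)%:C * (2 * pi)%:C = 1 :> C.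
  by rewrite -rmorphM /= mulVf// gt_eqF// mulr_gt0// pi_gt0.
rewrite /fsum /symsum; under eq_bigr do rewrite fcoef_quotient.
rewrite big_split /=.
have D0 := symsum_delta ((2 * pi)%:C * p) N; rewrite /symsum in D0; rewrite D0 mulrDr mulrA pV mul1r; congr (_ + _ * _).
pose a (i : nat) := fcoef q (i%:Z - N.+1%:Z) * char (i%:Z - N.+1%:Z) t0.
under eq_bigr => i _.
  rewrite (_ : sidx N i - 1 = i%:Z - N.+1%:Z); last by rewrite /sidx; lia.
  rewrite (_ : sidx N i = i.+1%:Z - N.+1%:Z); last by rewrite /sidx; lia.
  rewrite -/(a i) -/(a i.+1) -opprB.
  over.
rewrite sumrN telescope_sumr// opprB /a; congr (_ * _ - _ * _).
- by congr (fcoef q _); lia.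
- by congr (char _ _); lia.
- by congr (fcoef q _); lia.
- by congr (char _ _); lia.
Qed.

Lemma fsum_bound N : nc (fsum P N t0) <= nc p + 2 * M.
Proof.
have p0 : 0 < 2 * pi :> R by have := pi_gt0 R; lra.
have cM j : nc (fcoef q j) <= M * (2 * pi).
  apply: (le_trans (nc_cint_le D mD _ (nint_fcoef q (- j) jq))).
  rewrite -Rintegral_cst_period; apply: le_Rintegral; first exact: mD.
  - by case: (nint_fcoef q (- j) jq).
  - exact: rint_cst.
  - by move=> t Dt; rewrite -[X in X <= _]/(nc (q t * char (- j) t)) ncM nc_char mulr1 qM.
rewrite fsum_telescope; apply: (le_trans (ncD _ _)); rewrite lerD2l ncM ncr.
rewrite ger0_norm ?invr_ge0 ?(ltW p0)// mulrC ler_pdivrMr//.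
apply: (le_trans (ncB _ _)); rewrite !ncM !nc_char !mulr1.
by have := cM (- N.+1%:Z); have := cM N; lra.
Qed.

Lemma fsum_cvg : ccvg (fun N => fsum P N t0) p.
Proof.
have sq : sqint q by exact: sqint_bounded qM.
have i1 : injective (fun N : nat => - N.+1%:Z) by move=> m n; lia.
have i2 : injective (fun N : nat => N%:Z) by move=> m n; lia.
have r1 := riemann_lebesgue q _ sq i1.
have r2 := riemann_lebesgue q _ sq i2.
rewrite /ccvg; apply: (@squeeze0 _ _ (fun N => (2 * pi)^-1 * (nc (fcoef q (- N.+1%:Z)) + nc (fcoef q N)))).
  move=> N; rewrite nc_ge0 fsum_telescope addrC addKr ncM ncr andTb.
  rewrite ger0_norm ?invr_ge0 ?mulr_ge0 ?pi_ge0// ler_wpM2l ?invr_ge0 ?mulr_ge0 ?pi_ge0//.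
  by apply: (le_trans (ncB _ _)); rewrite !ncM !nc_char !mulr1.
have := cvgM (cvg_cst ((2 * pi)^-1 : R)) (cvgD r1 r2).
by rewrite addr0 mulr0; exact.
Qed.

End Chernoff.

End FourierSeries.

(** * Parseval's identity *)

Section Pairing.
Context {R : realType}.
Local Notation C := R[i].
Local Notation nc := (@Normc.normc R).
Local Notation D := (@period R).
Local Notation mD := (@measurable_period R).
Implicit Types (f g h P : R -> C).

(** Two points of the period at distance more than pi become closer after one of them is
    moved by 2 pi; this is why the Lipschitz bound is used up to radius 3 pi. *)
Lemma circle_lipschitz P (K : R) : (forall t, P (t + 2 * pi) = P t) ->
  (forall s t, `|s| <= 3 * pi -> `|t| <= 3 * pi -> nc (P s - P t) <= K * `|s - t|) ->
  forall s t, D s -> D t -> nc (P s - P t) <= 4 * K * nc (cis s - cis t).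
Proof.
move=> per lip s t Ds Dt.
have {}Ds : - pi < s < pi by move: Ds; rewrite /period/= in_itv.
have {}Dt : - pi < t < pi by move: Dt; rewrite /period/= in_itv.
have p0 := pi_gt0 R.
have K0 : 0 <= K.
  have h : nc (P pi - P 0) <= K * pi.
    by have := lip pi 0; rewrite subr0 normr0 (ger0_norm (ltW p0)); apply; lra.
  have := nc_ge0 (P pi - P 0); nra.
have near u v : `|u| <= 3 * pi -> `|v| <= 3 * pi -> `|u - v| <= pi ->
    nc (P u - P v) <= 4 * K * nc (cis u - cis v).
  move=> hu hv uv; apply: (le_trans (lip u v hu hv)).
  rewrite nc_cisB mulrAC mulrC ler_wpM2r//.
  exact: chord_lower.
have shift (u : R) : cis (u + 2 * pi) = cis u by rewrite cisD cis_2pi mulr1.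
have [st|st] := leP `|s - t| pi.
  by apply: near => //; rewrite ler_norml; lra.
have [ts|ts] := leP t s.
  have : pi < s - t by rewrite -(@ger0_norm _ (s - t)) ?subr_ge0.
  move=> st'; rewrite -(per t) -(shift t); apply: near; rewrite ler_norml; lra.
have : pi < t - s by rewrite -(@ger0_norm _ (t - s)) ?subr_ge0 1?distrC// ltW.
move=> st'; rewrite -(per s) -(shift s); apply: near; rewrite ler_norml; lra.
Qed.

(** Parseval's identity against a Lipschitz function: its symmetric Fourier sums
    converge boundedly, so they may be integrated against h term by term. *)
Lemma parseval_pairing h P (K M : R) : nint D h -> cmeas D P -> 0 <= K ->
  (forall t, D t -> nc (P t) <= M) ->
  (forall s t, D s -> D t -> nc (P s - P t) <= K * nc (cis s - cis t)) ->
  ccvg (symsum (fun j => ((2 * pi)^-1)%:C * fcoef P j * cint D (fun t => h t * char j t)))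
       (cint D (fun t => h t * P t)).
Proof.
move=> jh mP K0 PM lip.
pose q t0 t := (P t - P t0) / (cis (t - t0) - 1).
have mq t0 : cmeas D (q t0).
  apply: cmeasM; first by apply: cmeasB => //; exact: cmeas_cst.
  apply: cmeasV; apply: cmeasB; last exact: cmeas_cst.
  apply: cmeas_cis; apply: measurable_funB; [exact: measurable_id|exact: measurable_cst].
have qE t0 t : D t0 -> D t -> P t - P t0 = q t0 t * (cis (t - t0) - 1).
  move=> D0 Dt; rewrite /q; have [z|nz] := eqVneq (cis (t - t0) - 1) 0.
    by rewrite z mulr0; apply: nc_eq0; apply/eqP; rewrite eq_le nc_ge0 andbT;
       have := lip t t0 Dt D0; rewrite nc_cisB z nc0 mulr0.
  by rewrite mulfVK.
have qK t0 t : D t0 -> D t -> nc (q t0 t) <= K.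
  move=> D0 Dt; rewrite /q; have [z|nz] := eqVneq (cis (t - t0) - 1) 0.
    by rewrite z invr0 mulr0 nc0.
  have nz' : 0 < nc (cis (t - t0) - 1).
    rewrite lt_neqAle nc_ge0 andbT eq_sym; apply: contra_neq nz; exact: nc_eq0.
  by rewrite ncM Normc.normcV ler_pdivrMr// -nc_cisB lip.
have cs : forall t0, D t0 -> ccvg (fun N => fsum P N t0) (P t0).
  move=> t0 D0; apply: (fsum_cvg P (q t0) (P t0) t0 K (mq t0)) => t Dt; first exact: qK.
  exact: qE.
have bs : forall N t0, D t0 -> nc (fsum P N t0) <= M + 2 * K.
  move=> N t0 D0; apply: (@le_trans _ _ (nc (P t0) + 2 * K)); last by rewrite lerD2r PM.
  by apply: (fsum_bound P (q t0) (P t0) t0 K (mq t0)) => t Dt; [exact: qK|exact: qE].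
have ms N : cmeas D (fsum P N).
  apply: cmeasZ; apply: cmeas_sum => i; apply: cmeasZ; exact: cmeas_char.
have main : ccvg (fun N => cint D (fun t => h t * fsum P N t)) (cint D (fun t => h t * P t)).
  apply: (cdct D mD _ _ (fun t => (M + 2 * K) * nc (h t))).
  - by move=> N; apply: cmeasM => //; case: jh.
  - by apply: rintZ; [exact: mD|case: jh].
  - by move=> N t Dt; rewrite ncM mulrC ler_wpM2r ?nc_ge0// bs.
  - by move=> t Dt; apply: ccvgZ; exact: cs.
move: main; congr (ccvg _ _); apply/funext => N.
rewrite /symsum.
have E t : h t * fsum P N t = \sum_(0 <= i < N.*2.+1)
    (((2 * pi)^-1)%:C * fcoef P (sidx N i)) * (h t * char (sidx N i) t).
  rewrite /fsum /symsum !mulr_sumr; apply: eq_bigr => i _.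
  by set k := _%:C; ring.
rewrite (eq_cint D _ _ (fun t _ => E t)) cint_sum; last 2 first.
- exact: mD.
- by move=> i; apply: nintZ; [exact: mD|exact: nint_fcoef].
apply: eq_bigr => i _; rewrite cintZ//; first exact: mD.
exact: nint_fcoef.
Qed.

End Pairing.

(** * Tiling the line by translates of an interval *)

Section Tiling.
Context {R : realType}.
Local Notation mu := (@lebesgue_measure R).
Implicit Types (f : R -> R).

Lemma Rintegral_shift f (a b c : R) : measurable_fun setT f ->
  rint `]a, b]%classic (fun x => f (x + c)) ->
  Rintegral mu `](a + c), (b + c)]%classic f = Rintegral mu `]a, b]%classic (fun x => f (x + c)).
Proof.
move=> mf jf.
have E : (fun x : R => x + c) @^-1` `](a + c), (b + c)]%classic = `]a, b]%classic.
  by apply/seteqP; split => x /=; rewrite !in_itv/= ltrD2r lerD2r.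
rewrite (integral_preserved _ (measurable_shift c) (shift_preserves c) _ f) ?E//.
Qed.

Lemma Rintegral_cat f (a b c : R) : a <= b -> b <= c -> rint `]a, c]%classic f ->
  Rintegral mu `]a, c]%classic f =
  Rintegral mu `]a, b]%classic f + Rintegral mu `]b, c]%classic f.
Proof.
move=> ab bc jf.
have := @Rintegral_itvB R f (BRight a) (BRight c) b jf; rewrite !bnd_simp.
by move=> /(_ ab bc) <-; rewrite addrC subrK.
Qed.

Definition window (r : R) (N : nat) : set R :=
  `](- (N.*2.+1%:R * r)), (N.*2.+1%:R * r)]%classic.

Lemma measurable_window r N : measurable (window r N).
Proof. exact: measurable_itv. Qed.

Lemma window_bigcup (r : R) : 0 < r -> \bigcup_N window r N = setT.
Proof.
move=> r0; apply/seteqP; split => // x _.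
have /andP[_ xN] := truncn_itv (divr_ge0 (normr_ge0 x) (ltW r0)).
set n := Num.truncn _ in xN.
exists n => //; rewrite /window /= in_itv/=.
have : `|x| < n.*2.+1%:R * r.
  rewrite -ltr_pdivrMr//; apply: lt_le_trans xN _.
  by rewrite ler_nat ltnS -addnn leq_addr.
by rewrite ltr_norml => /andP[-> /ltW].
Qed.

Lemma rint_itv_bounded f (M a b : R) : measurable_fun setT f -> (forall x, `|f x| <= M) ->
  rint `]a, b]%classic f.
Proof.
move=> mf fM; have mI : (mu `]a, b]%classic < +oo)%E.
  by rewrite lebesgue_measure_itv/=; case: ifP => _; rewrite -?EFinB ltry.
apply: measurable_bounded_integrable => //.
- exact: measurable_funTS.
- exists M; split; first exact: num_real.
  by move=> y My x _ /=; apply: le_trans (fM x) (ltW My).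
Qed.

(** The window of radius (2N + 1) r is the union of the 2N + 1 translates by multiples of
    2r of the interval of radius r. *)
Lemma tiling f (r M : R) (N : nat) : 0 < r -> measurable_fun setT f ->
  (forall x, `|f x| <= M) ->
  Rintegral mu (window r N) f =
  symsum (fun j : int => Rintegral mu `](- r), r]%classic (fun x => f (x + 2 * r * j%:~R))) N.
Proof.
move=> r0 mf fM; have lf a b := rint_itv_bounded f M a b mf fM.
have step (b : R) n : Rintegral mu `]b, (b + n%:R * (2 * r))]%classic f =
    \sum_(0 <= i < n) Rintegral mu `](b + i%:R * (2 * r)), (b + i.+1%:R * (2 * r))]%classic f.
  elim: n => [|n IH].
    by rewrite big_nil mul0r addr0 set_itv_ge ?Rintegral_set0// -leNgt bnd_simp.
  rewrite big_nat_recr //= -IH; apply: Rintegral_cat => //.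
  - by rewrite lerDl mulr_ge0// mulr_ge0// ltW.
  - by rewrite lerD2l ler_wpM2r ?ler_nat// mulr_ge0// ltW.
have -> : window r N = `](- (N.*2.+1%:R * r)), (- (N.*2.+1%:R * r) + N.*2.+1%:R * (2 * r))]%classic.
  rewrite /window; congr (fun v : R => `](- (N.*2.+1%:R * r)), v]%classic).
  by rewrite (_ : - (N.*2.+1%:R * r) + N.*2.+1%:R * (2 * r) = N.*2.+1%:R * r)//; ring.
rewrite step /symsum; apply: eq_bigr => i _.
have mfs : measurable_fun setT (fun x : R => f (x + 2 * r * (sidx N i)%:~R)).
  exact: (measurableT_comp mf (measurable_shift _)).
have ji := rint_itv_bounded _ M (- r) r mfs (fun x => fM _).
have sE : (sidx N i)%:~R = i%:R - N%:R :> R by rewrite /sidx rmorphB.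
rewrite -(Rintegral_shift f (- r) r _ mf ji) sE.
have dE : N.*2.+1%:R = 2 * N%:R + 1 :> R by rewrite -natr1 -mul2n natrM.
have iE : i.+1%:R = i%:R + 1 :> R by rewrite -natr1.
rewrite dE iE.
have -> : - ((2 * N%:R + 1) * r) + i%:R * (2 * r) = - r + 2 * r * (i%:R - N%:R) by ring.
have -> : - ((2 * N%:R + 1) * r) + (i%:R + 1) * (2 * r) = r + 2 * r * (i%:R - N%:R) by ring.
by [].
Qed.

Lemma Rintegral_windows f (r : R) : 0 < r -> rint setT f ->
  Rintegral mu (window r N) f @[N --> \oo] --> Rintegral mu setT f.
Proof.
move=> r0 jf; have mf := rint_meas _ _ jf.
have -> : (fun N => Rintegral mu (window r N) f) = fun N => Rintegral mu setT (f \_ (window r N)).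
  by apply/funext => N; rewrite -Rintegral_mkcond.
apply: (rdct setT measurableT _ _ (fun x => `|f x|)) => //.
- by move=> N; apply/(measurable_restrictT f (measurable_window r N)); exact: measurable_funTS.
- exact: integrable_norm.
- by move=> N x _; rewrite /patch; case: ifP => // _; rewrite normr0.
- move=> x _; have : (\bigcup_N window r N) x by rewrite window_bigcup.
  move=> [N0 _ xN0]; apply: cvg_near_cst; exists N0 => // N /= N0N.
  rewrite /patch mem_set//; move: xN0; rewrite /window /= !in_itv/= => /andP[a b].
  have NN : N0.*2.+1%:R * r <= N.*2.+1%:R * r by rewrite ler_wpM2r ?(ltW r0)// ler_nat ltnS leq_double.
  by rewrite (le_lt_trans _ a) ?lerN2// (le_trans b).
Qed.

End Tiling.

(** * Symmetric and unordered sums over the integers *)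

Section SymmetricSums.
Import finmap.
Context {R : realType}.
Implicit Types (u v : int -> R).

Lemma sidx_inj N : injective (sidx N).
Proof. by move=> i j; rewrite /sidx; lia. Qed.

Definition sidxs (N : nat) : seq int := [seq sidx N i | i <- index_iota 0 N.*2.+1].

Lemma sidxs_uniq N : uniq (sidxs N).
Proof. by rewrite map_inj_uniq ?iota_uniq//; exact: sidx_inj. Qed.

Lemma mem_sidxs N (j : int) : (j \in sidxs N) = (`|j| <= N)%N.
Proof.
apply/mapP/idP => [[n]|jN].
  by rewrite mem_index_iota => nN ->; rewrite /sidx; lia.
exists (absz (j + N%:Z)); first by rewrite mem_index_iota; lia.
by rewrite /sidx; lia.
Qed.

Lemma symsumE {V : nmodType} (u : int -> V) N : symsum u N = \sum_(j <- sidxs N) u j.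
Proof. by rewrite /symsum big_map. Qed.

Lemma symsumS {V : zmodType} (u : int -> V) N :
  symsum u N.+1 = u (- N.+1%:Z) + symsum u N + u N.+1%:Z.
Proof.
rewrite /symsum doubleS big_nat_recr //= big_nat_recl //=; congr (_ + _ + _).
- by congr u; rewrite /sidx; lia.
- by apply: eq_bigr => i _; congr u; rewrite /sidx; lia.
- by congr u; rewrite /sidx; lia.
Qed.

Lemma symsum_shift {V : zmodType} (u : int -> V) N :
  symsum (fun j => u (j + 1)) N = symsum u N + (u N.+1%:Z - u (- N%:Z)).
Proof.
apply/eqP; rewrite addrC -subr_eq; apply/eqP.
rewrite /symsum -sumrB; pose w (i : nat) := u (i%:Z - N%:Z).
rewrite (eq_bigr (fun i => w i.+1 - w i)).
  rewrite telescope_sumr// /w; congr (u _ - u _); lia.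
by move=> i _; rewrite /w /sidx; congr (u _ - u _); lia.
Qed.

Lemma symsumN {V : zmodType} (u : int -> V) N : symsum (fun j => u (- j)) N = symsum u N.
Proof.
elim: N => [|N IH]; last by rewrite !symsumS IH opprK [RHS]addrC addrA [_ + symsum _ _ + _]addrAC [RHS]addrC addrA addrC addrA.
by rewrite /symsum !big_nat1.
Qed.

Lemma symsumD {V : zmodType} (u v : int -> V) N :
  symsum (fun j => u j + v j) N = symsum u N + symsum v N.
Proof. exact: big_split. Qed.

Lemma symsumB {V : zmodType} (u v : int -> V) N :
  symsum (fun j => u j - v j) N = symsum u N - symsum v N.
Proof. exact: sumrB. Qed.

Lemma symsumZ {V : pzRingType} (c : V) (u : int -> V) N :
  symsum (fun j => c * u j) N = c * symsum u N.
Proof. by rewrite /symsum mulr_sumr. Qed.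

Lemma ler_symsum u v N : (forall j, u j <= v j) -> symsum u N <= symsum v N.
Proof. by move=> uv; apply: ler_sum => i _; exact: uv. Qed.

Lemma symsum_ge u (j : int) N : (forall j, 0 <= u j) -> (`|j| <= N)%N -> u j <= symsum u N.
Proof.
move=> u0 jN; rewrite symsumE (bigD1_seq j) ?mem_sidxs ?sidxs_uniq//= lerDl.
by apply: sumr_ge0 => i _; exact: u0.
Qed.

Lemma symsum_cvg u M : (forall j, 0 <= u j) -> (forall N, symsum u N <= M) ->
  cvgn (symsum u).
Proof.
move=> u0 uM; apply: nondecreasing_is_cvgn.
  by apply/nondecreasing_seqP => N; rewrite symsumS -addrA addrCA lerDl addr_ge0.
by exists M => _ [N _ <-].
Qed.

(** A family is the difference of its sum with its modulus and of its modulus, which both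
    have nondecreasing symmetric sums. *)
Lemma symsum_abs_cvg u M : (forall N, symsum (fun j => `|u j|) N <= M) -> cvgn (symsum u).
Proof.
move=> uM.
have -> : symsum u = (fun N => symsum (fun j => u j + `|u j|) N - symsum (fun j => `|u j|) N).
  by apply/funext => N; rewrite symsumD addrK.
apply: is_cvgB; last exact: symsum_cvg.
apply: (@symsum_cvg _ (2 * M)) => [j|N].
  by have := ler_norm (- u j); rewrite normrN; lra.
rewrite symsumD; have := uM N.
have : symsum u N <= symsum (fun j => `|u j|) N by apply: ler_symsum => j; exact: ler_norm.
lra.
Qed.

Lemma sum_subseq (s t : seq int) u : uniq s -> uniq t -> {subset s <= t} ->
  \sum_(j <- t) u j = \sum_(j <- s) u j + \sum_(j <- [seq j <- t | j \notin s]) u j.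
Proof.
move=> us ut st; rewrite (bigID (mem s)) /= big_filter; congr (_ + _).
rewrite -big_filter; apply: perm_big; apply: uniq_perm => //; first exact: filter_uniq.
by move=> j; rewrite mem_filter andb_idr// => /st.
Qed.

(** Finitely many indices lie in some symmetric range. *)
Lemma sum_le_symsum (s : seq int) u M : uniq s -> (forall j, 0 <= u j) ->
  (forall N, symsum u N <= M) -> \sum_(j <- s) u j <= M.
Proof.
move=> us u0 uM; pose N := \max_(j <- s) `|j|%N.
have sub : {subset s <= sidxs N}.
  by move=> j js; rewrite mem_sidxs /N; exact: leq_bigmax_seq.
apply: le_trans (uM N); rewrite symsumE (sum_subseq _ _ _ us (sidxs_uniq N) sub).
by rewrite lerDl; apply: sumr_ge0 => i _; exact: u0.
Qed.

(** A finite set of indices that nearly exhausts the sum of the moduli approximates all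
    larger finite sums, among them the symmetric ones and those along which the unordered
    sum is the limit. *)
Lemma sumZ_symsum u M l : (forall s, uniq s -> \sum_(j <- s) `|u j| <= M) ->
  symsum u N @[N --> \oo] --> l -> sumZ u = l.
Proof.
move=> uM ul.
pose A := [set x | exists2 s : seq int, uniq s & x = \sum_(j <- s) `|u j|].
have supA : has_sup A.
  split; first by exists 0; exists [::]; rewrite ?big_nil.
  by exists M => _ [s us ->]; exact: uM.
have key e : 0 < e -> exists2 s0 : seq int, uniq s0 &
    forall s, uniq s -> {subset s0 <= s} -> `|\sum_(j <- s) u j - \sum_(j <- s0) u j| <= e.
  move=> e0; have [_ [s0 us0 ->] ltA] := sup_adherent e0 supA.
  exists s0 => // s us s0s; rewrite (sum_subseq _ _ _ us0 us s0s) addrC addKr.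
  apply: (le_trans (ler_norm_sum _ _ _)).
  have : \sum_(j <- s) `|u j| <= sup A by apply: (sup_upper_bound supA); exists s.
  rewrite (sum_subseq _ _ (fun j => `|u j|) us0 us s0s); lra.
have FT := @summability.totally_filter int.
rewrite /sumZ /summability.sum; apply: cvg_lim => //.
apply/(@cvgrPdist_le _ R^o) => e e0; have e2 : 0 < e / 2 by rewrite divr_gt0.
have [s0 us0 s0P] := key _ e2.
have ls0 : `|l - \sum_(j <- s0) u j| <= e / 2.
  have : `|symsum u N - \sum_(j <- s0) u j| @[N --> \oo] --> `|l - \sum_(j <- s0) u j|.
    by apply: cvg_norm; apply: cvgB => //; exact: cvg_cst.
  move=> /cvgr_to_le; apply; exists (\max_(j <- s0) `|j|%N) => // N /= sN.
  rewrite symsumE; apply: s0P; first exact: sidxs_uniq.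
  move=> j js; rewrite mem_sidxs; apply: leq_trans sN; exact: leq_bigmax_seq.
exists [fset j in s0]%fset => // B /= s0B.
rewrite /summability.partial_sum.
rewrite (_ : \sum_(i : B) _ = \sum_(j <- enum_fset B) u j); last by rewrite big_seq_fsetE.
have := s0P (enum_fset B) (fset_uniq B) _.
have sub : {subset s0 <= enum_fset B}.
  by move=> j js; apply: (fsubsetP s0B); rewrite inE.
move=> /(_ sub); rewrite distrC => h; rewrite -(subrKA (\sum_(j <- s0) u j)).
by apply: (le_trans (ler_normD _ _)); lra.
Qed.

(** The terms 1 / (1 + n^2) are at most 6 / (n + 1) - 6 / (n + 2); both sides of the origin
    then telescope and contribute 6 each, and the middle term contributes 1. *)
Lemma symsum_inv_sqr N : symsum (fun j : int => (1 + j%:~R ^+ 2)^-1 : R) N <= 13.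
Proof.
have bound n : (1 + n%:R ^+ 2)^-1 <= 6 / n.+1%:R - 6 / n.+2%:R :> R.
  have n0 : 0 <= n%:R :> R by [].
  rewrite -[n.+2%:R]natr1 -[n.+1%:R]natr1.
  have -> : 6 / (n%:R + 1) - 6 / (n%:R + 1 + 1) = 6 / ((n%:R + 1) * (n%:R + 1 + 1)) :> R.
    by field; rewrite !gt_eqF; lra.
  rewrite ler_pdivlMr; last by rewrite mulr_gt0; lra.
  rewrite mulrC ler_pdivrMr; last by nra.
  by move: n%:R n0 => x x0; nra.
suff : symsum (fun j : int => (1 + j%:~R ^+ 2)^-1 : R) N <= 13 - 12 / N.+2%:R.
  by move=> /le_trans; apply; rewrite lerBlDr lerDl divr_ge0.
elim: N => [|N IH].
  by rewrite /symsum big_nat1 /sidx subrr expr0n addr0 invr1; lra.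
rewrite symsumS; have := bound N.+1; rewrite rmorphN sqrrN /=.
rewrite [6 / _](_ : _ = 12 / N.+2%:R / 2); last by field; rewrite ?pnatr_eq0.
rewrite [6 / _](_ : _ = 12 / N.+3%:R / 2); last by field; rewrite ?pnatr_eq0.
move: IH; set a := _^-1; set b := 12 / N.+2%:R; set c := 12 / N.+3%:R; lra.
Qed.

End SymmetricSums.

(** * Symmetric sums of complex families *)

Section ComplexSymmetricSums.
Context {R : realType}.
Local Notation C := R[i].
Local Notation Re := (@complex.Re R).
Local Notation Im := (@complex.Im R).
Local Notation nc := (@Normc.normc R).
Local Notation mu := (@lebesgue_measure R).
Local Notation D := (@period R).

Definition clim (u : nat -> C) : C :=
  lim (Re (u n) @[n --> \oo]) +i* lim (Im (u n) @[n --> \oo]).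

Lemma Re_symsum (u : int -> C) N : Re (symsum u N) = symsum (Re \o u) N.
Proof. exact: cRe_sum. Qed.

Lemma Im_symsum (u : int -> C) N : Im (symsum u N) = symsum (Im \o u) N.
Proof. exact: cIm_sum. Qed.

Lemma nc_symsum (u : int -> C) N : nc (symsum u N) <= symsum (nc \o u) N.
Proof. exact: nc_sum. Qed.

Lemma csymsum_cvg (u : int -> C) (M : R) : (forall N, symsum (nc \o u) N <= M) ->
  ccvg (symsum u) (clim (symsum u)).
Proof.
move=> uM; apply/ccvgP; split => /=.
- have -> : (fun n => Re (symsum u n)) = symsum (Re \o u).
    by apply/funext => n; exact: Re_symsum.
  apply: (symsum_abs_cvg _ M) => N; apply: le_trans (uM N).
  by apply: ler_symsum => j; exact: Re_le_nc.
- have -> : (fun n => Im (symsum u n)) = symsum (Im \o u).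
    by apply/funext => n; exact: Im_symsum.
  apply: (symsum_abs_cvg _ M) => N; apply: le_trans (uM N).
  by apply: ler_symsum => j; exact: Im_le_nc.
Qed.

Lemma eq_cvgn (u v : nat -> R) (l : R) : (forall n, u n = v n) ->
  v n @[n --> \oo] --> l -> u n @[n --> \oo] --> l.
Proof. by move=> /funext ->. Qed.

(** The line is tiled by the translates of the period, and the integrals over the growing
    windows converge by domination. *)
Lemma tiling_cint (F : R -> C) (M : R) : nint setT F -> (forall x, nc (F x) <= M) ->
  ccvg (symsum (fun j : int => cint D (fun x => F (x + 2 * pi * j%:~R)))) (cint setT F).
Proof.
move=> jF FM; have [[mR mI] _] := jF; have p0 := pi_gt0 R.
have real (f : R -> R) : measurable_fun setT f -> (forall x, `|f x| <= M) -> rint setT f ->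
    symsum (fun j : int => Rintegral mu D (fun x => f (x + 2 * pi * j%:~R))) N @[N --> \oo] -->
    Rintegral mu setT f.
  move=> mf fM jf; apply: eq_cvgn (Rintegral_windows f pi p0 jf) => N; apply/esym.
  rewrite (tiling f pi M N p0 mf fM); apply: eq_bigr => i _.
  rewrite /period Rintegral_itv_bndo_bndc//.
  have mfs : measurable_fun setT (fun x : R => f (x + 2 * pi * (sidx N i)%:~R)).
    exact: (measurableT_comp mf (measurable_shift _)).
  have := rint_itv_bounded _ M (- pi) pi mfs (fun x => fM _).
  by apply: integrableS => // x /=; rewrite !in_itv/= => /andP[-> /ltW->].
apply/ccvgP; rewrite Re_cint Im_cint; split.
- apply: eq_cvgn (real (Re \o F) mR (fun x => le_trans (Re_le_nc _) (FM x))
    (nint_Re setT measurableT _ jF)) => N; rewrite Re_symsum.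
  by apply: eq_bigr => i _; rewrite /= Re_cint.
- apply: eq_cvgn (real (Im \o F) mI (fun x => le_trans (Im_le_nc _) (FM x))
    (nint_Im setT measurableT _ jF)) => N; rewrite Im_symsum.
  by apply: eq_bigr => i _; rewrite /= Im_cint.
Qed.

End ComplexSymmetricSums.

(** * The periodized kernel and the multiplier *)

Section Kernel.
Context {R : realType}.
Variables (alpha : R) (alpha_gt0 : 0 < alpha).

Definition phi (x : R) : R := (x ^+ 2 + alpha ^+ 2)^-1.

Let a2_gt0 : 0 < alpha ^+ 2. Proof. by rewrite exprn_gt0. Qed.

Lemma phi_den_gt0 (x : R) : 0 < x ^+ 2 + alpha ^+ 2.
Proof. by rewrite ltr_wpDl ?sqr_ge0. Qed.
Hint Resolve phi_den_gt0 : core.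

Lemma phi_gt0 x : 0 < phi x. Proof. by rewrite invr_gt0. Qed.
Lemma phi_ge0 x : 0 <= phi x. Proof. exact/ltW/phi_gt0. Qed.

Lemma phi_le x : phi x <= alpha ^- 2.
Proof. by rewrite lef_pV2 ?posrE// lerDr sqr_ge0. Qed.

Lemma phi_anti (x y : R) : `|x| <= `|y| -> phi y <= phi x.
Proof.
move=> xy; rewrite lef_pV2 ?posrE// lerD2r.
by rewrite -(real_normK (num_real x)) -(real_normK (num_real y)) ler_sqr ?nnegrE.
Qed.

Lemma continuous_phi : continuous phi.
Proof.
move=> x; apply: cvgV; first by rewrite gt_eqF.
by apply: cvgD; [exact: exprn_continuous|exact: cvg_cst].
Qed.

Lemma rint_phi : rint setT phi.
Proof.
have := rintZ setT measurableT (2 * alpha)^-1 _ (rint_poisson alpha 0 alpha_gt0).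
congr (rint _ _); apply/funext => x; rewrite subr0 /poisson /phi [x ^+ 2 + _]addrC.
have d0 : alpha ^+ 2 + x ^+ 2 != 0 by rewrite addrC gt_eqF.
by field; rewrite d0 gt_eqF.
Qed.

Definition pt (x : R) (j : int) : R := x + 2 * pi * j%:~R.

Lemma ptD x i j : pt (pt x i) j = pt x (i + j).
Proof. by rewrite /pt intrD (mulrDr (2 * pi)) addrA. Qed.

Lemma pt_shift x j : pt (x + 2 * pi) j = pt x (j + 1).
Proof. by rewrite /pt intrD (mulrDr (2 * pi)) mulr1 addrA addrAC. Qed.

Lemma pt0 x : pt x 0 = x. Proof. by rewrite /pt mulr0 addr0. Qed.

Definition phi_sum_bound (r : R) : R := 13 * (1 + (1 + r ^+ 2) / alpha ^+ 2).

(** With y = x + 2 pi j one has j^2 <= y^2 + r^2, so a bound uniform for x in a bounded set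
    is obtained by comparing y^2 + alpha^2 with 1 + j^2. *)
Lemma phi_pt_le (r x : R) (j : int) : `|x| <= r ->
  phi (pt x j) <= (1 + (1 + r ^+ 2) / alpha ^+ 2) * (1 + j%:~R ^+ 2)^-1.
Proof.
move=> xr; have j0 : 0 < 1 + (j%:~R : R) ^+ 2 by rewrite ltr_wpDr ?sqr_ge0.
rewrite ler_pdivlMr// /phi mulrC ler_pdivrMr//.
set y := pt x j.
have pj : 4 * (j%:~R : R) ^+ 2 <= (2 * pi * j%:~R) ^+ 2.
  rewrite exprMn ler_wpM2r ?sqr_ge0// exprMn.
  have := pi_ge2 R => p2; have : 2 ^+ 2 <= pi ^+ 2 :> R by rewrite ler_sqr ?nnegrE// pi_ge0.
  nra.
have x2 : x ^+ 2 <= r ^+ 2.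
  by rewrite -(real_normK (num_real x)) ler_sqr ?nnegrE// (le_trans _ xr).
have e : 2 * pi * j%:~R = y - x by rewrite /y /pt addrC addKr.
rewrite e in pj.
have jb : (j%:~R : R) ^+ 2 <= y ^+ 2 + r ^+ 2.
  by have := sqr_ge0 (y + x); nra.
apply: (@le_trans _ _ (y ^+ 2 + (1 + r ^+ 2))); first lra.
have -> : (1 + (1 + r ^+ 2) / alpha ^+ 2) * (y ^+ 2 + alpha ^+ 2) =
   y ^+ 2 + (1 + r ^+ 2) + (alpha ^+ 2 + (1 + r ^+ 2) / alpha ^+ 2 * y ^+ 2).
  by field; rewrite gt_eqF.
rewrite lerDl addr_ge0 ?(ltW a2_gt0)// mulr_ge0 ?sqr_ge0// divr_ge0 ?(ltW a2_gt0)//.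
by rewrite addr_ge0 ?sqr_ge0.
Qed.

Lemma symsum_phi (r x : R) N : `|x| <= r ->
  symsum (fun j => phi (pt x j)) N <= phi_sum_bound r.
Proof.
move=> xr; set A := 1 + (1 + r ^+ 2) / alpha ^+ 2.
have A0 : 0 <= A.
  by rewrite addr_ge0// divr_ge0 ?(ltW a2_gt0)// addr_ge0 ?sqr_ge0.
apply: (@le_trans _ _ (symsum (fun j : int => A * (1 + j%:~R ^+ 2)^-1) N)).
  by apply: ler_symsum => j; exact: phi_pt_le.
rewrite symsumZ /phi_sum_bound mulrC ler_wpM2r//.
exact: symsum_inv_sqr.
Qed.

(** Lipschitz bounds weighted by phi itself, so that they may be summed over
    the translates. *)
Lemma phi_lipschitz (a b : R) :
  `|phi a - phi b| <= alpha^-1 * (phi a + phi b) * `|a - b|.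
Proof.
have e : phi a - phi b = (b - a) * (a + b) * (phi a * phi b).
  by rewrite /phi; field; rewrite !gt_eqF.
have h (x : R) : `|x| * phi x <= alpha^-1.
  rewrite ler_pdivrMr// -(@ler_pM2l _ alpha)// mulrA mulfV ?gt_eqF// mul1r.
  rewrite -(real_normK (num_real x)).
  have := sqr_ge0 (`|x| - alpha); have := normr_ge0 x; nra.
rewrite e !normrM (ger0_norm (phi_ge0 a)) (ger0_norm (phi_ge0 b)) distrC.
rewrite -mulrA mulrC ler_wpM2r//.
apply: (@le_trans _ _ ((`|a| + `|b|) * (phi a * phi b))).
  by rewrite ler_wpM2r ?ler_normD// mulr_ge0 ?phi_ge0.
have := h a; have := h b; have := phi_ge0 a; have := phi_ge0 b => pb pa hb ha.
have := ler_wpM2r pb ha; have := ler_wpM2r pa hb; lra.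
Qed.

Lemma exprn_lipschitz (c : R) (n : nat) : 0 <= c -> exists2 K, 0 <= K &
  forall x y : R, 0 <= x <= c -> 0 <= y <= c -> `|x ^+ n - y ^+ n| <= K * `|x - y|.
Proof.
move=> c0; elim: n => [|n [K K0 IH]].
  by exists 0 => // x y _ _; rewrite !expr0 subrr normr0 mul0r.
exists (c * K + c ^+ n); first by rewrite addr_ge0 ?mulr_ge0 ?exprn_ge0.
move=> x y /andP[x0 xc] /andP[y0 yc].
have -> : x ^+ n.+1 - y ^+ n.+1 = x * (x ^+ n - y ^+ n) + y ^+ n * (x - y).
  by rewrite !exprS; ring.
apply: (le_trans (ler_normD _ _)); rewrite !normrM mulrDl; apply: lerD.
- rewrite -mulrA ger0_norm//; apply: ler_pM => //.
  by apply: IH; rewrite ?x0 ?y0.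
- by rewrite ger0_norm ?exprn_ge0// ler_wpM2r// lerXn2r.
Qed.

Section Order.
Variables (k : nat) (k_gt0 : (0 < k)%N).

Definition phik (x : R) : R := phi x ^+ k.

Lemma phik_gt0 x : 0 < phik x. Proof. by rewrite exprn_gt0// phi_gt0. Qed.
Lemma phik_ge0 x : 0 <= phik x. Proof. exact/ltW/phik_gt0. Qed.

Lemma phik_le x : phik x <= alpha ^- 2 ^+ k.-1 * phi x.
Proof.
rewrite /phik -(prednK k_gt0) exprSr ler_wpM2r ?phi_ge0//.
by rewrite lerXn2r ?nnegrE ?phi_ge0 ?phi_le// invr_ge0 ltW.
Qed.

Lemma continuous_phik : continuous phik.
Proof. by move=> x; apply: (@continuous_comp _ _ _ phi (fun y : R => y ^+ k)); [exact: continuous_phi|exact: exprn_continuous]. Qed.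

Definition phik_bound (r : R) : R := alpha ^- 2 ^+ k.-1 * phi_sum_bound r.

Lemma symsum_phik (r x : R) N : `|x| <= r ->
  symsum (fun j => phik (pt x j)) N <= phik_bound r.
Proof.
move=> xr; apply: (@le_trans _ _ (symsum (fun j => alpha ^- 2 ^+ k.-1 * phi (pt x j)) N)).
  by apply: ler_symsum => j; exact: phik_le.
rewrite symsumZ ler_wpM2l ?exprn_ge0 ?invr_ge0 ?(ltW a2_gt0)//.
exact: symsum_phi.
Qed.

(** The periodization of phi^k, the denominator of the transform of the fundamental
    function once the signs of G_k are removed. *)
Definition ksum (x : R) : R := lim (symsum (fun j => phik (pt x j)) N @[N --> \oo]).

Lemma ksum_cvg x : symsum (fun j => phik (pt x j)) N @[N --> \oo] --> ksum x.
Proof.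
apply: (symsum_cvg _ (phik_bound `|x|)) => [j|N]; first exact: phik_ge0.
exact: symsum_phik.
Qed.

Lemma symsum_le_ksum x N : symsum (fun j => phik (pt x j)) N <= ksum x.
Proof.
apply: (nondecreasing_cvgn_le _ (cvgP _ (ksum_cvg x))).
by apply/nondecreasing_seqP => n; rewrite symsumS -addrA addrCA lerDl addr_ge0 ?phik_ge0.
Qed.

Lemma ksum_ge x j : phik (pt x j) <= ksum x.
Proof.
apply: le_trans (symsum_le_ksum x `|j|%N).
by apply: (symsum_ge (fun j => phik (pt x j))) => // i; exact: phik_ge0.
Qed.

Definition ksum_low : R := (4 * pi ^+ 2 + alpha ^+ 2) ^- k.

Lemma ksum_low_gt0 : 0 < ksum_low.
Proof. by rewrite invr_gt0 exprn_gt0// ltr_wpDl// mulr_ge0 ?sqr_ge0. Qed.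

(** Some translate of x lies in [0, 2 pi], and its term alone gives the bound. *)
Lemma ksum_lower x : ksum_low <= ksum x.
Proof.
have p2 : 0 < 2 * pi :> R by have := pi_gt0 R; lra.
pose j := Num.floor (x / (2 * pi)).
have /andP[j1 j2] := floor_itv (x / (2 * pi)).
apply: le_trans (ksum_ge x (- j)).
rewrite /ksum_low /phik -exprVn lerXn2r ?nnegrE ?phi_ge0//.
  by rewrite invr_ge0 addr_ge0 ?(ltW a2_gt0)// mulr_ge0 ?sqr_ge0.
have q0 : 0 < 4 * pi ^+ 2 + alpha ^+ 2 by rewrite ltr_wpDl// mulr_ge0 ?sqr_ge0.
rewrite lef_pV2 ?posrE// lerD2r.
have -> : 4 * pi ^+ 2 = (2 * pi) ^+ 2 :> R by ring.
rewrite /pt intrN mulrN.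
move: j1 j2; rewrite -/j ler_pdivlMr// ltr_pdivrMr// intrD => j1 j2.
rewrite ler_sqr ?nnegrE ?(ltW p2)//; first by lra.
by lra.
Qed.

Lemma ksum_gt0 x : 0 < ksum x. Proof. exact: lt_le_trans ksum_low_gt0 (ksum_lower x). Qed.

Lemma phik_cvg0 x : phik (pt x N.+1%:Z) @[N --> \oo] --> (0 : R) /\
  phik (pt x (- N%:Z)) @[N --> \oo] --> (0 : R).
Proof.
pose B := alpha ^- 2 ^+ k.-1 * (1 + (1 + `|x| ^+ 2) / alpha ^+ 2).
have B0 : 0 <= B.
  by rewrite mulr_ge0 ?exprn_ge0 ?invr_ge0 ?(ltW a2_gt0)// addr_ge0// divr_ge0 ?(ltW a2_gt0)// addr_ge0 ?sqr_ge0.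
have bnd (j : int) N : (N.+1%:R : R) <= 1 + j%:~R ^+ 2 -> 0 <= phik (pt x j) <= B * N.+1%:R^-1.
  move=> jN; rewrite phik_ge0/=; apply: (le_trans (phik_le _)).
  rewrite -mulrA ler_wpM2l ?exprn_ge0 ?invr_ge0 ?(ltW a2_gt0)//.
  apply: (le_trans (phi_pt_le `|x| x j (lexx _))).
  rewrite ler_wpM2l ?addr_ge0 ?divr_ge0 ?(ltW a2_gt0) ?addr_ge0 ?sqr_ge0//.
  by rewrite lef_pV2 ?posrE// (lt_le_trans _ jN).
have lim0 : B * N.+1%:R^-1 @[N --> \oo] --> (0 : R).
  by rewrite -[0](mulr0 B); apply: cvgM; [exact: cvg_cst|exact: cvg_harmonic].
split; apply: (@squeeze0 _ _ (fun N => B * N.+1%:R^-1)) => // N; apply: bnd.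
- by rewrite -natrX [1 + _]addrC natr1 ler_nat; apply: leqW; rewrite -{1}(expn1 N.+1) leq_pexp2l.
- rewrite intrN sqrrN -natrX [1 + _]addrC natr1 ler_nat ltnS.
  by case: N => // N; rewrite -{1}(expn1 N.+1) leq_pexp2l.
Qed.

Lemma ksum_periodic x : ksum (x + 2 * pi) = ksum x.
Proof.
have [a b] := phik_cvg0 x.
have H : symsum (fun j => phik (pt x j)) N +
    (phik (pt x N.+1%:Z) - phik (pt x (- N%:Z))) @[N --> \oo] --> ksum x.
  by have := cvgD (ksum_cvg x) (cvgB a b); rewrite subrr addr0; exact.
have L : symsum (fun j => phik (pt (x + 2 * pi) j)) N @[N --> \oo] --> ksum x.
  apply: (eq_cvgn _ _ _ _ H) => N.
  rewrite -[RHS](symsum_shift (fun j => phik (pt x j))).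
  by apply: eq_bigr => i _; rewrite pt_shift.
exact: (cvg_unique _ (ksum_cvg (x + 2 * pi)) L).
Qed.

Lemma ksum_pt x j : ksum (pt x j) = ksum x.
Proof.
have nat x' (n : nat) : ksum (pt x' n) = ksum x'.
  elim: n => [|n IH]; first by rewrite pt0.
  by rewrite -addn1 PoszD -ptD -[RHS]IH -[RHS]ksum_periodic /pt mulr1.
case: j => n; first exact: nat.
by rewrite -(nat (pt x (Negz n)) n.+1) ptD NegzE addNr pt0.
Qed.

Lemma measurable_ksum : measurable_fun setT ksum.
Proof.
apply: (@measurable_fun_cvg _ _ _ setT (fun N x => symsum (fun j => phik (pt x j)) N)) => //.
  move=> N; apply: measurable_sum => i; apply: (measurableT_comp _ (measurable_shift _)).
  by apply: continuous_measurable_fun; exact: continuous_phik.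
by move=> x _; exact: ksum_cvg.
Qed.

(** Up to the factor (2 pi)^(-1/2) this is the Fourier transform of the fundamental
    function: the signs (-1)^k of numerator and denominator cancel. *)
Definition mult (x : R) : R := phik x / ksum x.

Lemma mult_ge0 x : 0 <= mult x.
Proof. by rewrite divr_ge0 ?phik_ge0 ?(ltW (ksum_gt0 x)). Qed.

Lemma mult_le1 x : mult x <= 1.
Proof. by rewrite ler_pdivrMr ?ksum_gt0// mul1r -[x in phik x]pt0 ksum_ge. Qed.

Lemma mult_pt x j : mult (pt x j) = (ksum x)^-1 * phik (pt x j).
Proof. by rewrite /mult ksum_pt mulrC. Qed.

Lemma measurable_mult : measurable_fun setT mult.
Proof.
apply: measurable_funM; first by apply: continuous_measurable_fun; exact: continuous_phik.
by apply: measurable_invr; exact: measurable_ksum.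
Qed.

(** The denominator is bounded below, and phi^k is bounded by a multiple of phi. *)
Lemma rint_mult : rint setT mult.
Proof.
apply: (rint_le setT measurableT _ (fun x => ksum_low^-1 * (alpha ^- 2 ^+ k.-1) * phi x)).
- exact: measurable_mult.
- by apply: rintZ => //; exact: rint_phi.
- move=> x _; rewrite ger0_norm ?mult_ge0// /mult mulrC -mulrA.
  apply: ler_pM; rewrite ?invr_ge0 ?(ltW (ksum_gt0 x)) ?phik_ge0//; last exact: phik_le.
  by rewrite lef_pV2 ?posrE ?ksum_low_gt0 ?ksum_gt0// ksum_lower.
Qed.

Lemma symsum_mult_le1 x N : symsum (fun j => mult (pt x j)) N <= 1.
Proof.
have -> : symsum (fun j => mult (pt x j)) N = (ksum x)^-1 * symsum (fun j => phik (pt x j)) N.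
  by rewrite -symsumZ; apply: eq_bigr => i _; exact: mult_pt.
by rewrite mulrC ler_pdivrMr ?ksum_gt0// mul1r symsum_le_ksum.
Qed.

End Order.
End Kernel.

(** * Periodization of the modulated multiplier *)

Section Periodization.
Context {R : realType}.
Local Notation C := R[i].
Local Notation Re := (@complex.Re R).
Local Notation Im := (@complex.Im R).
Local Notation nc := (@Normc.normc R).
Local Notation D := (@period R).
Local Notation mD := (@measurable_period R).
Variables (alpha : R) (alpha_gt0 : 0 < alpha) (k : nat) (k_gt0 : (0 < k)%N).
Local Notation phi := (phi alpha).
Local Notation phik := (phik alpha k).
Local Notation ksum := (ksum alpha k).
Local Notation mult := (mult alpha k).

Let phik0 x : 0 <= phik x. Proof. exact: phik_ge0. Qed.

Definition modulated (y x : R) : C := (phik x)%:C * cis (y * x).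

Lemma nc_modulated y x : nc (modulated y x) = phik x.
Proof. by rewrite ncM nc_cis mulr1 ncr ger0_norm. Qed.

Lemma modulated_lipschitz y : exists2 K, 0 <= K & forall a b,
  nc (modulated y a - modulated y b) <= K * (phi a + phi b) * `|a - b|.
Proof.
have c0 : 0 <= alpha ^- 2 by rewrite invr_ge0 sqr_ge0.
have [K K0 HK] := exprn_lipschitz (alpha ^- 2) k c0.
have b0 : 0 <= alpha ^- 2 ^+ k.-1 * `|y| by rewrite mulr_ge0// exprn_ge0.
exists (K * alpha^-1 + alpha ^- 2 ^+ k.-1 * `|y|).
  by rewrite addr_ge0// mulr_ge0// invr_ge0 ltW.
move=> a b.
have pa := phi_ge0 alpha alpha_gt0 a; have pb := phi_ge0 alpha alpha_gt0 b.
have e : modulated y a - modulated y b =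
    (phik a - phik b)%:C * cis (y * a) + (phik b)%:C * (cis (y * a) - cis (y * b)).
  by rewrite rmorphB /= /modulated mulrBl mulrBr addrA subrK.
rewrite e; apply: (le_trans (ncD _ _)); rewrite !ncM nc_cis mulr1 !ncr mulrDl mulrDl.
apply: lerD.
- apply: (@le_trans _ _ (K * `|phi a - phi b|)).
    by apply: HK; rewrite ?pa ?pb phi_le.
  rewrite -!mulrA ler_wpM2l// !mulrA; exact: phi_lipschitz.
- rewrite ger0_norm//; apply: (@le_trans _ _ ((alpha ^- 2 ^+ k.-1 * phi b) * (`|y| * `|a - b|))).
    apply: ler_pM; rewrite ?nc_ge0//; first exact: phik_le.
    by apply: (le_trans (cis_lipschitz _ _)); rewrite -mulrBr normrM.
  rewrite -!mulrA ler_wpM2l ?exprn_ge0// mulrCA ler_wpM2l// ler_wpM2r// lerDr.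
  exact: phi_ge0.
Qed.

Definition fterm (y x : R) (j : int) : C := modulated y (pt x j).

Definition Nsum (y x : R) : C := clim (symsum (fterm y x)).

Lemma Nsum_cvg y x : ccvg (symsum (fterm y x)) (Nsum y x).
Proof.
apply: (csymsum_cvg _ (phik_bound alpha k `|x|)) => N.
apply: (@le_trans _ _ (symsum (fun j => phik (pt x j)) N)).
  by apply: ler_symsum => j; rewrite [X in X <= _](nc_modulated y (pt x j)).
exact: symsum_phik.
Qed.

Lemma symsum_fterm_le y x N : nc (symsum (fterm y x) N) <= ksum x.
Proof.
apply: (le_trans (nc_symsum _ _)).
apply: (@le_trans _ _ (symsum (fun j => phik (pt x j)) N)).
  by apply: ler_symsum => j; rewrite [X in X <= _](nc_modulated y (pt x j)).
exact: symsum_le_ksum.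
Qed.

Lemma Nsum_le y x : nc (Nsum y x) <= ksum x.
Proof. exact: (ccvg_nc_le _ _ _ (Nsum_cvg y x) (symsum_fterm_le y x)). Qed.

Lemma Nsum0 x : Nsum 0 x = (ksum x)%:C.
Proof.
apply: (ccvg_unique _ _ _ (Nsum_cvg 0 x)).
have E j : fterm 0 x j = (phik (pt x j))%:C.
  by rewrite /fterm /modulated mul0r cis0 mulr1.
apply/ccvgP; split.
- apply: (eq_cvgn _ _ _ _ (ksum_cvg alpha alpha_gt0 k k_gt0 x)) => N; rewrite Re_symsum.
  by apply: eq_bigr => i _; rewrite -[LHS]/(Re (fterm 0 x (sidx N i))) E.
- apply: (eq_cvgn _ (fun=> 0)); last exact: cvg_cst.
  by move=> N; rewrite Im_symsum /symsum big1// => i _; rewrite -[LHS]/(Im (fterm 0 x (sidx N i))) E.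
Qed.

Lemma Nsum_lipschitz y (r : R) : exists2 K, 0 <= K & forall a b,
  `|a| <= r -> `|b| <= r -> nc (Nsum y a - Nsum y b) <= K * `|a - b|.
Proof.
have [K K0 HK] := modulated_lipschitz y.
have [r0|r0] := leP 0 r; last first.
  by exists 0 => // a b ar; have := normr_ge0 a; lra.
exists (K * (2 * phi_sum_bound alpha r)).
  rewrite !mulr_ge0// addr_ge0// divr_ge0 ?sqr_ge0// addr_ge0 ?sqr_ge0//.
move=> a b ar br.
apply: (ccvg_nc_le _ _ _ (ccvgD _ _ _ _ (Nsum_cvg y a) (ccvgN _ _ (Nsum_cvg y b)))) => N.
rewrite -symsumB; apply: (le_trans (nc_symsum _ _)).
apply: (@le_trans _ _ (symsum (fun j => K * `|a - b| * (phi (pt a j) + phi (pt b j))) N)).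
  apply: ler_symsum => j; apply: (le_trans (HK _ _)).
  by rewrite /pt opprD addrACA subrr addr0 mulrAC.
rewrite symsumZ [leRHS]mulrAC ler_wpM2l ?mulr_ge0//.
rewrite symsumD mulr_natl mulr2n; apply: lerD; exact: symsum_phi.
Qed.

Lemma Nsum_periodic y x : Nsum y (x + 2 * pi) = Nsum y x.
Proof.
have [a b] := phik_cvg0 alpha alpha_gt0 k k_gt0 x.
have a' : ccvg (fun N => fterm y x N.+1%:Z) 0.
  by rewrite /ccvg; apply: (eq_cvgn _ _ _ _ a) => N; rewrite subr0 nc_modulated.
have b' : ccvg (fun N => fterm y x (- N%:Z)) 0.
  by rewrite /ccvg; apply: (eq_cvgn _ _ _ _ b) => N; rewrite subr0 nc_modulated.
have H := ccvgD _ _ _ _ (Nsum_cvg y x) (ccvgD _ _ _ _ a' (ccvgN _ _ b')).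
rewrite subrr addr0 in H.
apply: (ccvg_unique _ _ _ _ H).
have := Nsum_cvg y (x + 2 * pi); congr (ccvg _ _); apply/funext => N.
rewrite -(symsum_shift (fterm y x)); apply: eq_bigr => i _.
by rewrite /fterm pt_shift.
Qed.

(** Since the denominator of the multiplier is periodic, this is the sum over j of
    mult (x + 2 pi j) e^(iy(x + 2 pi j)): an average of the translated characters with
    the values of the multiplier as weights. *)
Definition Psum (y x : R) : C := ((ksum x)^-1)%:C * Nsum y x.

Let S0 x : 0 < ksum x. Proof. exact: ksum_gt0. Qed.

Lemma Psum_periodic y x : Psum y (x + 2 * pi) = Psum y x.
Proof. by rewrite /Psum Nsum_periodic ksum_periodic. Qed.

Lemma Psum_le1 y x : nc (Psum y x) <= 1.
Proof.
rewrite ncM ncr ger0_norm ?invr_ge0 ?(ltW (S0 _))// mulrC ler_pdivrMr// mul1r.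
exact: Nsum_le.
Qed.

(** For y = 0 the numerator is the denominator itself, so the quotient rule only involves
    Lipschitz bounds for the numerators. *)
Lemma Psum_lipschitz y (r : R) : exists2 K, 0 <= K & forall a b,
  `|a| <= r -> `|b| <= r -> nc (Psum y a - Psum y b) <= K * `|a - b|.
Proof.
have [K1 K10 H1] := Nsum_lipschitz y r; have [K2 K20 H2] := Nsum_lipschitz 0 r.
have s0 := ksum_low_gt0 alpha alpha_gt0 k.
exists ((ksum_low alpha k)^-1 * (K1 + K2)).
  by rewrite mulr_ge0 ?addr_ge0// invr_ge0 ltW.
move=> a b ar br.
have e : Psum y a - Psum y b = ((ksum b)^-1)%:C * ((Nsum y a - Nsum y b) -
   (Nsum 0 a - Nsum 0 b) * Psum y a).
  rewrite /Psum !Nsum0 -rmorphB /=.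
  have nb : (ksum b)%:C != 0 :> C by apply/eqP => -[]/eqP; rewrite gt_eqF.
  have na : (ksum a)%:C != 0 :> C by apply/eqP => -[]/eqP; rewrite gt_eqF.
  have -> : ((ksum b)^-1)%:C = ((ksum b)%:C)^-1 :> C by rewrite fmorphV.
  have -> : ((ksum a)^-1)%:C = ((ksum a)%:C)^-1 :> C by rewrite fmorphV.
  rewrite rmorphB /=; field; by rewrite na nb.
rewrite e ncM ncr ger0_norm ?invr_ge0 ?(ltW (S0 _))//.
rewrite -mulrA; apply: ler_pM; rewrite ?nc_ge0 ?invr_ge0 ?(ltW (S0 _))//.
  by rewrite lef_pV2 ?posrE// ksum_lower.
apply: (le_trans (ncB _ _)); rewrite [leRHS]mulrDl; apply: lerD; first exact: H1.
rewrite ncM; apply: le_trans (H2 a b ar br).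
by rewrite ler_piMr ?nc_ge0// Psum_le1.
Qed.

Lemma cmeas_Psum y : cmeas setT (Psum y).
Proof.
apply: cmeasM.
  by apply: cmeas_real; apply: measurable_invr; exact: measurable_ksum.
apply: (cmeas_lim setT (fun N x => symsum (fterm y x) N)) => // [N|x _]; last exact: Nsum_cvg.
apply: cmeas_sum => i; apply: cmeasM.
  apply: cmeas_real; apply: (measurableT_comp _ (measurable_shift _)).
  by apply: continuous_measurable_fun; exact: continuous_phik.
apply: cmeas_cis; apply: (measurableT_comp (measurable_lin y setT)).
exact: measurable_shift.
Qed.

(** The multiplier sums to one over the translates, so replacing the translated
    characters by one of them costs at most twice the mass off that translate. *)
Lemma Psum_near y x : nc (cis (y * x) - Psum y x) <= 2 * (1 - mult x).
Proof.
have Sx := S0 x; have Sn : ksum x != 0 by rewrite gt_eqF.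
have E : cis (y * x) - Psum y x = ((ksum x)^-1)%:C * (Nsum 0 x * cis (y * x) - Nsum y x).
  rewrite /Psum Nsum0 mulrBr mulrA -rmorphM /= mulVf//.
  by rewrite mul1r.
have -> : 2 * (1 - mult x) = (ksum x)^-1 * (2 * (ksum x - phik x)).
  by rewrite /mult; field.
rewrite E ncM ncr ger0_norm ?invr_ge0 ?(ltW (S0 _))// ler_wpM2l ?invr_ge0 ?(ltW (S0 _))//.
have cv := ccvgD _ _ _ _ (ccvgM _ _ _ _ (Nsum_cvg 0 x) (ccvg_cst (cis (y * x))))
  (ccvgN _ _ (Nsum_cvg y x)).
apply: (ccvg_nc_le _ _ _ cv) => N.
have -> : symsum (fterm 0 x) N * cis (y * x) - symsum (fterm y x) N =
    symsum (fun j => (phik (pt x j))%:C * (cis (y * x) - cis (y * pt x j))) N.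
  rewrite /symsum mulr_suml -sumrB; apply: eq_bigr => i _.
  by rewrite /fterm /modulated mul0r cis0 mulr1 mulrBr.
apply: (le_trans (nc_symsum _ _)).
apply: (@le_trans _ _ (symsum (fun j => 2 * (phik (pt x j) - (if j == 0 then phik x else 0))) N)).
  apply: ler_symsum => j.
  rewrite -[X in X <= _]/(nc ((phik (pt x j))%:C * (cis (y * x) - cis (y * pt x j)))).
  rewrite ncM ncr ger0_norm//.
  case: eqVneq => [->|_].
    by rewrite pt0 !subrr nc0 !mulr0.
  rewrite subr0 [leRHS]mulrC ler_wpM2l//.
  by apply: (le_trans (ncB _ _)); rewrite !nc_cis.
rewrite symsumZ ler_wpM2l// symsumB symsum_delta lerB//.
exact: symsum_le_ksum.
Qed.

(** An integral frequency gives the same character at all the points x + 2 pi j. *)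
Lemma Psum_char y (n : int) x : Psum (y + n%:~R) x = Psum y x * char n x.
Proof.
rewrite /Psum -mulrA; congr (_ * _).
apply: (ccvg_unique _ _ _ (Nsum_cvg (y + n%:~R) x)).
have := ccvgM _ _ _ _ (Nsum_cvg y x) (ccvg_cst (char n x)).
congr (ccvg _ _); apply/funext => N; rewrite /symsum mulr_suml; apply: eq_bigr => i _.
rewrite /fterm /modulated -mulrA; congr (_ * _).
rewrite mulrDl cisD; congr (_ * _); rewrite /pt (mulrDr n%:~R) cisD /char.
have -> : n%:~R * (2 * pi * (sidx N i)%:~R) = 2 * pi * (n * sidx N i)%:~R :> R.
  by rewrite intrM; ring.
by rewrite cis_2piz mulr1.
Qed.

(** Cut the line into translates of the period and sum under the integral sign; the
    partial sums are bounded by 1 because the multiplier sums to at most 1. *)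
Lemma mult_periodize y :
  cint setT (fun x => (mult x)%:C * cis (y * x)) = cint D (Psum y).
Proof.
have jm : nint setT (fun x => (mult x)%:C).
  by apply: nint_real => //; exact: rint_mult.
have jF : nint setT (fun x => (mult x)%:C * cis (y * x)).
  exact: (nintM_cis setT measurableT _ (fun x => y * x) jm (measurable_lin y setT)).
have bF x : nc ((mult x)%:C * cis (y * x)) <= 1.
  by rewrite ncM nc_cis mulr1 ncr ger0_norm ?mult_ge0// mult_le1.
have L := tiling_cint _ 1 jF bF.
apply: (ccvg_unique _ _ _ L).
have jt (j : int) : nint D (fun x => (mult (pt x j))%:C * cis (y * pt x j)).
  apply: (nint_bounded _ 1) => [|x _]; last exact: bF.
  apply: (cmeasS D setT) => //.
  have [[a b] _] := jF.
  by split; [exact: (measurableT_comp a (measurable_shift _))|exact: (measurableT_comp b (measurable_shift _))].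
have E x : symsum (fun j => (mult (pt x j))%:C * cis (y * pt x j)) =
    fun N => ((ksum x)^-1)%:C * symsum (fterm y x) N.
  apply/funext => N; rewrite /symsum mulr_sumr; apply: eq_bigr => i _.
  by rewrite mult_pt// rmorphM /= -mulrA.
have : ccvg (fun N => cint D (fun x => symsum (fun j => (mult (pt x j))%:C * cis (y * pt x j)) N))
    (cint D (Psum y)).
  apply: (cdct D mD _ _ (fun=> 1)).
  - by move=> N; apply: cmeas_sum => i; case: (jt (sidx N i)).
  - exact: rint_cst.
  - move=> N x _; apply: (le_trans (nc_symsum _ _)).
    apply: le_trans (symsum_mult_le1 alpha alpha_gt0 k k_gt0 x N).
    apply: ler_symsum => j.
    rewrite -[X in X <= _]/(nc ((mult (pt x j))%:C * cis (y * pt x j))).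
    by rewrite ncM nc_cis mulr1 ncr ger0_norm ?mult_ge0.
  - by move=> x _; rewrite E; apply: ccvgZ; exact: Nsum_cvg.
congr (ccvg _ _); apply/funext => N.
by rewrite /symsum (cint_sum D mD)// => i; exact: jt.
Qed.

End Periodization.

(** * Concentration of the multiplier *)

Section Concentration.
Context {R : realType}.
Local Notation D := (@period R).
Variables (alpha : R) (alpha_gt0 : 0 < alpha).

(** Inside the period the translate nearest to the origin dominates
    geometrically in the order. *)
Lemma mult_cvg1 (x : R) : D x -> mult alpha n.+1 x @[n --> \oo] --> (1 : R).
Proof.
move=> Dx; have p0 := pi_gt0 R.
have {Dx} xp : `|x| < pi by move: Dx; rewrite /period/= in_itv/= ltr_norml.
pose z := 2 * pi - `|x|.
have z0 : `|x| < `|z| by rewrite (ger0_norm (_ : 0 <= z)) /z; lra.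
have px := phi_gt0 alpha alpha_gt0 x.
pose rho := phi alpha z / phi alpha x.
have rho0 : 0 <= rho by rewrite divr_ge0// phi_ge0.
have rho1 : rho < 1.
  rewrite ltr_pdivrMr// mul1r /phi ltf_pV2 ?posrE ?phi_den_gt0// ltrD2r.
  by rewrite -(real_normK (num_real x)) -(real_normK (num_real z)) ltr_sqr ?nnegrE.
have far (j : int) : j != 0 -> phi alpha (pt x j) <= rho * phi alpha x.
  move=> j0; rewrite /rho mulfVK ?gt_eqF//; apply: phi_anti => //.
  rewrite (ger0_norm (_ : 0 <= z)) /z; last by lra.
  have j1 : 1 <= `|j%:~R : R| by rewrite -intr_norm -[1]/(1%:~R) ler_int; lia.
  have : `|2 * pi * j%:~R| <= `|pt x j| + `|x|.
    have -> : 2 * pi * j%:~R = pt x j - x by rewrite /pt addrC addKr.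
    exact: ler_normB.
  rewrite normrM (ger0_norm (_ : 0 <= 2 * pi)); last by lra.
  nra.
pose B := phi_sum_bound alpha `|x|.
have bound n : 1 - mult alpha n.+1 x <= B / phi alpha x * rho ^+ n.
  have Sx := ksum_gt0 alpha alpha_gt0 n.+1 erefl x.
  have pk := phik_gt0 alpha alpha_gt0 n.+1 x.
  have c0 : 0 <= (rho * phi alpha x) ^+ n by rewrite exprn_ge0// mulr_ge0// ltW.
  have SB : ksum alpha n.+1 x <= phik alpha n.+1 x + (rho * phi alpha x) ^+ n * B.
    have := ksum_cvg alpha alpha_gt0 n.+1 erefl x => /cvgr_to_le; apply; apply: nearW => N.
    apply: (@le_trans _ _ (symsum (fun j => (if j == 0 then phik alpha n.+1 x else 0) +
       (rho * phi alpha x) ^+ n * phi alpha (pt x j)) N)).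
      apply: ler_symsum => j; case: eqVneq => [->|j0].
        by rewrite pt0 lerDl mulr_ge0// phi_ge0.
      rewrite add0r /phik exprSr ler_wpM2r ?phi_ge0// lerXn2r ?nnegrE ?phi_ge0 ?far//.
      by rewrite mulr_ge0// ltW.
    rewrite symsumD symsum_delta lerD2l symsumZ ler_wpM2l//.
    exact: symsum_phi.
  have -> : 1 - mult alpha n.+1 x = (ksum alpha n.+1 x - phik alpha n.+1 x) / ksum alpha n.+1 x.
    by rewrite /mult; field; rewrite gt_eqF.
  apply: (@le_trans _ _ ((rho * phi alpha x) ^+ n * B / phik alpha n.+1 x)).
    apply: ler_pM.
    - by rewrite subr_ge0 -[x in phik _ _ x]pt0 ksum_ge.
    - by rewrite invr_ge0 ltW.
    - by lra.
    - by rewrite lef_pV2 ?posrE// -[x in phik _ _ x]pt0 ksum_ge.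
  rewrite /phik exprMn exprSr.
  have xn : phi alpha x ^+ n != 0 by rewrite expf_neq0// gt_eqF.
  have xn0 : phi alpha x != 0 by rewrite gt_eqF.
  rewrite le_eqVlt; apply/orP; left; apply/eqP; field; by rewrite xn0 xn.
have lim0 : B / phi alpha x * rho ^+ n @[n --> \oo] --> (0 : R).
  rewrite -[0](mulr0 (B / phi alpha x)); apply: cvgM; first exact: cvg_cst.
  by apply: cvg_expr; rewrite ger0_norm.
have : 1 - mult alpha n.+1 x @[n --> \oo] --> (0 : R).
  apply: (squeeze0 _ _ _ lim0) => n; rewrite bound andbT subr_ge0.
  exact: mult_le1.
move=> H; rewrite -[X in _ --> X]subr0.
have : 1 - (1 - mult alpha n.+1 x) @[n --> \oo] --> (1 - 0 : R).
  by apply: cvgB => //; exact: cvg_cst.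
by apply: eq_cvgn => n; ring.
Qed.

End Concentration.

(** * Band-limited functions *)

Section BandLimited.
Context {R : realType}.
Local Notation C := R[i].
Local Notation nc := (@Normc.normc R).
Local Notation mu := (@lebesgue_measure R).
Local Notation D := (@period R).
Local Notation mD := (@measurable_period R).

Definition band : set R := `[(- pi), pi]%classic.

Lemma measurable_band : measurable band.
Proof. exact: measurable_itv. Qed.

Definition band_limited (V : zmodType) (f : R -> V) :=
  {ae mu, forall xi, ~ (- pi <= xi <= pi) -> f xi = 0}.

Lemma band_limited_comp (V W : zmodType) (f : R -> V) (F : R -> W) :
  (forall xi, f xi = 0 -> F xi = 0) -> band_limited V f -> band_limited W F.
Proof.
move=> fF; apply: filterS; first exact: (ae_filter_ringOfSetsType mu).
by move=> xi h /h /fF.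
Qed.

Lemma integral_band_limited (F : R -> R) : measurable_fun setT F -> band_limited R F ->
  (\int[mu]_x (F x)%:E = \int[mu]_(x in band) (F x)%:E)%E.
Proof.
move=> mF bF; rewrite [RHS]integral_mkcond; apply: ae_eq_integral => //.
- exact/measurable_EFinP.
- apply/(measurable_restrictT _ measurable_band).
  by apply: measurable_funTS; exact/measurable_EFinP.
- move: bF; apply: filterS; first exact: (ae_filter_ringOfSetsType mu).
  move=> xi h _; rewrite /patch; case: ifPn => // xN.
  rewrite h//; move/negP: xN => xN hx; apply: xN; rewrite inE /band /= in_itv/=; exact: hx.
Qed.

Lemma integrable_band_limited (F : R -> R) : measurable_fun setT F -> band_limited R F ->
  rint band F -> rint setT F.
Proof.
move=> mF bF /integrableP[_ jF]; apply/integrableP; split; first exact/measurable_EFinP.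
have mN : measurable_fun setT (fun x => `|F x|) by exact: measurableT_comp.
have bN : band_limited R (fun x => `|F x|).
  by apply: band_limited_comp bF => xi ->; rewrite normr0.
by have := integral_band_limited _ mN bN; rewrite /= => ->.
Qed.

Lemma Rintegral_band_limited (F : R -> R) : rint setT F -> band_limited R F ->
  Rintegral mu setT F = Rintegral mu D F.
Proof.
move=> jF bF; have mF := rint_meas _ _ jF.
have -> : Rintegral mu setT F = Rintegral mu band F by rewrite /Rintegral (integral_band_limited F mF bF).
have js (E : set R) : measurable E -> rint E F by move=> mE; exact: integrableS jF.
rewrite /period /band Rintegral_itv_bndo_bndc; last exact: js.
by rewrite Rintegral_itv_obnd_cbnd//; exact: js.
Qed.

Lemma cint_band_limited (F : R -> C) : nint setT F -> band_limited C F ->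
  cint setT F = cint D F.
Proof.
move=> jF bF; apply: eq_ReIm; rewrite ?Re_cint ?Im_cint; apply: Rintegral_band_limited.
- exact: nint_Re.
- by apply: band_limited_comp bF => xi /= ->.
- exact: nint_Im.
- by apply: band_limited_comp bF => xi /= ->.
Qed.

Lemma inL2_sqint (h : R -> C) : inL2 h -> sqint h.
Proof.
move=> h2; split; first by apply: (cmeasS D setT) => //; case: h2.
by have := inL2_rint h h2; apply: integrableS => //; exact: mD.
Qed.

(** The band has finite measure, on which square-integrability implies integrability. *)
Lemma nint_band_limited (h : R -> C) : inL2 h -> band_limited C h -> nint setT h.
Proof.
move=> h2 bh; split; first by case: h2.
apply: integrable_band_limited.
- by apply: measurable_nc; case: h2.
- by apply: band_limited_comp bh => xi /= ->; rewrite nc0.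
have mA := @measurable_band.
have A1 : rint band (fun x : R => 1 + nc (h x) ^+ 2).
  apply: rintD => //.
  - apply: continuous_compact_integrable; first exact: segment_compact.
    by apply: continuous_subspaceT => x; exact: cvg_cst.
  - by have := inL2_rint h h2; apply: integrableS.
apply: (rint_le _ mA _ _ _ A1).
  by apply: measurable_funTS; apply: measurable_nc; case: h2.
move=> x _ /=; rewrite ger0_norm ?nc_ge0//.
by have := sqr_ge0 (nc (h x) - 1); have := nc_ge0 (h x); nra.
Qed.

End BandLimited.

(** * The interpolation error *)

Section Interpolation.
Context {R : realType}.
Local Notation C := R[i].
Local Notation nc := (@Normc.normc R).
Local Notation mu := (@lebesgue_measure R).
Local Notation D := (@period R).
Local Notation mD := (@measurable_period R).
Local Notation c0 := (@c0 R).
Variables (alpha : R) (alpha_gt0 : 0 < alpha).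

Lemma GkE k x : Gk alpha k x = (-1) ^+ k * phik alpha k x.
Proof. by rewrite /Gk /phik /phi exprVn. Qed.

(** The terms share the sign (-1)^k, hence the sum is absolutely convergent and may be
    taken symmetrically. *)
Lemma sumZ_Gk k xi : (0 < k)%N ->
  sumZ (fun j => Gk alpha k (xi - 2 * pi * j%:~R)) = (-1) ^+ k * ksum alpha k xi.
Proof.
move=> k0.
have E j : xi - 2 * pi * j%:~R = pt xi (- j) by rewrite /pt intrN mulrN.
have nn j : `|Gk alpha k (xi - 2 * pi * j%:~R)| = phik alpha k (pt xi (- j)).
  by rewrite GkE normrM normrX normrN1 expr1n mul1r E ger0_norm// phik_ge0.
apply: (sumZ_symsum _ (phik_bound alpha k `|xi|)).
  move=> s us; under eq_bigr do rewrite nn.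
  apply: sum_le_symsum => // [j|N]; first exact: phik_ge0.
  by rewrite (symsumN (fun j => phik alpha k (pt xi j))) symsum_phik.
have : (-1) ^+ k * symsum (fun j => phik alpha k (pt xi j)) N @[N --> \oo] --> (-1) ^+ k * ksum alpha k xi.
  by apply: cvgM; [exact: cvg_cst|exact: ksum_cvg].
apply: eq_cvgn => N; rewrite -(symsumN (fun j => phik alpha k (pt xi j))) -symsumZ.
apply: eq_bigr => i _.
by rewrite GkE E.
Qed.

Lemma hatLE k xi : (0 < k)%N -> hatL alpha k xi = c0 * mult alpha k xi.
Proof.
move=> k0; rewrite /hatL sumZ_Gk// GkE /mult; congr (_ * _).
by rewrite -mulf_div divff ?mul1r// signr_eq0.
Qed.

Lemma c0_sqrE : c0 * c0 = (2 * pi)^-1.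
Proof.
have p0 : 2 * pi != 0 :> R by rewrite gt_eqF// mulr_gt0// pi_gt0.
by apply: (mulIf p0); rewrite c0_sqr mulVf.
Qed.

Lemma fundamentalE k (L : R -> C) y : (0 < k)%N -> fundamental alpha k L ->
  L y = ((2 * pi)^-1)%:C * cint D (Psum alpha k y).
Proof.
move=> k0 [Lc Lh].
have EL xi : (hatL alpha k xi)%:C = c0%:C * (mult alpha k xi)%:C by rewrite hatLE// rmorphM.
have jm : nint setT (fun xi => (mult alpha k xi)%:C).
  by apply: nint_real => //; exact: rint_mult.
have jL : nint setT (fun xi => (hatL alpha k xi)%:C).
  apply: (eq_nint setT (fun xi => c0%:C * (mult alpha k xi)%:C)) => [xi|]; first by rewrite EL.
  exact: nintZ.
rewrite (fourier_inversion y L _ Lc Lh jL) -mult_periodize//.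
have -> : ((2 * pi)^-1)%:C = c0%:C * c0%:C :> C by rewrite -rmorphM /= c0_sqrE.
rewrite -[RHS]mulrA; congr (_ * _).
rewrite -(cintZ setT measurableT c0%:C (fun xi => (mult alpha k xi)%:C * cis (y * xi))); last first.
  exact: (nintM_cis setT measurableT _ (fun xi => y * xi) jm (measurable_lin y setT)).
by apply: eq_cint => xi _; rewrite EL mulrA.
Qed.

(** Translating the fundamental function by j multiplies its periodized transform by a
    character, so its values at the points x - j are the Fourier coefficients of one
    function of the frequency. *)
Lemma fundamental_translate k (L : R -> C) x j : (0 < k)%N -> fundamental alpha k L ->
  L (x - j%:~R) = ((2 * pi)^-1)%:C * fcoef (Psum alpha k x) j.
Proof.
move=> k0 FL; rewrite (fundamentalE k L)//; congr (_ * _); apply: eq_cint => xi _.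
by rewrite -intrN Psum_char.
Qed.

Lemma csumZ_symsum (u : int -> C) (M : R) (l : C) :
  (forall s, uniq s -> \sum_(j <- s) nc (u j) <= M) -> ccvg (symsum u) l -> csumZ u = l.
Proof.
move=> uM /ccvgP[lR lI]; apply: eq_ReIm => /=.
- apply: (sumZ_symsum _ M) => [s us|].
    by apply: le_trans (uM s us); apply: ler_sum => j _; exact: Re_le_nc.
  by apply: (eq_cvgn _ _ _ _ lR) => N; rewrite Re_symsum.
- apply: (sumZ_symsum _ M) => [s us|].
    by apply: le_trans (uM s us); apply: ler_sum => j _; exact: Im_le_nc.
  by apply: (eq_cvgn _ _ _ _ lI) => N; rewrite Im_symsum.
Qed.

Section PaleyWiener.
Variables (g h : R -> C).
Hypothesis g_cont : ccontinuous g.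
Hypothesis g_hat : fourierL2 g h.
Hypothesis h_band : band_limited C h.

Let h2 : inL2 h. Proof. by case: g_hat. Qed.
Let jh : nint setT h. Proof. exact: nint_band_limited. Qed.
Let sh : sqint h. Proof. exact: inL2_sqint. Qed.
Let jhD : nint D h. Proof. exact: sqint_nint. Qed.

(** Taken at x = j, this says that the samples of g are the Fourier coefficients of its
    transform, up to normalisation. *)
Lemma PW_inversion x : g x = c0%:C * cint D (fun xi => h xi * cis (x * xi)).
Proof.
rewrite (fourier_inversion x g h g_cont g_hat jh); congr (_ * _).
apply: cint_band_limited.
  exact: (nintM_cis setT measurableT _ (fun xi => x * xi) jh (measurable_lin x setT)).
by apply: band_limited_comp h_band => xi ->; rewrite mul0r.
Qed.

Section FixedOrder.
Variables (k : nat) (k_gt0 : (0 < k)%N) (L : R -> C).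
Hypothesis FL : fundamental alpha k L.
Local Notation P := (Psum alpha k).
Local Notation m := (mult alpha k).

Let mP x : cmeas D (P x).
Proof. by apply: (cmeasS D setT) => //; exact: cmeas_Psum. Qed.

Let P1 x t : nc (P x t) <= 1. Proof. exact: Psum_le1. Qed.

Lemma translate_product j x : g j%:~R * L (x - j%:~R) =
  c0%:C * (((2 * pi)^-1)%:C * fcoef (P x) j * cint D (fun t => h t * char j t)).
Proof.
rewrite PW_inversion (fundamental_translate k L x j k_gt0 FL) -mulrA; congr (_ * _).
by rewrite mulrC.
Qed.

(** The interpolant is a sum of products of Fourier coefficients, evaluated by Parseval's
    identity against the Lipschitz function Psum x. *)
Lemma interp_symsum x :
  ccvg (symsum (fun j => g j%:~R * L (x - j%:~R))) (c0%:C * cint D (fun t => h t * P x t)).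
Proof.
have [K K0 lip] := Psum_lipschitz alpha alpha_gt0 k k_gt0 x (3 * pi).
have clip := circle_lipschitz (P x) K (Psum_periodic alpha alpha_gt0 k k_gt0 x) lip.
have K4 : 0 <= 4 * K by rewrite mulr_ge0.
have := ccvgZ c0%:C _ _ (parseval_pairing h (P x) (4 * K) 1 jhD (mP x) K4 (fun t _ => P1 x t) clip).
congr (ccvg _ _); apply/funext => N; rewrite -symsumZ.
by apply: eq_bigr => i _; rewrite translate_product.
Qed.

(** Both factors have square-summable Fourier coefficients, by Bessel's inequality. *)
Lemma interp_abs_summable x : exists M, forall s, uniq s ->
  \sum_(j <- s) nc (g j%:~R * L (x - j%:~R)) <= M.
Proof.
pose A := c0 * (2 * pi)^-1.
have A0 : 0 <= A by rewrite mulr_ge0 ?c0_ge0// invr_ge0 mulr_ge0// pi_ge0.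
have sP : sqint (P x) by apply: (sqint_bounded _ 1).
pose B f := 2 * pi * Rintegral mu D (fun t => nc (f t) ^+ 2).
exists (A * (B (P x) + B h)) => s us.
have us' : uniq [seq - j | j <- s] by rewrite map_inj_uniq//; exact: oppr_inj.
have b1 := bessel (P x) s sP us; have b2 := bessel h _ sh us'.
rewrite big_map in b2.
apply: (@le_trans _ _ (A * (\sum_(j <- s) nc (fcoef (P x) j) ^+ 2 +
   \sum_(j <- s) nc (fcoef h (- j)) ^+ 2))); last first.
  by rewrite ler_wpM2l// lerD.
rewrite -big_split mulr_sumr; apply: ler_sum => j _ /=.
rewrite translate_product !ncM !ncr !ger0_norm ?c0_ge0 ?invr_ge0 ?mulr_ge0 ?pi_ge0//.
have -> : cint D (fun t => h t * char j t) = fcoef h (- j) by rewrite /fcoef opprK.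
move: (nc_ge0 (fcoef (P x) j)) (nc_ge0 (fcoef h (- j))).
move: (nc (fcoef (P x) j)) (nc (fcoef h (- j))) => a b a0 b0.
have -> : c0 * ((2 * pi)^-1 * a * b) = A * (a * b) by rewrite /A !mulrA.
by rewrite ler_wpM2l//; have := sqr_ge0 (a - b); nra.
Qed.

Lemma interpE x : interp L g x = c0%:C * cint D (fun t => h t * P x t).
Proof.
have [M HM] := interp_abs_summable x.
exact: (csumZ_symsum _ M _ HM (interp_symsum x)).
Qed.

(** The integrand of the error: interpolation replaces the character e^(ixt) by its
    average Psum x. *)
Definition defect (x t : R) : C := h t * (cis (x * t) - P x t).

Let mdef x : cmeas D (fun t => cis (x * t) - P x t).
Proof. by apply: cmeasB => //; apply: cmeas_cis; exact: measurable_lin. Qed.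

Let near x t : nc (cis (x * t) - P x t) <= 2 * (1 - m t).
Proof. exact: Psum_near. Qed.

Let m01 t : 0 <= 1 - m t <= 1.
Proof. by rewrite subr_ge0 mult_le1//= lerBlDr lerDl mult_ge0. Qed.

Let le2 x t : nc (cis (x * t) - P x t) <= 2.
Proof. by apply: (le_trans (near x t)); have := m01 t; lra. Qed.

Lemma nint_defect x : nint D (defect x).
Proof. by apply: (nintM_bounded D mD _ _ 2 jhD (mdef x)) => t _; exact: le2. Qed.

Lemma error_defect x : g x - interp L g x = c0%:C * cint D (defect x).
Proof.
rewrite PW_inversion interpE -mulrBr; congr (_ * _).
have j1 := nintM_cis D mD _ (fun t => x * t) jhD (measurable_lin x D).
have j2 := nintM_bounded D mD _ _ 1 jhD (mP x) (fun t _ => P1 x t).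
by rewrite -(cintB D mD _ _ j1 j2); apply: eq_cint => t _; rewrite /defect mulrBr.
Qed.

(** Integral translates of x multiply the defect by characters. *)
Lemma error_translate (j : int) x :
  g (x + j%:~R) - interp L g (x + j%:~R) = c0%:C * fcoef (defect x) (- j).
Proof.
rewrite error_defect /fcoef opprK; congr (_ * _); apply: eq_cint => t _.
rewrite /defect Psum_char// mulrDl cisD -[cis (j%:~R * t)]/(char j t).
by rewrite -mulrBl mulrA.
Qed.

(** The defect is at most twice the mass that the multiplier leaves to the other
    translates; the next two quantities integrate this bound. *)
Definition sup_bound : R := c0 * Rintegral mu D (fun t => nc (h t) * (2 * (1 - m t))).
Definition l2_bound : R := Rintegral mu D (fun t => nc (h t) ^+ 2 * (2 * (1 - m t)) ^+ 2).

Let mm : measurable_fun D (fun t => 1 - m t).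
Proof.
apply: measurable_funB; first exact: measurable_cst.
by apply: measurable_funTS; exact: measurable_mult.
Qed.

Lemma rint_sup_bound : rint D (fun t => nc (h t) * (2 * (1 - m t))).
Proof.
apply: (rint_le D mD _ (fun t => 2 * nc (h t))).
- apply: measurable_funM; first by case: jhD => /measurable_nc.
  by apply: measurable_funM => //; exact: measurable_cst.
- by apply: rintZ; [exact: mD|case: jhD].
- move=> t _; have := m01 t; have := nc_ge0 (h t) => a b.
  by rewrite ger0_norm; nra.
Qed.

Lemma rint_l2_bound : rint D (fun t => nc (h t) ^+ 2 * (2 * (1 - m t)) ^+ 2).
Proof.
apply: (rint_le D mD _ (fun t => 4 * nc (h t) ^+ 2)).
- apply: measurable_funM; first by case: sh => /measurable_nc2.
  by apply: measurable_funX; apply: measurable_funM => //; exact: measurable_cst.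
- by apply: rintZ; [exact: mD|case: sh].
- move=> t _; have b := m01 t; rewrite ger0_norm; last by rewrite mulr_ge0 ?sqr_ge0.
  by rewrite mulrC ler_wpM2r ?sqr_ge0//; nra.
Qed.

Lemma error_sup x : nc (g x - interp L g x) <= sup_bound.
Proof.
rewrite error_defect ncM ncr ger0_norm ?c0_ge0// ler_wpM2l ?c0_ge0//.
apply: (le_trans (nc_cint_le D mD _ (nint_defect x))).
apply: le_Rintegral; [exact: mD|by case: (nint_defect x)|exact: rint_sup_bound|].
move=> t _; rewrite -[X in X <= _]/(nc (h t * (cis (x * t) - P x t))) ncM ler_wpM2l ?nc_ge0//.
Qed.

Lemma sqint_defect x : sqint (defect x).
Proof.
split; first by case: (nint_defect x).
apply: (rint_le D mD _ _ _ rint_l2_bound).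
  by apply: measurable_nc2; case: (nint_defect x).
move=> t _; rewrite ger0_norm ?sqr_ge0// ncM exprMn ler_wpM2l ?sqr_ge0//.
by rewrite ler_sqr ?nnegrE ?nc_ge0 ?near// (le_trans (nc_ge0 _) (near x t)).
Qed.

(** The errors at the points x + j are Fourier coefficients of the defect, which Bessel's
    inequality controls together. *)
Lemma error_lattice x N :
  symsum (fun j : int => nc (g (x + j%:~R) - interp L g (x + j%:~R)) ^+ 2) N <= l2_bound.
Proof.
have us : uniq [seq - j | j <- sidxs N].
  by rewrite map_inj_uniq ?sidxs_uniq//; exact: oppr_inj.
have b := bessel (defect x) _ (sqint_defect x) us; rewrite big_map in b.
rewrite symsumE; under eq_bigr do rewrite error_translate ncM ncr ger0_norm ?c0_ge0// exprMn.
rewrite -mulr_sumr; apply: (@le_trans _ _ (c0 ^+ 2 *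
   (2 * pi * Rintegral mu D (fun t => nc (defect x t) ^+ 2)))).
  by rewrite ler_wpM2l ?sqr_ge0.
rewrite mulrA expr2 c0_sqr mul1r; apply: le_Rintegral.
- exact: mD.
- by case: (sqint_defect x).
- exact: rint_l2_bound.
- move=> t _; rewrite ncM exprMn ler_wpM2l ?sqr_ge0//.
  by rewrite ler_sqr ?nnegrE ?nc_ge0 ?near// (le_trans (nc_ge0 _) (near x t)).
Qed.

Lemma cmeas_error : cmeas setT (fun x => g x - interp L g x).
Proof.
have mg := ccontinuous_cmeas g g_cont; have [mR mI] := ccontinuous_cmeas L FL.1.
apply: cmeasB => //.
apply: (@cmeas_lim R _ (measurableTypeR R) setT (fun N x => symsum (fun j => g j%:~R * L (x - j%:~R)) N)) => // [N|x _].
  apply: cmeas_sum => i; apply: cmeasZ.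
  by split; [exact: (measurableT_comp mR (measurable_shift _))|exact: (measurableT_comp mI (measurable_shift _))].
rewrite interpE; exact: interp_symsum.
Qed.

(** Integrating the bound on the lattice x + Z over a unit interval gives the integral of
    the squared error over the whole line. *)
Lemma error_L2 :
  (\int[mu]_x (nc (g x - interp L g x) ^+ 2)%:E <= l2_bound%:E)%E.
Proof.
have eqj (j : int) : 2 * 2^-1 * j%:~R = j%:~R :> R by rewrite divff ?mul1r ?pnatr_eq0.
set f := fun x => nc (g x - interp L g x) ^+ 2.
have mf : measurable_fun setT f by apply: measurable_nc2; exact: cmeas_error.
have r0 : 0 < 2^-1 :> R by rewrite invr_gt0.
have f0 x : 0 <= f x by rewrite sqr_ge0.
have fM x : `|f x| <= sup_bound ^+ 2.
  rewrite ger0_norm// /f ler_sqr ?nnegrE ?nc_ge0 ?error_sup//.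
  exact: (le_trans (nc_ge0 _) (error_sup x)).
pose I := `](- 2^-1), 2^-1]%classic : set R.
have mI : measurable I by exact: measurable_itv.
have jI (j : int) : rint I (fun x => f (x + j%:~R)).
  apply: (rint_itv_bounded _ (sup_bound ^+ 2)) => //.
  exact: (measurableT_comp mf (measurable_shift j%:~R)).
have one : mu I = 1%:E.
  rewrite /I lebesgue_measure_itv/= ifT; last by rewrite lte_fin; lra.
  by rewrite -EFinB; congr EFin; lra.
have win N : (\int[mu]_(x in window 2^-1 N) (f x)%:E <= l2_bound%:E)%E.
  have jw : rint (window 2^-1 N) f by exact: (rint_itv_bounded f _ _ _ mf fM).
  have -> : (\int[mu]_(x in window 2^-1 N) (f x)%:E = (Rintegral mu (window 2^-1 N) f)%:E)%E.
    by rewrite /Rintegral fineK//; apply: (@integrable_fin_num _ (measurableTypeR R)) => //; exact: measurable_window.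
  rewrite lee_fin (tiling f 2^-1 (sup_bound ^+ 2) N r0 mf fM) -/I.
  have -> : symsum (fun j : int => Rintegral mu I (fun x => f (x + 2 * 2^-1 * j%:~R))) N =
      Rintegral mu I (fun x => symsum (fun j : int => f (x + j%:~R)) N).
    rewrite /symsum (Rintegral_fsum I mI _ _ _ (fun i => jI _)).
    by apply: eq_bigr => i _; congr (Rintegral mu I _); apply/funext => x; rewrite eqj.
  have -> : l2_bound = Rintegral mu I (fun=> l2_bound).
    rewrite Rintegral_cst//.
    set t := fine _; suff -> : t = 1 by rewrite mulr1.
    by rewrite /t [X in fine X]one.
  apply: le_Rintegral => //.
  - by rewrite /symsum; apply: rint_fsum.
  - by apply: (rint_itv_bounded _ `|l2_bound|).
  - by move=> x _; exact: error_lattice.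
have : (\int[mu]_x (f x)%:E = \int[mu]_(x in \bigcup_N window 2^-1 N) (f x)%:E)%E.
  by rewrite window_bigcup.
move=> ->.
have mono : nondecreasing_seq (window (2^-1 : R)).
  apply/nondecreasing_seqP => n; apply/subsetPset => x; rewrite /window /= !in_itv/=.
  have l : n.*2.+1%:R * 2^-1 <= n.+1.*2.+1%:R * 2^-1 :> R.
    by rewrite ler_wpM2r// ler_nat doubleS; lia.
  by move: l; set a := n.*2.+1%:R * _; set b := n.+1.*2.+1%:R * _ => l /andP[u v]; apply/andP; split; lra.
have mEf (E : set R) : measurable_fun E (EFin \o f) by apply/measurable_EFinP; exact: measurable_funTS.
have cv := @ge0_nondecreasing_set_cvg_integral _ (measurableTypeR R) R (window 2^-1) (EFin \o f) mu mono
  (fun N => measurable_window _ _) (fun N => mEf (window 2^-1 N)) (fun N x _ => f0 x).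
rewrite -(cvg_lim _ cv)//; apply: lime_le; first by apply/cvg_ex; eexists; exact: cv.
by apply: nearW => N; exact: win.
Qed.

End FixedOrder.
End PaleyWiener.
End Interpolation.

(** * Convergence *)

Section Limits.
Context {R : realType}.
Local Notation C := R[i].
Local Notation nc := (@Normc.normc R).
Local Notation mu := (@lebesgue_measure R).
Local Notation D := (@period R).
Local Notation mD := (@measurable_period R).
Variables (alpha : R) (alpha_gt0 : 0 < alpha).

Lemma L2norm_le (f : R -> C) (b : R) :
  (\int[mu]_x (nc (f x) ^+ 2)%:E <= b%:E)%E -> (L2norm f <= (Num.sqrt b)%:E)%E.
Proof.
rewrite -L2norm_sqr; have := L2norm_ge0 f; case: (L2norm f) => [r| |]//=.
- rewrite !lee_fin => r0; rewrite powR_mulrn// => rb.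
  by rewrite -(ger0_norm r0) -sqrtr_sqr ler_wsqrtr.
- by rewrite gt_eqF.
Qed.

Section Bounds.
Variable h : R -> C.
Hypothesis sh : sqint h.

Let jh : nint D h. Proof. exact: sqint_nint. Qed.

Let mm n : measurable_fun D (fun t => 2 * (1 - mult alpha n.+1 t)).
Proof.
apply: measurable_funM; first exact: measurable_cst.
apply: measurable_funB; first exact: measurable_cst.
by apply: measurable_funTS; exact: measurable_mult.
Qed.

Let cv t : D t -> 2 * (1 - mult alpha n.+1 t) @[n --> \oo] --> 0.
Proof.
move=> Dt; rewrite -[0](mulr0 2) -[X in 2 * X](subrr 1).
apply: cvgM; first exact: cvg_cst.
by apply: cvgB; [exact: cvg_cst|exact: mult_cvg1].
Qed.

Let m01 n t : 0 <= 2 * (1 - mult alpha n.+1 t) <= 2.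
Proof.
have := mult_ge0 alpha alpha_gt0 n.+1 isT t; have := mult_le1 alpha alpha_gt0 n.+1 isT t.
by lra.
Qed.

(** The multiplier tends to 1 inside the period, and the integrands are dominated. *)
Lemma sup_bound_cvg0 : sup_bound alpha h n.+1 @[n --> \oo] --> 0.
Proof.
rewrite -[0](mulr0 c0); apply: cvgM; first exact: cvg_cst.
rewrite -[0](_ : Rintegral mu D (fun=> 0) = 0); last by rewrite Rintegral_cst_period mul0r.
apply: (rdct D mD _ _ (fun t => 2 * nc (h t))).
- by move=> n; apply: measurable_funM => //; case: jh => /measurable_nc.
- exact: measurable_cst.
- by apply: rintZ; [exact: mD|case: jh].
- move=> n t _; rewrite normrM (ger0_norm (nc_ge0 _)) mulrC ler_wpM2r ?nc_ge0//.
  by have /andP[a b] := m01 n t; rewrite ger0_norm.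
- move=> t Dt; rewrite -[0](mulr0 (nc (h t))).
  by apply: cvgM; [exact: cvg_cst|exact: cv].
Qed.

Lemma l2_bound_cvg0 : l2_bound alpha h n.+1 @[n --> \oo] --> 0.
Proof.
rewrite -[0](_ : Rintegral mu D (fun=> 0) = 0); last by rewrite Rintegral_cst_period mul0r.
apply: (rdct D mD _ _ (fun t => 4 * nc (h t) ^+ 2)).
- move=> n; apply: measurable_funM => //; first by case: sh => /measurable_nc2.
  exact: measurable_funX.
- exact: measurable_cst.
- by apply: rintZ; [exact: mD|case: sh].
- move=> n t _; rewrite normrM (ger0_norm (sqr_ge0 _)) mulrC ler_wpM2r ?sqr_ge0//.
  by have /andP[a b] := m01 n t; rewrite ger0_norm ?sqr_ge0//; nra.
- move=> t Dt; rewrite -[0](mulr0 (nc (h t) ^+ 2)) -[X in _ * X](mulr0 0).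
  apply: cvgM; first exact: cvg_cst.
  by apply: (cvgM (cv t Dt) (cv t Dt)).
Qed.

End Bounds.
End Limits.

Theorem theorem1 (R : realType) (alpha : R) (alpha_gt0 : 0 < alpha)
    (L : nat -> R -> R[i])
    (L_fundamental : forall k, (0 < k)%N -> fundamental alpha k (L k))
    (g : R -> R[i]) (g_PW : PW g) :
  (L2norm (fun x => g x - interp (L k) g x) @[k --> \oo] --> 0%E) /\
  {uniform, (fun k x => Normc.normc (g x - interp (L k) g x)) @ \oo --> (fun=> 0 : R)}.
Proof.
have [gc [h gh bh]] := g_PW.
have sh : sqint h by case: gh => _ h2 _; exact: inL2_sqint.
split.
  (* the orders of interpolation start at 1 *)
  rewrite -cvg_shiftS.
  have low : (fun _ : nat => 0%E : \bar R) n @[n --> \oo] --> 0%E by exact: cvg_cst.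
  have up : (Num.sqrt (l2_bound alpha h n.+1))%:E @[n --> \oo] --> 0%E.
    apply: cvg_EFin; first by apply: nearW.
    rewrite -[0]sqrtr0; apply: continuous_cvg; first exact: sqrt_continuous.
    exact: (l2_bound_cvg0 alpha alpha_gt0 h sh).
  apply: squeeze_cvge low up; apply: nearW => n; rewrite L2norm_ge0/=; apply: L2norm_le.
  exact: (error_L2 alpha alpha_gt0 g h gc gh bh n.+1 isT (L n.+1) (L_fundamental n.+1 isT)).
move=> Q /uniform_nbhs[E [entE sub]].
have [e /= e0 eE] : exists2 e : R, 0 < e & forall a b, ball a e b -> E (a, b).
  move: entE; rewrite -entourage_ballE => -[e /= e0 eE]; exists e => // a b ab.
  by apply: eE.
have /cvgrPdistC_lt/(_ _ e0)[N _ HN] := sup_bound_cvg0 alpha alpha_gt0 h sh.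
exists N.+1 => // -[//|n] /= nN; apply: sub => x _; apply: eE.
rewrite /ball/= sub0r normrN ger0_norm ?nc_ge0//.
have := HN n nN; rewrite /= subr0 => /(le_lt_trans (ler_norm _)); apply: le_lt_trans.
exact: (error_sup alpha alpha_gt0 g h gc gh bh n.+1 isT (L n.+1) (L_fundamental n.+1 isT)).
Qed.
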